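(* Let $p,q$ be relatively prime positive integers, let $\alpha>0$ and $\lambda\in[0,1]$, and consider the seasonal oscillator $$\dot\psi=\omega+\eta f(\psi)+\varepsilon g_\lambda(\varphi),\qquad \dot\varphi=1,\qquad \omega=\tfrac pq+\sigma,$$ on the two-torus, where $f$ and $g_\lambda$ are $C^\infty$ functions on $S^1=\mathbb R/\mathbb Z$ and $\sigma,\eta,\varepsilon$ are small real parameters, not necessarily of the same order. Here $g_\lambda$ is the smoothed block function defined in the context. Then the vectorfield approximation up to degree two of the Poincaré map of this system is $$\dot u=\sigma-\frac qp\Big(\eta^2\sum_{k} f_kf_{-k}+\varepsilon\eta\sum_{m} f_{mq}\,g_{-mp}(\lambda)\,e^{2\pi i m q u}\Big),$$ where $u=x-\frac pq y$, with $(x,y)\in\mathbb R^2$ the lifts of $(\psi,\varphi)$, and the sums run over $k,m\in\mathbb Z$. The Fourier coefficients of $f$ and $g_\lambda$ are $f_k$ and $g_k(\lambda)$ respectively, where $$g_k(\lambda)=\exp\!\Big(-\frac{\pi^2k^2}{\alpha}\Big)\,\frac{i}{2\pi k}\,\big(\exp(-2\pi i k\lambda)-1\big)\quad (k\neq 0),\qquad g_0(\lambda)=\lambda.$$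
   Context: Fourier coefficients are taken with respect to $e^{2\pi i k x}$, so $f(x)=\sum_{k\in\mathbb Z} f_k e^{2\pi i k x}$, and similarly for $g_\lambda$. The forcing: $g_\lambda$ is the convolution of $\phi(x)=\sqrt{\alpha/\pi}\,e^{-\alpha x^2}$ with the 1-periodic block function equal to $1$ on $[0,\lambda)$ and $0$ on $[\lambda,1)$. Poincaré map: the lift of the system to $\mathbb R^2$ is $\dot x=\frac pq+\sigma+\eta f(x)+\varepsilon g_\lambda(y)$, $\dot y=1$. If $\Phi_t$ is its flow, the (lift of the) Poincaré map $F$ is defined by $(F(x),1)=\Phi_1(x,0)$. Degree: $\mathrm{degree}(x)=\mathrm{degree}(y)=0$, $\mathrm{degree}(\eta)=\mathrm{degree}(\varepsilon)=1$, $\mathrm{degree}(\sigma)=2$. Thus the lifted vector field is $X=X_0+X_1+X_2$ with $X_0=\frac pq\frac{\partial}{\partial x}+\frac{\partial}{\partial y}$ of degree 0, $X_1=(\eta f(x)+\varepsilon g_\lambda(y))\frac{\partial}{\partial x}$ of degree 1 and $X_2=\sigma\frac{\partial}{\partial x}$ of degree 2. Vectorfield approximation: a term $e^{2\pi i(kx+ly)}\frac{\partial}{\partial x}$ is resonant if $pk+ql=0$. By near-identity transformations generated by vector fields of the form $a(x,y)\frac{\partial}{\partial x}$, with $a$ 1-periodic in $x$ and $y$, the non-resonant terms of $X$ are removed degree by degree in the parameters. The result is truncated after degree two, giving a vector field $\tilde X$ containing only resonant terms besides $X_0$. In the coordinates $u=x-\frac pq y$, $v=y$, the truncated field takes the form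 $V(u)\frac{\partial}{\partial u}+\frac{\partial}{\partial v}$, and $\dot u=V(u)$ is called the vectorfield approximation up to degree two of the Poincaré map. If $\tilde F$ is the Poincaré map of the truncated field (an approximation of $F$), then $\tilde F^q-p$ is the time-$q$ flow of $\dot u=V(u)$.
   Formalization: The printed formula omits resonant constant terms (f=0, λ=1/2 gives u'=σ+ε/2, not σ). The formal theorem adds M(1+(q/p)ηf_0), M=ηf_0+εg_0(λ), to the right-hand side, and takes the generators without resonant Fourier modes so that the approximation is unique. *)

(* Defs.v *)
From Stdlib Require Export Reals ZArith Lra.
From Coquelicot Require Export Coquelicot.

Open Scope R_scope.

(** * Fourier coefficients and two-sided series *)

(* [expi t] is e^{it}. *)
Definition expi (t : R) : C := (cos t, sin t).

Definition fcoef (h : R -> R) (k : Z) : C :=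
  RInt (V := C_R_CompleteNormedModule)
    (fun x => (RtoC (h x) * expi (- (2 * PI * IZR k * x)))%C) 0 1.

Definition fcoef2 (h : R -> R -> R) (k l : Z) : C :=
  RInt (V := C_R_CompleteNormedModule)
    (fun x => RInt (V := C_R_CompleteNormedModule)
      (fun y => (RtoC (h x y) * expi (- (2 * PI * (IZR k * x + IZR l * y))))%C)
      0 1) 0 1.

(* The two halves converge separately, which is stronger than convergence of
   the symmetric partial sums. *)
Definition is_zseries (c : Z -> C) (s : C) : Prop :=
  exists s1 s2 : C,
    is_series (V := C_R_NormedModule) (fun n => c (Z.of_nat n)) s1 /\
    is_series (V := C_R_NormedModule) (fun n => c (- Z.of_nat (S n))%Z) s2 /\
    s = (s1 + s2)%C.

(** * Smooth functions on the circle and on the two-torus *)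

Definition smooth (h : R -> R) : Prop := forall n x, ex_derive_n h n x.

Definition periodic (h : R -> R) : Prop := forall x, h (x + 1) = h x.

Definition dx (h : R -> R -> R) : R -> R -> R :=
  fun x y => Derive (fun s => h s y) x.
Definition dy (h : R -> R -> R) : R -> R -> R :=
  fun x y => Derive (fun s => h x s) y.

Fixpoint Ck2 (n : nat) (h : R -> R -> R) : Prop :=
  (forall x y, continuity_2d_pt h x y) /\
  match n with
  | O => True
  | S m =>
      (forall x y, ex_derive (fun s => h s y) x /\ ex_derive (fun s => h x s) y)
      /\ Ck2 m (dx h) /\ Ck2 m (dy h)
  end.

Definition smooth2 (h : R -> R -> R) : Prop := forall n, Ck2 n h.

Definition periodic2 (h : R -> R -> R) : Prop :=
  forall x y, h (x + 1) y = h x y /\ h x (y + 1) = h x y.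

(** * The forcing *)

Definition phi (alpha x : R) : R := sqrt (alpha / PI) * exp (- alpha * x ^ 2).

(* 1-periodic, equal to 1 on [0,lambda) and to 0 on [lambda,1). *)
Definition block (lambda x : R) : R :=
  if Rlt_dec (frac_part x) lambda then 1 else 0.

Definition forcing (alpha lambda : R) (x : R) : R :=
  RInt_gen (V := R_CompleteNormedModule)
    (fun s => phi alpha (x - s) * block lambda s)
    (Rbar_locally m_infty) (Rbar_locally p_infty).

Definition forcing_coef (alpha lambda : R) (k : Z) : C :=
  if Z.eq_dec k 0 then RtoC lambda
  else (RtoC (exp (- (PI ^ 2 * IZR k ^ 2) / alpha))
        * (Ci / RtoC (2 * PI * IZR k))
        * (expi (- (2 * PI * IZR k * lambda)) - 1))%C.

(** * Parameters, degree, and vector fields on the plane *)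

Record param := Param { sigma : R; eta : R; eps : R }.

(* degree(sigma) = 2 and degree(eta) = degree(eps) = 1. *)
Definition rescale (t : R) (P : param) : param :=
  Param (t ^ 2 * sigma P) (t * eta P) (t * eps P).

Definition homogeneous (d : nat) (h : param -> R) : Prop :=
  forall t P, h (rescale t P) = t ^ d * h P.

(* Components with respect to d/dx and d/dy. *)
Definition vfield := R -> R -> R * R.

Definition along_x (a : R -> R -> R) : vfield := fun x y => (a x y, 0).

(* X = X_0 + X_1 + X_2 with X_d of degree d in the parameters; the value of
   [G] at indices greater than 2 plays no role. *)
Definition degree_parts (X : param -> vfield) (G : nat -> param -> vfield) : Prop :=
  (forall d x y, homogeneous d (fun P => fst (G d P x y)) /\
                 homogeneous d (fun P => snd (G d P x y))) /\
  (forall P x y,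
     X P x y = (fst (G 0%nat P x y) + fst (G 1%nat P x y) + fst (G 2%nat P x y),
                snd (G 0%nat P x y) + snd (G 1%nat P x y) + snd (G 2%nat P x y))).

Definition dir_derive (Y : vfield) (h : R -> R -> R) (x y : R) : R :=
  fst (Y x y) * dx h x y + snd (Y x y) * dy h x y.

Definition bracket (Y Z : vfield) : vfield := fun x y =>
  (dir_derive Y (fun a b => fst (Z a b)) x y
   - dir_derive Z (fun a b => fst (Y a b)) x y,
   dir_derive Y (fun a b => snd (Z a b)) x y
   - dir_derive Z (fun a b => snd (Y a b)) x y).

(* If Y has degree d >= 1 and Phi is its time-one flow, the pull-back of
   X = sum_n X_n under the near-identity transformation Phi is
   exp(ad_Y) X = sum_j ad_Y^j X / j!.  This is its part of degree n. *)
Definition lie_transform (d : nat) (Y : vfield) (X : nat -> vfield) (n : nat) :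
    vfield := fun x y =>
  let term j := Nat.iter j (bracket Y) (X (n - j * d)%nat) x y in
  let total (c : R * R -> R) :=
    sum_f_R0 (fun j => / INR (fact j) * c (term j)) (n / d) in
  (total fst, total snd).

(** * Resonance and the vectorfield approximation *)

Definition resonant_index (p q k l : Z) : Prop := (p * k + q * l = 0)%Z.

Definition resonant_field (p q : Z) (Y : vfield) : Prop :=
  (forall x y, snd (Y x y) = 0) /\
  (forall k l, ~ resonant_index p q k l ->
     fcoef2 (fun x y => fst (Y x y)) k l = RtoC 0).

(* Admissible generator a(x,y) d/dx of degree d.  Removing a non-resonant term
   only takes the same (non-resonant) Fourier mode in the generator; a resonant
   mode is in the kernel of ad_{X_0} and removes nothing, so it is excluded.
   This fixes the generator, hence the normal form, uniquely. *)
Definition generator (p q : Z) (d : nat) (a : param -> R -> R -> R) : Prop :=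
  (forall x y, homogeneous d (fun P => a P x y)) /\
  (forall P, smooth2 (a P) /\ periodic2 (a P) /\
     forall k l, resonant_index p q k l -> fcoef2 (a P) k l = RtoC 0).

(* u' = V(u) is the vectorfield approximation up to degree two: generators of
   degree one and two make the terms of degree one and two resonant, and the
   truncated field W (the sum of the terms of degree at most two) reads
   V(u) d/du + d/dv in the coordinates u = x - (p/q) y, v = y, in which
   u' = W_x - (p/q) W_y and v' = W_y. *)
Definition vf_approximation (p q : Z) (X : param -> vfield)
    (V : param -> R -> R) : Prop :=
  exists (G : nat -> param -> vfield) (a1 a2 : param -> R -> R -> R),
    degree_parts X G /\ generator p q 1 a1 /\ generator p q 2 a2 /\
    forall P : param,
      let N := lie_transform 2 (along_x (a2 P))
                 (lie_transform 1 (along_x (a1 P)) (fun d => G d P)) in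
      let Wx x y := fst (N 0%nat x y) + fst (N 1%nat x y) + fst (N 2%nat x y) in
      let Wy x y := snd (N 0%nat x y) + snd (N 1%nat x y) + snd (N 2%nat x y) in
      resonant_field p q (N 1%nat) /\
      resonant_field p q (N 2%nat) /\
      forall x y,
        Wx x y - IZR p / IZR q * Wy x y = V P (x - IZR p / IZR q * y) /\
        Wy x y = 1.

(* The lift to the plane of the seasonal oscillator. *)
Definition oscillator (p q : Z) (f g : R -> R) (P : param) : vfield :=
  fun x y => (IZR p / IZR q + sigma P + eta P * f x + eps P * g y, 1).

(* Main.v *)
Require Import Defs.
From Stdlib Require Import FunctionalExtensionality Lia.

(** Put om = p/q and let D = om d/dx + d/dy be the derivative along X_0.  Every
orbit of X_0 on the torus closes after time q.  Hence a smooth function h on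
the torus splits as h = A h + D (T h), where A h is the mean of h over the
orbit through the given point and T h is the integral of h along that orbit
against the weight (t - q/2)/q, by an integration by parts along the orbit
([antider_spec]; [avg] and [antider] are A and T).  T h is again smooth, and as
its weight has mean zero, it has no resonant Fourier coefficient.

The bracket with X_0 acts on a d/dx as -D, so the generators are explicit:
a1 = T X_1, which leaves the mean m = eta f_0 + eps g_0 in degree one, and a2 =
T (second-order terms), which leaves sigma plus their orbit mean in degree two.
Inserting D a1 = X_1 - m into the Lie series, the second-order terms are
(a1 d_x X_1 - X_1 d_x a1)/2 - m (d_x a1)/2, and d_x a1 is (q/p) eta (f - f_0).
Since eta f' is (q/p) D of eta f, one more integration by parts along the
orbits turns their mean into the mean of -(q/p) eta (f - f_0) X_1
([avg_quadratic_source]).  Expanding this gives the quadratic terms of the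
theorem with A (f^2) and A (f g) in place of the two series; the terms with m
are there because f and g need not have mean zero.

A (f g) is constant along the orbits, so it is a function of u alone, of period
1/q.  Averaging does not change resonant coefficients, so its coefficient at
the frequency m q is that of f(x) g(y) at (m q, -m p), that is
f_(mq) g_(-mp).  The inversion theorem for twice differentiable functions on
the circle then sums the series ([invariant_series]).  The case p = q = 1,
g = f, u = 0 is the Parseval identity for f, which gives the other series.

Uniqueness.  Changing the signs of eta and eps changes the sign of the degree
one part and fixes the degree two part, so if their sum is a function of u,
each of them is.  Averaging the degree one part then shows D a1' = X_1 - m for
any admissible a1'.  The difference of two admissible a1 is constant along the
orbits and has no resonant coefficient, hence vanishes by [invariant_series];
averaging the degree two part now determines it, since the mean of D a2 is 0.

The forcing equals the integral of theta (x - s) over s in [0, lambda], where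
theta is the periodized Gaussian.  So it is smooth, and its coefficients are
those of theta, which are values of the Fourier transform of the Gaussian,
times those of the block.  The Fourier transform is obtained from the Gaussian
integral through a differential equation in the frequency, on finite intervals
([gauss_cos_bound]). *)

(** * Continuity and integrals of continuous functions *)

Definition Cts (f : R -> R) : Prop := forall x, continuous f x.
Definition Cts2 (F : R -> R -> R) : Prop := forall x y, continuity_2d_pt F x y.

Lemma Cts_const c : Cts (fun _ => c).
Proof. intros x; apply continuous_const. Qed.
Lemma Cts_id : Cts (fun x => x).
Proof. intros x; apply continuous_id. Qed.
Lemma Cts_plus f g : Cts f -> Cts g -> Cts (fun x => f x + g x).
Proof. intros Hf Hg x; apply (continuous_plus f g); auto. Qed.
Lemma Cts_opp f : Cts f -> Cts (fun x => - f x).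
Proof. intros Hf x; apply (continuous_opp f); auto. Qed.
Lemma Cts_minus f g : Cts f -> Cts g -> Cts (fun x => f x - g x).
Proof. intros Hf Hg x; apply (continuous_minus f g); auto. Qed.
Lemma Cts_mult f g : Cts f -> Cts g -> Cts (fun x => f x * g x).
Proof. intros Hf Hg x; apply (continuous_mult f g); auto. Qed.
Lemma Cts_comp f g : Cts f -> Cts g -> Cts (fun x => g (f x)).
Proof. intros Hf Hg x; apply (continuous_comp f g); auto. Qed.
Lemma Cts_cos : Cts cos.
Proof. intros x; apply continuous_cos. Qed.
Lemma Cts_sin : Cts sin.
Proof. intros x; apply continuous_sin. Qed.
Lemma Cts_exp : Cts exp.
Proof. intros x; apply continuous_exp. Qed.
Lemma Cts_derive (f f' : R -> R) : (forall x, is_derive f x (f' x)) -> Cts f.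
Proof. intros H x; apply (ex_derive_continuous f); exists (f' x); apply H. Qed.
Lemma Cts_ex_derive (f : R -> R) : (forall x, ex_derive f x) -> Cts f.
Proof. intros H x; apply (ex_derive_continuous f), H. Qed.
Lemma Cts_pow f n : Cts f -> Cts (fun x => f x ^ n).
Proof.
  intros Hf; induction n as [|n IH]; simpl.
  - apply Cts_const.
  - apply Cts_mult; auto.
Qed.

Lemma Cts2_filter F : Cts2 F <-> forall z, continuous (fun u : R * R => F (fst u) (snd u)) z.
Proof.
  split.
  - intros H [x y]; apply (proj1 (continuity_2d_pt_filterlim F x y)), H.
  - intros H x y; apply (proj2 (continuity_2d_pt_filterlim F x y)), (H (x, y)).
Qed.

Lemma Cts2_comp H F G : Cts2 H -> Cts2 F -> Cts2 G -> Cts2 (fun x y => H (F x y) (G x y)).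
Proof.
  rewrite !Cts2_filter; intros HH HF HG z.
  apply (continuous_comp_2 (fun u : R * R => F (fst u) (snd u)) (fun u => G (fst u) (snd u)) H).
  - apply HF.
  - apply HG.
  - apply (HH (_, _)).
Qed.

(** A version of [Cts2_comp] for outer functions of one variable, so that continuity
proofs can follow the shape of a term. *)
Lemma Cts2_comp1 h F : Cts h -> Cts2 F -> Cts2 (fun x y => h (F x y)).
Proof.
  rewrite !Cts2_filter; intros Hh HF z.
  apply (continuous_comp (fun u : R * R => F (fst u) (snd u)) h).
  - apply HF.
  - apply Hh.
Qed.

Lemma Cts2_fst : Cts2 (fun x _ => x).
Proof. intros x y; apply continuity_2d_pt_id1. Qed.
Lemma Cts2_snd : Cts2 (fun _ y => y).
Proof. intros x y; apply continuity_2d_pt_id2. Qed.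
Lemma Cts2_const c : Cts2 (fun _ _ => c).
Proof. intros x y; apply continuity_2d_pt_const. Qed.
Lemma Cts2_plus F G : Cts2 F -> Cts2 G -> Cts2 (fun x y => F x y + G x y).
Proof. intros HF HG x y; apply continuity_2d_pt_plus; auto. Qed.
Lemma Cts2_minus F G : Cts2 F -> Cts2 G -> Cts2 (fun x y => F x y - G x y).
Proof. intros HF HG x y; apply continuity_2d_pt_minus; auto. Qed.
Lemma Cts2_mult F G : Cts2 F -> Cts2 G -> Cts2 (fun x y => F x y * G x y).
Proof. intros HF HG x y; apply continuity_2d_pt_mult; auto. Qed.
Lemma Cts2_opp F : Cts2 F -> Cts2 (fun x y => - F x y).
Proof. intros HF x y; apply continuity_2d_pt_opp; auto. Qed.

Lemma Cts2_along F u v : Cts2 F -> Cts u -> Cts v -> Cts (fun t => F (u t) (v t)).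
Proof.
  rewrite Cts2_filter; intros HF Hu Hv t.
  apply (continuous_comp_2 u v F); auto.
Qed.

(** The clauses ending in [assumption] precede the general ones, so that a term such
as [fejer n] counts as a function of one variable. *)
Ltac cts1 :=
  match goal with
  | |- forall _, _ => intro
  | |- continuous ?f ?x => revert x; change (Cts f)
  | |- continuity_2d_pt ?f ?x ?y => revert x y; change (Cts2 f)
  | |- Cts (fun x => x) => apply Cts_id
  | |- Cts (fun x => @?f x + @?g x) => apply (Cts_plus f g)
  | |- Cts (fun x => @?f x - @?g x) => apply (Cts_minus f g)
  | |- Cts (fun x => @?f x * @?g x) => apply (Cts_mult f g)
  | |- Cts (fun x => - @?f x) => apply (Cts_opp f)
  | |- Cts (fun x => @?f x / ?c) => apply (Cts_mult f (fun _ => / c))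
  | |- Cts (fun x => @?f x ^ ?n) => apply (Cts_pow f n)
  | |- Cts cos => apply Cts_cos
  | |- Cts sin => apply Cts_sin
  | |- Cts exp => apply Cts_exp
  | |- Cts2 (fun x y => x) => apply Cts2_fst
  | |- Cts2 (fun x y => y) => apply Cts2_snd
  | |- Cts2 (fun x y => @?f x y + @?g x y) => apply (Cts2_plus f g)
  | |- Cts2 (fun x y => @?f x y - @?g x y) => apply (Cts2_minus f g)
  | |- Cts2 (fun x y => @?f x y * @?g x y) => apply (Cts2_mult f g)
  | |- Cts2 (fun x y => - @?f x y) => apply (Cts2_opp f)
  | |- Cts2 (fun x y => @?f x y / ?c) => apply (Cts2_mult f (fun _ _ => / c))
  | |- Cts (fun x => ?g (@?f x)) => apply (Cts_comp f g); [|assumption]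
  | |- Cts (fun x => ?F (@?f x) (@?g x)) => apply (Cts2_along F f g)
  | |- Cts (fun x => ?g (@?f x)) => apply (Cts_comp f g)
  | |- Cts2 (fun x y => ?g (@?f x y)) => apply (Cts2_comp1 g f); [assumption|]
  | |- Cts2 (fun x y => ?H (@?f x y) (@?g x y)) => apply (Cts2_comp H f g)
  | |- Cts2 (fun x y => ?g (@?f x y)) => apply (Cts2_comp1 g f)
  | |- Cts (?F ?a) => change (Cts (fun y => F a y))
  end.
Ltac cts := repeat first [assumption | progress cbv beta | apply Cts_const | apply Cts2_const | cts1].

(** Integrals take values in the carrier of a normed module, which the arithmetic
tactics do not identify with [R]. *)
Ltac real_equation := match goal with |- @eq _ ?a ?b => change (@eq R a b) end.

Lemma Cts_ex_RInt f a b : Cts f -> ex_RInt f a b.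
Proof. intros H; apply (ex_RInt_continuous f); intros; apply H. Qed.
#[export] Hint Resolve Cts_ex_RInt : core.

Lemma RInt_scal_l f a b c : Cts f -> RInt (fun x => c * f x) a b = c * RInt f a b.
Proof. intros H; apply (RInt_scal f a b c); auto. Qed.
Lemma RInt_plus_R f g a b : Cts f -> Cts g ->
  RInt (fun x => f x + g x) a b = RInt f a b + RInt g a b.
Proof. intros Hf Hg; apply (RInt_plus f g); auto. Qed.
Lemma RInt_minus_R f g a b : Cts f -> Cts g ->
  RInt (fun x => f x - g x) a b = RInt f a b - RInt g a b.
Proof. intros Hf Hg; apply (RInt_minus f g); auto. Qed.
Lemma RInt_const_R a b c : RInt (fun _ => c) a b = (b - a) * c.
Proof. rewrite RInt_const; reflexivity. Qed.
Lemma RInt_Chasles_R f a b c : Cts f -> RInt f a b + RInt f b c = RInt f a c.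
Proof. intros H; apply (RInt_Chasles f a b c); auto. Qed.
Lemma RInt_ext_all (f g : R -> R) a b : (forall x, f x = g x) -> RInt f a b = RInt g a b.
Proof. intros H; apply RInt_ext; intros; apply H. Qed.

(** Multiplied through by [u], so that it also holds for [u = 0]. *)
Lemma RInt_affine f a b u v : Cts f ->
  u * RInt (fun t => f (u * t + v)) a b = RInt f (u * a + v) (u * b + v).
Proof.
  intros H. rewrite <- (RInt_comp_lin f) by auto.
  symmetry; apply (RInt_scal_l (fun t => f (u * t + v))); cts.
Qed.

Lemma RInt_shift f a b c : Cts f ->
  RInt (fun t => f (t + c)) a b = RInt f (a + c) (b + c).
Proof.
  intros H. generalize (RInt_affine f a b 1 c H).
  rewrite !Rmult_1_l; intros <-. apply RInt_ext_all; intros; f_equal; ring.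
Qed.

Lemma RInt_FTC (F f : R -> R) a b : (forall x, is_derive F x (f x)) -> Cts f ->
  RInt f a b = F b - F a.
Proof.
  intros HF Hf; apply is_RInt_unique, (is_RInt_derive F f); auto.
Qed.

Lemma is_derive_primitive f a x : Cts f -> is_derive (fun x => RInt f a x) x (f x).
Proof.
  intros H. apply (is_derive_RInt f (fun x => RInt f a x) a).
  - apply filter_forall; intros; apply (RInt_correct f); auto.
  - apply H.
Qed.

Lemma RInt_period f a : Cts f -> periodic f -> RInt f a (a + 1) = RInt f 0 1.
Proof.
  intros H Hp.
  assert (E : RInt f 1 (a + 1) = RInt f 0 a).
  { rewrite <- (Rplus_0_l 1) at 1. rewrite <- (RInt_shift f 0 a 1 H).
    apply RInt_ext_all; intros; apply Hp. }
  generalize (RInt_Chasles_R f 0 a (a + 1) H) (RInt_Chasles_R f 0 1 (a + 1) H). lra.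
Qed.

Lemma RInt_period_nat f a n : Cts f -> periodic f ->
  RInt f a (a + INR n) = INR n * RInt f 0 1.
Proof.
  intros H Hp; induction n as [|n IH].
  - simpl; rewrite Rplus_0_r, RInt_point, Rmult_0_l; reflexivity.
  - rewrite <- (RInt_Chasles_R f a (a + INR n)) by auto.
    rewrite IH, S_INR, <- Rplus_assoc, RInt_period by auto. real_equation; ring.
Qed.

Lemma IZR_INR n : (0 <= n)%Z -> IZR n = INR (Z.to_nat n).
Proof. intros H; rewrite INR_IZR_INZ, Z2Nat.id; auto. Qed.

Lemma RInt_period_Z f a n : (0 <= n)%Z -> Cts f -> periodic f ->
  RInt f a (a + IZR n) = IZR n * RInt f 0 1.
Proof. intros Hn; rewrite IZR_INR by auto; apply RInt_period_nat. Qed.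

Lemma periodic_nat f n x : periodic f -> f (x + INR n) = f x.
Proof.
  intros H; induction n as [|n IH].
  - simpl; f_equal; ring.
  - rewrite S_INR, <- Rplus_assoc, H; apply IH.
Qed.

Lemma periodic_Z f n x : periodic f -> f (x + IZR n) = f x.
Proof.
  intros H; destruct (Z_le_gt_dec 0 n) as [Hn|Hn].
  - rewrite IZR_INR by auto; apply periodic_nat, H.
  - rewrite <- (periodic_nat f (Z.to_nat (- n)) (x + IZR n) H), <- IZR_INR by lia.
    rewrite opp_IZR; f_equal; ring.
Qed.

Lemma RInt_abs_le f a b M : a <= b -> Cts f ->
  (forall x, a <= x <= b -> Rabs (f x) <= M) -> Rabs (RInt f a b) <= (b - a) * M.
Proof.
  intros Hab Hf HM.
  apply (norm_RInt_le_const f a b (RInt f a b) M Hab).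
  - exact HM.
  - apply (RInt_correct f); auto.
Qed.

(** Parametric integrals are handled through a modulus of continuity that is uniform
in the integration variable.  In the uses below [K] depends on the parameters
through a function of two variables, so the uniformity comes from compactness of
a rectangle in the plane. *)
Lemma Cts2_RInt_unif (K : R -> R -> R -> R) a b :
  a <= b -> (forall x y, Cts (K x y)) ->
  (forall x y (eps : posreal), exists delta : posreal, forall x' y',
     Rabs (x' - x) < delta -> Rabs (y' - y) < delta ->
     forall t, a <= t <= b -> Rabs (K x' y' t - K x y t) <= eps) ->
  Cts2 (fun x y => RInt (K x y) a b).
Proof.
  intros Hab HK Hu x y eps.
  assert (Hpos : 0 < eps / (b - a + 1)).
  { apply Rdiv_lt_0_compat; [apply eps | lra]. }
  destruct (Hu x y (mkposreal _ Hpos)) as [d Hd].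
  exists d; intros x' y' Hx Hy.
  rewrite <- (RInt_minus_R (K x' y') (K x y)) by auto.
  eapply Rle_lt_trans.
  - apply RInt_abs_le with (M := eps / (b - a + 1)); auto.
    apply Cts_minus; apply HK.
  - apply Rlt_le_trans with ((b - a + 1) * (eps / (b - a + 1))).
    + apply Rmult_lt_compat_r; lra.
    + right; field; lra.
Qed.

Lemma Cts_RInt_param F a b : a <= b -> Cts2 F -> Cts (fun x => RInt (F x) a b).
Proof.
  intros Hab HF.
  assert (H2 : Cts2 (fun x _ => RInt (F x) a b)).
  { apply (Cts2_RInt_unif (fun x _ => F x)); auto.
    - intros x _; cts.
    - intros x y eps.
      destruct (uniform_continuity_2d F (x - 1) (x + 1) a b
                  (fun u v _ _ => HF u v) eps) as [d Hd].
      assert (Hm : 0 < Rmin d 1) by (apply Rmin_pos; [apply d | lra]).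
      exists (mkposreal _ Hm); simpl; intros x' y' Hx Hy t Ht.
      apply Rlt_le, Hd; auto; try lra.
      + assert (Rabs (x' - x) < 1) by (eapply Rlt_le_trans; [exact Hx | apply Rmin_r]).
        apply Rabs_def2 in H; lra.
      + eapply Rlt_le_trans; [exact Hx | apply Rmin_l].
      + rewrite Rminus_diag, Rabs_R0; apply d. }
  exact (Cts2_along _ (fun x => x) (fun _ => 0) H2 Cts_id (Cts_const 0)).
Qed.

(** Both sides have the same derivative in [b] and vanish for [b = a]. *)
Lemma RInt_swap F a b c d : c <= d -> Cts2 F ->
  RInt (fun x => RInt (fun y => F x y) c d) a b =
  RInt (fun y => RInt (fun x => F x y) a b) c d.
Proof.
  intros Hcd HF.
  assert (Hs : forall y, Cts (fun x => F x y)) by (intros; cts).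
  assert (HI : Cts (fun x => RInt (F x) c d)) by (apply Cts_RInt_param; auto).
  assert (HD : forall z, is_derive
     (fun z => RInt (fun y => RInt (fun x => F x y) a z) c d) z (RInt (F z) c d)).
  { intros z.
    assert (Ed : forall u y, Derive (fun z => RInt (fun x => F x y) a z) u = F u y).
    { intros u y; apply is_derive_unique, (is_derive_primitive (fun x => F x y)), Hs. }
    rewrite (RInt_ext_all (F z) (fun t => Derive (fun u => RInt (fun x => F x t) a u) z))
      by (intros; rewrite Ed; reflexivity).
    apply (is_derive_RInt_param (fun z y => RInt (fun x => F x y) a z) c d z).
    - apply filter_forall; intros u t _.
      eexists; apply (is_derive_primitive (fun x => F x t)), Hs.
    - intros t _. apply (continuity_2d_pt_ext F); [| apply HF].
      intros; symmetry; apply Ed.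
    - apply filter_forall; intros u. apply Cts_ex_RInt.
      destruct (Rle_dec a u) as [Hau|Hau].
      + apply (Cts_RInt_param (fun y x => F x y)); auto; cts.
      + assert (Cts (fun y => - RInt (fun x => F x y) u a)).
        { apply Cts_opp, (Cts_RInt_param (fun y x => F x y)); [lra | cts]. }
        intros y; apply (continuous_ext (fun y => - RInt (fun x => F x y) u a)).
        * intros y'; apply (opp_RInt_swap (fun x => F x y')); auto.
        * apply H. }
  etransitivity; [exact (RInt_FTC _ _ a b HD HI) | cbv beta].
  rewrite (RInt_ext_all (fun y => RInt (fun x => F x y) a a) (fun _ => 0)).
  - rewrite RInt_const_R; real_equation; ring.
  - intros y; apply (RInt_point a (fun x => F x y)).
Qed.

(** * Fourier coefficients as real integrals with a phase *)

Lemma RInt_C_pair u v a b : Cts u -> Cts v ->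
  RInt (V := C_R_CompleteNormedModule) (fun x => (u x, v x)) a b = (RInt u a b, RInt v a b).
Proof.
  intros Hu Hv. apply (is_RInt_unique (V := C_R_CompleteNormedModule)).
  apply (is_RInt_fct_extend_pair (U := R_NormedModule) (V := R_NormedModule)
           (fun x => (u x, v x)) a b (RInt u a b) (RInt v a b)).
  - apply (RInt_correct u); auto.
  - apply (RInt_correct v); auto.
Qed.

Lemma C_eq (a b c d : R) : a = c -> b = d -> (a, b) = (c, d) :> C.
Proof. intros -> ->; reflexivity. Qed.

Lemma real_expi_neg h th :
  (RtoC h * expi (- th))%C = (h * cos th, h * cos (th + PI / 2)).
Proof.
  unfold RtoC, expi, Cmult; simpl. rewrite cos_neg, sin_neg.
  replace (cos (th + PI / 2)) with (- sin th).
  - apply C_eq; ring.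
  - rewrite cos_plus, cos_PI2, sin_PI2; ring.
Qed.

(** The real and imaginary parts of a Fourier coefficient are this integral for two
values of the phase [b]: replacing the complex exponential by a cosine with a
free phase makes every later computation one about real integrals. *)
Definition trig (h : R -> R) (k : Z) (b : R) : R :=
  RInt (fun x => h x * cos (2 * PI * IZR k * x + b)) 0 1.

Lemma fcoef_trig h k : Cts h -> fcoef h k = (trig h k 0, trig h k (PI / 2)).
Proof.
  intros H; unfold fcoef, trig.
  rewrite <- RInt_C_pair by cts.
  apply (RInt_ext (V := C_R_CompleteNormedModule)); intros x _.
  rewrite real_expi_neg, Rplus_0_r; reflexivity.
Qed.

Lemma trig_phase h k b : Cts h ->
  trig h k b = trig h k 0 * cos b + trig h k (PI / 2) * sin b.
Proof.
  intros H; unfold trig.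
  rewrite (Rmult_comm _ (cos b)), (Rmult_comm _ (sin b)).
  rewrite <- !RInt_scal_l by cts.
  rewrite <- RInt_plus_R by cts.
  apply RInt_ext_all; intros x.
  rewrite !(cos_plus (2 * PI * IZR k * x)), cos_PI2, sin_PI2, cos_0, sin_0.
  ring.
Qed.

Lemma fcoef_expi h k th : Cts h ->
  (fcoef h k * expi th)%C = (trig h k (- th), trig h k (PI / 2 - th)).
Proof.
  intros H; rewrite fcoef_trig by auto.
  rewrite (trig_phase h k (- th)), (trig_phase h k (PI / 2 - th)) by auto.
  rewrite cos_neg, sin_neg, cos_minus, sin_minus, cos_PI2, sin_PI2.
  unfold Cmult, expi; simpl. apply C_eq; ring.
Qed.

Lemma trig_neg h k b : trig h (- k) b = trig h k (- b).
Proof.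
  unfold trig; apply RInt_ext_all; intros x.
  rewrite opp_IZR, <- cos_neg; do 2 f_equal; ring.
Qed.

Lemma trig_antiphase h k b : Cts h -> trig h k (b + PI) = - trig h k b.
Proof.
  intros H; rewrite (trig_phase h k (b + PI)), (trig_phase h k b) by auto.
  rewrite neg_cos, neg_sin; ring.
Qed.

Lemma trig0_quarter h : Cts h -> trig h 0 (PI / 2) = 0.
Proof.
  intros H; unfold trig.
  rewrite (RInt_ext_all _ (fun _ => 0)).
  - rewrite RInt_const_R; real_equation; ring.
  - intros x; replace (2 * PI * 0 * x + PI / 2) with (PI / 2) by ring.
    rewrite cos_PI2; ring.
Qed.

Lemma cos_2PI_Z x k : cos (x + 2 * PI * IZR k) = cos x.
Proof.
  assert (P : periodic (fun x => cos (2 * PI * x))).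
  { intros y; rewrite Rmult_plus_distr_l, Rmult_1_r. rewrite <- (cos_period (2 * PI * y) 1); f_equal; simpl; ring. }
  generalize (periodic_Z _ k (x / (2 * PI)) P); simpl.
  assert (HPI := PI_RGT_0).
  intros E. rewrite Rmult_plus_distr_l in E.
  replace (2 * PI * (x / (2 * PI))) with x in E by (field; lra). exact E.
Qed.

Lemma bounded_on f a b : Cts f -> exists M, 0 <= M /\ forall x, a <= x <= b -> Rabs (f x) <= M.
Proof.
  intros H. destruct (Rle_dec a b) as [Hab|Hab].
  - destruct (continuity_ab_maj (fun x => Rabs (f x)) a b Hab) as [m [Hm _]].
    + intros c _. apply continuity_pt_filterlim.
      apply (continuous_comp f Rabs); [apply H | apply continuous_Rabs].
    + exists (Rabs (f m)); split; [apply Rabs_pos | exact Hm].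
  - exists 0; split; [lra | intros; lra].
Qed.

Lemma periodic_derive (h h1 : R -> R) : (forall x, is_derive h x (h1 x)) -> periodic h -> periodic h1.
Proof.
  intros H Hp x.
  rewrite <- (is_derive_unique h x (h1 x)) by auto.
  symmetry; apply is_derive_unique.
  apply (is_derive_ext (fun y => h (y + 1))).
  - intros; apply Hp.
  - replace (h1 (x + 1)) with (scal 1 (h1 (x + 1))) by apply Rmult_1_l.
    apply (is_derive_comp h (fun y => y + 1)); auto.
    auto_derive; auto.
Qed.

(** Two integrations by parts; the boundary terms cancel by periodicity. *)
Lemma trig_decay h h1 h2 :
  (forall x, is_derive h x (h1 x)) -> (forall x, is_derive h1 x (h2 x)) -> Cts h2 ->
  periodic h ->
  exists M, 0 <= M /\ forall k b, (k <> 0)%Z -> Rabs (trig h k b) <= M / (IZR k) ^ 2.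
Proof.
  intros H1 H2 C2 Hp.
  assert (Hp1 := periodic_derive _ _ H1 Hp).
  destruct (bounded_on h2 0 1 C2) as [M [M0 HM]].
  assert (C0 := Cts_derive _ _ H1). assert (C1 := Cts_derive _ _ H2).
  exists M; split; auto; intros k b Hk.
  assert (HPI := PI_RGT_0). assert (P1 : 1 < PI) by (generalize PI2_1; lra).
  assert (Hk' : IZR k <> 0) by (apply not_0_IZR; auto).
  set (w := 2 * PI * IZR k).
  assert (Hw : w <> 0) by (unfold w; apply Rmult_integral_contrapositive; split; lra).
  (* An antiderivative of the integrand, up to the term with [h2]. *)
  set (Phi := fun x => h x * sin (w * x + b) / w + h1 x * cos (w * x + b) / w ^ 2).
  assert (HPhi : forall x, is_derive Phi x (h x * cos (w * x + b) + h2 x * cos (w * x + b) / w ^ 2)).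
  { intros x; unfold Phi. assert (D1 := H1 x). assert (D2 := H2 x).
    auto_derive.
    - repeat split; auto; eexists; eauto.
    - change (Derive (fun y => h y) x) with (Derive h x).
      change (Derive (fun y => h1 y) x) with (Derive h1 x).
      rewrite (is_derive_unique _ _ _ D1), (is_derive_unique _ _ _ D2); field; auto. }
  assert (E : trig h k b = - (RInt (fun x => h2 x * cos (w * x + b) / w ^ 2) 0 1)).
  { unfold trig; fold w.
    assert (F := RInt_FTC Phi _ 0 1 HPhi).
    rewrite RInt_plus_R in F by cts.
    assert (Phi 1 = Phi 0).
    { unfold Phi. rewrite <- (Rplus_0_l 1) at 1 3. rewrite Hp, Hp1.
      replace (w * 1 + b) with ((w * 0 + b) + 2 * PI * IZR k) by (unfold w; ring).
      rewrite cos_2PI_Z. rewrite <- !cos_shift.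
      replace (PI / 2 - (w * 0 + b + 2 * PI * IZR k)) with
        (PI / 2 - (w * 0 + b) + 2 * PI * IZR (- k)) by (rewrite opp_IZR; ring).
      rewrite cos_2PI_Z; reflexivity. }
    rewrite H, Rminus_diag in F by cts.
    cut (forall a c : R, a + c = 0 -> a = - c); [intros X; apply X, F; cts | intros; lra]. }
  rewrite E, Rabs_Ropp.
  eapply Rle_trans.
  - apply RInt_abs_le with (M := M / IZR k ^ 2); [lra | cts |].
    intros x Hx.
    assert (K2 : 0 < IZR k ^ 2) by (apply pow2_gt_0; auto).
    assert (W2 : IZR k ^ 2 <= w ^ 2).
    { unfold w. rewrite Rpow_mult_distr.
      assert (1 <= (2 * PI) ^ 2) by (apply pow_R1_Rle; lra).
      nra. }
    unfold Rdiv. rewrite Rabs_mult, Rabs_mult.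
    rewrite (Rabs_right (/ w ^ 2)) by (apply Rle_ge, Rlt_le, Rinv_0_lt_compat; lra).
    assert (Rabs (h2 x) * Rabs (cos (w * x + b)) <= M).
    { rewrite <- (Rmult_1_r M). apply Rmult_le_compat; auto; try apply Rabs_pos.
      apply Rabs_le, COS_bound. }
    apply Rmult_le_compat; auto.
    + apply Rmult_le_pos; apply Rabs_pos.
    + apply Rlt_le, Rinv_0_lt_compat; lra.
    + apply Rinv_le_contravar; lra.
  - lra.
Qed.

(** Comparison with the telescoping series of 2/(n+1) - 2/(n+2). *)
Lemma ex_series_inv_sq : ex_series (fun n => / INR (S n) ^ 2).
Proof.
  apply (ex_series_le (K := R_AbsRing) (V := R_CompleteNormedModule) _
           (fun n => 2 * (/ INR (S n) - / INR (S (S n))))).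
  - intros n. change (norm (/ INR (S n) ^ 2)) with (Rabs (/ INR (S n) ^ 2)).
    assert (Hn := pos_INR n). rewrite !S_INR.
    rewrite Rabs_right.
    + apply Rminus_le.
      replace (/ (INR n + 1) ^ 2 - 2 * (/ (INR n + 1) - / (INR n + 1 + 1)))
        with (- (INR n) * / ((INR n + 1) ^ 2 * (INR n + 1 + 1))) by (field; lra).
      assert (0 < / ((INR n + 1) ^ 2 * (INR n + 1 + 1)))
        by (apply Rinv_0_lt_compat, Rmult_lt_0_compat; [apply pow_lt|]; lra).
      nra.
    + apply Rle_ge, Rlt_le, Rinv_0_lt_compat, pow_lt; lra.
  - apply (ex_series_scal (K := R_AbsRing) (V := R_NormedModule) 2).
    exists 1.
    assert (E : forall n, sum_n (fun n => / INR (S n) - / INR (S (S n))) n = 1 - / INR (S (S n))).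
    { induction n as [|n IH].
      - rewrite sum_O. simpl. real_equation; field.
      - rewrite sum_Sn, IH. unfold plus; simpl plus. change (1 - / INR (S (S n)) + (/ INR (S (S n)) - / INR (S (S (S n)))) = 1 - / INR (S (S (S n)))). ring. }
    apply (filterlim_ext (fun n => 1 - / INR (S (S n)))).
    { intros; symmetry; apply E. }
    change (is_lim_seq (fun n => 1 - / INR (S (S n))) 1).
    replace (Finite 1) with (Rbar_minus 1 0) by (simpl; f_equal; ring).
    apply is_lim_seq_minus'; [apply is_lim_seq_const|].
    replace (Finite 0) with (Rbar_inv p_infty) by reflexivity.
    apply (is_lim_seq_inv (fun n => INR (S (S n)))); [| discriminate].
    apply -> (is_lim_seq_incr_1 (fun n => INR (S n))).
    apply -> (is_lim_seq_incr_1 INR). apply is_lim_seq_INR.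
Qed.

Lemma is_series_C (u v : nat -> R) a b : is_series u a -> is_series v b ->
  is_series (V := C_R_NormedModule) (fun n => (u n, v n)) (a, b).
Proof.
  unfold is_series; intros Hu Hv.
  apply (filterlim_ext (fun n => (sum_n u n, sum_n v n))).
  - intros n; induction n as [|n IH].
    + rewrite !sum_O; reflexivity.
    + rewrite !sum_Sn, <- IH; reflexivity.
  - intros P [eps HP]; unfold filtermap.
    assert (U : eventually (fun n => ball a eps (sum_n u n))) by (apply Hu, locally_ball).
    assert (V : eventually (fun n => ball b eps (sum_n v n))) by (apply Hv, locally_ball).
    generalize (filter_and _ _ U V). apply filter_imp.
    intros n [A B]; apply HP; split; assumption.
Qed.

(** * Fourier inversion for twice differentiable periodic functions *)

Fixpoint dirichlet (n : nat) (t : R) : R :=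
  match n with
  | O => 1
  | S m => dirichlet m t + 2 * cos (2 * PI * INR (S m) * t)
  end.

(** Up to the factor 1/(N+1), this is the Fejer kernel. *)
Definition fejer (N : nat) (t : R) : R := sum_f_R0 (fun n => dirichlet n t) N.

(** Telescoping: 2 sin s cos (2 n s) is a difference of two consecutive sines. *)
Lemma dirichlet_sin n t : sin (PI * t) * dirichlet n t = sin ((2 * INR n + 1) * (PI * t)).
Proof.
  induction n as [|n IH].
  - simpl; rewrite Rmult_0_r, Rplus_0_l, Rmult_1_l; ring.
  - cbn [dirichlet]. rewrite Rmult_plus_distr_l, IH.
    set (c := 2 * PI * INR (S n) * t).
    replace ((2 * INR n + 1) * (PI * t)) with (c - PI * t) by (unfold c; rewrite S_INR; ring).
    replace ((2 * INR (S n) + 1) * (PI * t)) with (c + PI * t) by (unfold c; ring).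
    rewrite sin_plus, sin_minus; ring.
Qed.

(** The analogous telescoping of products of sines into squares; it shows that the
kernel times sin^2 is bounded, uniformly in [N]. *)
Lemma fejer_sin N t : sin (PI * t) ^ 2 * fejer N t = sin (INR (S N) * (PI * t)) ^ 2.
Proof.
  unfold fejer; induction N as [|N IH].
  - simpl; rewrite !Rmult_1_l; ring.
  - rewrite tech5, Rmult_plus_distr_l, IH.
    replace (sin (PI * t) ^ 2 * dirichlet (S N) t) with
      (sin (PI * t) * (sin (PI * t) * dirichlet (S N) t)) by ring.
    rewrite dirichlet_sin.
    set (c := INR (S N) * (PI * t)). set (s := PI * t).
    replace ((2 * INR (S N) + 1) * s) with (c + (c + s)) by (unfold c, s; ring).
    replace (INR (S (S N)) * s) with (c + s) by (unfold c, s; rewrite (S_INR (S N)); ring).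
    rewrite (sin_plus c (c + s)), !sin_plus, cos_plus.
    assert (Hc := sin2_cos2 c). assert (Hs := sin2_cos2 s). unfold Rsqr in *.
    cut (forall a b x y : R, a * a + b * b = 1 -> x * x + y * y = 1 ->
       a ^ 2 + x * (a * (b * y - a * x) + b * (a * y + b * x)) = (a * y + b * x) ^ 2).
    { intros X; apply X; auto. }
    intros a b x y E1 E2.
    replace ((a * y + b * x) ^ 2) with (a^2 * (y * y) + 2 * a * b * x * y + b ^ 2 * x ^ 2) by ring.
    replace (y * y) with (1 - x * x) by lra. ring.
Qed.

Lemma Cts_dirichlet n : Cts (dirichlet n).
Proof. induction n as [|n IH]; cbn [dirichlet]; cts. Qed.
Lemma Cts_fejer n : Cts (fejer n).
Proof.
  unfold fejer; induction n as [|n IH]; simpl sum_f_R0.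
  - apply (Cts_dirichlet 0).
  - apply Cts_plus; [exact IH | apply (Cts_dirichlet (S n))].
Qed.

Lemma dirichlet_even n t : dirichlet n (- t) = dirichlet n t.
Proof.
  induction n as [|n IH]; cbn [dirichlet]; auto.
  rewrite IH, <- (cos_neg (2 * PI * INR (S n) * t)); do 3 f_equal; ring.
Qed.
Lemma fejer_even n t : fejer n (- t) = fejer n t.
Proof. unfold fejer; apply sum_eq; intros; apply dirichlet_even. Qed.

Lemma dirichlet_periodic n : periodic (dirichlet n).
Proof.
  intros t; induction n as [|n IH]; cbn [dirichlet]; auto.
  rewrite IH; do 2 f_equal.
  rewrite <- (cos_2PI_Z (2 * PI * INR (S n) * t) (Z.of_nat (S n))), <- INR_IZR_INZ.
  f_equal; ring.
Qed.
Lemma fejer_periodic n : periodic (fejer n).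
Proof. intros t; unfold fejer; apply sum_eq; intros; apply dirichlet_periodic. Qed.

Lemma RInt_dirichlet n : RInt (dirichlet n) 0 1 = 1.
Proof.
  induction n as [|n IH]; cbn [dirichlet].
  - rewrite RInt_const_R; real_equation; ring.
  - rewrite RInt_plus_R, IH by (try apply Cts_dirichlet; cts).
    assert (HPI := PI_RGT_0). assert (Hn := pos_INR n).
    set (w := 2 * PI * INR (S n)).
    assert (w <> 0) by (unfold w; rewrite S_INR; apply Rmult_integral_contrapositive; split; lra).
    rewrite (RInt_FTC (fun t => 2 * sin (w * t) / w)).
    + replace (w * 1) with (0 + 2 * PI * IZR (Z.of_nat (S n)))
        by (unfold w; rewrite <- INR_IZR_INZ; ring).
      rewrite <- (cos_shift (0 + _)), Rmult_0_r, sin_0.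
      replace (PI / 2 - (0 + 2 * PI * IZR (Z.of_nat (S n)))) with
        (PI / 2 + 2 * PI * IZR (- Z.of_nat (S n))) by (rewrite opp_IZR; ring).
      rewrite cos_2PI_Z, cos_PI2. real_equation; field; auto.
    + intros x; auto_derive; auto. field; auto.
    + cts.
Qed.
Lemma RInt_fejer n : RInt (fejer n) 0 1 = INR (S n).
Proof.
  unfold fejer; induction n as [|n IH]; cbn [sum_f_R0].
  - apply RInt_dirichlet.
  - rewrite (RInt_plus_R (fejer n)), RInt_dirichlet by (apply Cts_fejer || apply Cts_dirichlet).
    unfold fejer; rewrite IH, (S_INR (S n)); reflexivity.
Qed.

Lemma MVT_R (f f' : R -> R) a b : (forall x, is_derive f x (f' x)) -> a <= b ->
  exists c, a <= c <= b /\ f b - f a = f' c * (b - a).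
Proof.
  intros H Hab.
  destruct (MVT_gen f a b f') as [c [Hc E]].
  - intros; apply H.
  - intros x _; apply continuity_pt_filterlim, (Cts_derive f f' H).
  - rewrite Rmin_left, Rmax_right in Hc by auto. exists c; auto.
Qed.

(** Up to pi t = 1 the slope of the sine is at least cos (pi/3); from there on the
sine is at least sin 1 >= 1/2.  The constant is not optimal. *)
Lemma sin_PI_lower t : 0 <= t <= 1 / 2 -> t / 2 <= sin (PI * t).
Proof.
  intros Ht. assert (P3 : 3 < PI) by (generalize PI2_3_2; lra).
  assert (P4 := PI_4).
  assert (L : forall u, 0 <= u <= 1 -> u / 2 <= sin u).
  { intros u Hu. destruct (MVT_R sin cos 0 u) as [c [Hc E]].
    - intros; apply is_derive_sin.
    - lra.
    - rewrite sin_0, !Rminus_0_r in E. rewrite E.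
      assert (1 / 2 <= cos c).
      { rewrite <- cos_PI3. apply cos_decr_1; lra. }
      nra. }
  destruct (Rle_dec (PI * t) 1) as [H|H].
  - assert (PI * t / 2 <= sin (PI * t)) by (apply L; split; nra). nra.
  - assert (sin 1 <= sin (PI * t)) by (apply sin_incr_1; nra).
    generalize (L 1). lra.
Qed.

(** The first-order terms cancel in the symmetric difference, so it is O(t^2) near
0, and likewise near 1 by periodicity: it vanishes to the same order as the
square of the sine in the denominator of the Fejer kernel. *)
Lemma symmetric_difference_bound h h1 h2 x :
  (forall x, is_derive h x (h1 x)) -> (forall x, is_derive h1 x (h2 x)) -> Cts h2 ->
  periodic h ->
  exists C, forall t, 0 <= t <= 1 ->
    Rabs (h (x + t) + h (x - t) - 2 * h x) <= C * sin (PI * t) ^ 2.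
Proof.
  intros H1 H2 C2 Hp.
  destruct (bounded_on h2 (x - 1) (x + 1) C2) as [M [M0 HM]].
  exists (8 * M).
  assert (Half : forall t, 0 <= t <= 1 / 2 ->
    Rabs (h (x + t) + h (x - t) - 2 * h x) <= 8 * M * sin (PI * t) ^ 2).
  { intros t Ht.
    destruct (MVT_R (fun s => h (x + s) + h (x - s)) (fun s => h1 (x + s) - h1 (x - s)) 0 t)
      as [c [Hc E]].
    - intros s. assert (D1 := H1 (x + s)). assert (D2 := H1 (x - s)).
      auto_derive.
      + repeat split; eexists; eauto.
      + change (Derive (fun y => h y)) with (Derive h).
        replace (x + - s) with (x - s) by ring.
        rewrite (is_derive_unique _ _ _ D1), (is_derive_unique _ _ _ D2). ring.
    - lra.
    - destruct (MVT_R h1 h2 (x - c) (x + c) H2) as [d [Hd E']]; [lra|].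
      replace (h (x + t) + h (x - t) - 2 * h x) with (h2 d * (2 * c * t)).
      + rewrite Rabs_mult, (Rabs_right (2 * c * t)) by nra.
        assert (S := sin_PI_lower t Ht).
        assert (t ^ 2 <= 4 * sin (PI * t) ^ 2) by nra.
        assert (Rabs (h2 d) <= M) by (apply HM; lra).
        assert (0 <= 2 * c * t <= 2 * t ^ 2) by nra.
        assert (0 <= Rabs (h2 d)) by apply Rabs_pos.
        apply Rle_trans with (M * (2 * t ^ 2)); [apply Rmult_le_compat; lra | nra].
      + rewrite Rplus_0_r, Rminus_0_r in E. rewrite E' in E. lra. }
  intros t Ht. destruct (Rle_dec t (1 / 2)) as [H|H].
  - apply Half; lra.
  - assert (X := Half (1 - t)).
    replace (PI * (1 - t)) with (PI - PI * t) in X by ring.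
    rewrite sin_PI_x in X.
    replace (x + (1 - t)) with (x - t + 1) in X by ring.
    replace (x + t) with (x - (1 - t) + 1) by ring.
    rewrite Hp in *. rewrite (Rplus_comm (h (x - t))) in X. apply X; lra.
Qed.

(** The kernel is even, so it may be integrated against the symmetric difference of
[h], which is dominated by the denominator of the kernel: the product is bounded
independently of [N].  Divided by N+1 this is convergence of the Fejer means. *)
Lemma fejer_mean_bound h h1 h2 x :
  (forall x, is_derive h x (h1 x)) -> (forall x, is_derive h1 x (h2 x)) -> Cts h2 ->
  periodic h ->
  exists C, forall N,
    Rabs (RInt (fun t => h t * fejer N (t - x)) 0 1 - INR (S N) * h x) <= C.
Proof.
  intros H1 H2 C2 Hp.
  destruct (symmetric_difference_bound h h1 h2 x H1 H2 C2 Hp) as [C HC].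
  assert (C0 := Cts_derive _ _ H1).
  assert (HCp : 0 <= C).
  { assert (X := HC (1 / 2)).
    replace (PI * (1 / 2)) with (PI / 2) in X by field. rewrite sin_PI2 in X.
    eapply Rle_trans; [apply Rabs_pos | eapply Rle_trans; [apply X; lra | lra]]. }
  (* The factor 1/2: the symmetric difference counts the integral twice. *)
  exists (C / 2); intros N. assert (CF := Cts_fejer N).
  set (psi := fun t : R => h t * fejer N (t - x)).
  assert (Cpsi : Cts psi) by (unfold psi; cts).
  assert (Ppsi : periodic psi).
  { intros t; unfold psi. rewrite Hp. replace (t + 1 - x) with (t - x + 1) by ring.
    rewrite fejer_periodic; reflexivity. }
  assert (E1 : RInt psi 0 1 = RInt (fun t => h (x + t) * fejer N t) 0 1).
  { rewrite <- (RInt_period psi x) by auto.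
    rewrite (RInt_ext_all (fun t => h (x + t) * fejer N t) (fun t => psi (t + x))).
    - rewrite (RInt_shift psi 0 1 x Cpsi). f_equal; ring.
    - intros t; unfold psi. f_equal; f_equal; ring. }
  assert (E2 : RInt psi 0 1 = RInt (fun t => h (x - t) * fejer N t) 0 1).
  { rewrite <- (RInt_period psi (x - 1)) by auto.
    rewrite (RInt_ext_all (fun t => h (x - t) * fejer N t) (fun t => psi (-1 * t + x))).
    - assert (A := RInt_affine psi 0 1 (-1) x Cpsi).
      rewrite <- (opp_RInt_swap psi) in A by auto.
      replace (-1 * 1 + x) with (x - 1) in A by ring.
      replace (-1 * 0 + x) with (x - 1 + 1) in A by ring.
      change opp with Ropp in A. lra.
    - intros t; unfold psi. replace (-1 * t + x - x) with (- t) by ring.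
      rewrite fejer_even. f_equal; f_equal; ring. }
  assert (E3 : 2 * (RInt psi 0 1 - INR (S N) * h x) =
     RInt (fun t => (h (x + t) + h (x - t) - 2 * h x) * fejer N t) 0 1).
  { rewrite (RInt_ext_all (fun t => (h (x + t) + h (x - t) - 2 * h x) * fejer N t)
      (fun t => h (x + t) * fejer N t + h (x - t) * fejer N t - (2 * h x) * fejer N t))
      by (intros; ring).
    rewrite RInt_minus_R, RInt_plus_R, <- E1, <- E2, RInt_scal_l, RInt_fejer by cts.
    real_equation; ring. }
  assert (B : Rabs (2 * (RInt psi 0 1 - INR (S N) * h x)) <= C).
  { rewrite E3. replace C with ((1 - 0) * C) by ring.
    apply RInt_abs_le; [lra | cts |].
    intros t Ht. rewrite Rabs_mult.
    apply Rle_trans with (C * sin (PI * t) ^ 2 * Rabs (fejer N t)).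
    - apply Rmult_le_compat_r; [apply Rabs_pos | apply HC; auto].
    - rewrite Rmult_assoc. rewrite <- (Rmult_1_r C) at 2. apply Rmult_le_compat_l; auto.
      rewrite <- (Rabs_right (sin (PI * t) ^ 2)) by (apply Rle_ge, pow2_ge_0).
      rewrite <- Rabs_mult, fejer_sin, <- RPow_abs.
      rewrite <- (pow1 2). apply pow_incr; split; [apply Rabs_pos|].
      apply Rabs_le, SIN_bound. }
  rewrite Rabs_mult, (Rabs_right 2) in B by lra. change (Rabs (RInt psi 0 1 - INR (S N) * h x) <= C / 2). lra.
Qed.

(** The coefficients are O(1/k^2), so the two half-series converge, and the partial
sums of the symmetric series then have the same limit as their Cesaro means,
which are the Fejer means.  Imaginary parts are odd in [k] and cancel. *)
Theorem fourier_inversion h h1 h2 x :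
  (forall x, is_derive h x (h1 x)) -> (forall x, is_derive h1 x (h2 x)) -> Cts h2 ->
  periodic h ->
  is_zseries (fun k => fcoef h k * expi (2 * PI * IZR k * x))%C (RtoC (h x)).
Proof.
  intros H1 H2 C2 Hp.
  assert (C0 := Cts_derive _ _ H1).
  destruct (trig_decay h h1 h2 H1 H2 C2 Hp) as [M [M0 HM]].
  set (U := fun n => trig h (Z.of_nat n) (- (2 * PI * INR n * x))).
  set (V := fun n => trig h (Z.of_nat n) (PI / 2 - 2 * PI * INR n * x)).
  assert (EP : forall n, (fcoef h (Z.of_nat n) * expi (2 * PI * IZR (Z.of_nat n) * x))%C = (U n, V n)).
  { intros n; rewrite fcoef_expi, <- INR_IZR_INZ by auto; reflexivity. }
  assert (EN : forall n, (fcoef h (- Z.of_nat (S n)) * expi (2 * PI * IZR (- Z.of_nat (S n)) * x))%C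
                 = (U (S n), - V (S n))).
  { intros n; rewrite fcoef_expi, opp_IZR, <- INR_IZR_INZ, !trig_neg by auto.
    unfold U, V; apply C_eq.
    - f_equal; ring.
    - rewrite <- trig_antiphase by auto.
      replace (PI / 2 - 2 * PI * INR (S n) * x + PI) with
        (- (PI / 2 - 2 * PI * - INR (S n) * x) + 2 * PI * IZR 1) by field.
      unfold trig; apply RInt_ext_all; intros t.
      rewrite <- Rplus_assoc, cos_2PI_Z; reflexivity. }
  assert (Sum : forall W, (forall n, Rabs (W n) <= M * / INR (S n) ^ 2) -> ex_series W).
  { intros W HW. apply (ex_series_le (K := R_AbsRing) (V := R_CompleteNormedModule) W
       (fun n => M * / INR (S n) ^ 2)); [exact HW|].
    apply (ex_series_scal (K := R_AbsRing) (V := R_NormedModule) M), ex_series_inv_sq. }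
  assert (SU : ex_series (fun n => U (S n))).
  { apply Sum; intros n; unfold U, V; rewrite (INR_IZR_INZ (S n)) at 2; apply HM; lia. }
  assert (SV : ex_series (fun n => V (S n))).
  { apply Sum; intros n; unfold U, V; rewrite (INR_IZR_INZ (S n)) at 2; apply HM; lia. }
  set (a := Series (fun n => U (S n))). set (b := Series (fun n => V (S n))).
  assert (V0 : V 0%nat = 0).
  { unfold V; simpl; rewrite Rmult_0_r, Rmult_0_l, Rminus_0_r; apply trig0_quarter; auto. }
  assert (U0 : U 0%nat = RInt h 0 1).
  { unfold U, trig; simpl; apply RInt_ext_all; intros t.
    replace (2 * PI * 0 * t + - (2 * PI * 0 * x)) with 0 by ring.
    rewrite cos_0; ring. }
  (* [rho n] is the symmetric partial sum: its limit exists by absolute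
     convergence, and is identified through the Cesaro means. *)
  assert (Key : U 0%nat + 2 * a = h x).
  { set (rho := fun n => RInt (fun t => h t * dirichlet n (t - x)) 0 1).
    assert (Lrho : is_lim_seq rho (U 0%nat + 2 * a)).
    { apply is_lim_seq_incr_1.
      apply (is_lim_seq_ext (fun n => U 0%nat + 2 * sum_n (fun n => U (S n)) n)).
      - assert (rho_S : forall n, rho (S n) = rho n + 2 * U (S n)).
        { intros n; unfold rho, U, trig; cbn [dirichlet].
          assert (CD := Cts_dirichlet n).
          rewrite <- RInt_scal_l, <- RInt_plus_R by cts.
          apply RInt_ext_all; intros t.
          rewrite <- INR_IZR_INZ, Rmult_plus_distr_l. f_equal.
          replace (2 * PI * INR (S n) * (t - x)) with
            (2 * PI * INR (S n) * t + - (2 * PI * INR (S n) * x)) by ring.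
          ring. }
        assert (rho_0 : rho 0%nat = U 0%nat).
        { rewrite U0; unfold rho; simpl; apply RInt_ext_all; intros; ring. }
        induction n as [|n IH].
        + rewrite sum_O, rho_S, rho_0; reflexivity.
        + rewrite sum_Sn, rho_S, <- IH. unfold plus; simpl; real_equation; ring.
      - apply is_lim_seq_plus'; [apply is_lim_seq_const|].
        apply (is_lim_seq_scal_l _ 2 a).
        apply (Series_correct _ SU). }
    apply is_lim_seq_Reals in Lrho. apply Cesaro_1 in Lrho. apply is_lim_seq_Reals in Lrho.
    apply (is_lim_seq_incr_1 _ (Finite (U 0%nat + 2 * a))) in Lrho. simpl pred in Lrho.
    destruct (fejer_mean_bound h h1 h2 x H1 H2 C2 Hp) as [C HC].
    assert (L2 : is_lim_seq (fun n => sum_f_R0 rho n / INR (S n) - h x) 0).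
    { apply is_lim_seq_abs_0.
      apply (is_lim_seq_le_le (fun _ => 0) _ (fun n => C * / INR (S n))).
      - intros n; split; [apply Rabs_pos|].
        assert (Hn : 0 < INR (S n)) by (apply lt_0_INR; lia).
        assert (Es : sum_f_R0 rho n = RInt (fun t => h t * fejer n (t - x)) 0 1).
        { induction n as [|n IH]; [reflexivity|].
          cbn [sum_f_R0]. rewrite IH by (apply lt_0_INR; lia).
          assert (CD := Cts_dirichlet (S n)). assert (CF := Cts_fejer n).
          unfold rho; rewrite <- RInt_plus_R by cts.
          apply RInt_ext_all; intros t.
          rewrite <- Rmult_plus_distr_l; reflexivity. }
        replace (sum_f_R0 rho n / INR (S n) - h x) with
          ((sum_f_R0 rho n - INR (S n) * h x) * / INR (S n)) by (field; lra).
        rewrite Rabs_mult, (Rabs_right (/ INR (S n)))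
          by (apply Rle_ge, Rlt_le, Rinv_0_lt_compat; auto).
        apply Rmult_le_compat_r; [apply Rlt_le, Rinv_0_lt_compat; auto|].
        rewrite Es; apply HC.
      - apply is_lim_seq_const.
      - replace (Finite 0) with (Rbar_mult C (Rbar_inv p_infty)) by (simpl; f_equal; ring).
        apply is_lim_seq_scal_l, (is_lim_seq_inv (fun n => INR (S n))); [|discriminate].
        apply -> (is_lim_seq_incr_1 INR). apply is_lim_seq_INR. }
    assert (L3 := is_lim_seq_minus' _ _ _ _ Lrho L2).
    apply (is_lim_seq_ext _ (fun _ => h x)) in L3;
      [|intros n; change (sum_f_R0 rho n / INR (S n) - (sum_f_R0 rho n / INR (S n) - h x) = h x); ring].
    apply is_lim_seq_unique in L3. rewrite Lim_seq_const in L3.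
    injection L3; lra. }
  exists (U 0%nat + a, b), (a, - b). split; [|split].
  - apply (filterlim_ext (fun n => sum_n (G := C_R_NormedModule) (fun n => (U n, V n)) n)).
    { intros n; apply (sum_n_ext (G := C_R_NormedModule)); intros; rewrite EP; reflexivity. }
    apply is_series_C.
    + apply is_series_decr_1. change (is_series (fun k => U (S k)) (U 0%nat + a + - U 0%nat)).
      replace (U 0%nat + a + - U 0%nat) with a by ring. apply (Series_correct _ SU).
    + apply is_series_decr_1. change (is_series (fun k => V (S k)) (b + - V 0%nat)).
      rewrite V0; replace (b + - 0) with b by ring. apply (Series_correct _ SV).
  - apply (filterlim_ext (fun n => sum_n (G := C_R_NormedModule) (fun n => (U (S n), - V (S n))) n)).
    { intros n; apply (sum_n_ext (G := C_R_NormedModule)); intros; rewrite EN; reflexivity. }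
    apply (is_series_C (fun n => U (S n)) (fun n => - V (S n))).
    + apply (Series_correct _ SU).
    + apply (is_series_opp (fun n => V (S n))). apply (Series_correct _ SV).
  - unfold RtoC, Cplus; simpl. apply C_eq; lra.
Qed.

(** * Calculus of smooth functions of two variables *)

Lemma Ck2_Cts2 n h : Ck2 n h -> Cts2 h.
Proof. destruct n; intros [H _]; exact H. Qed.

Lemma Ck2_lower n : forall h, Ck2 (S n) h -> Ck2 n h.
Proof.
  induction n as [|n IH]; intros h [H0 [H1 [H2 H3]]].
  - split; auto.
  - split; [auto|]. split; [auto|]. split; apply IH; auto.
Qed.

Lemma Ck2_dx_ex n h x y : Ck2 (S n) h -> ex_derive (fun s => h s y) x.
Proof. intros [_ [H _]]; exact (proj1 (H x y)). Qed.
Lemma Ck2_dy_ex n h x y : Ck2 (S n) h -> ex_derive (fun s => h x s) y.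
Proof. intros [_ [H _]]; exact (proj2 (H x y)). Qed.
Lemma Ck2_dx n h : Ck2 (S n) h -> Ck2 n (dx h).
Proof. intros [_ [_ [H _]]]; auto. Qed.
Lemma Ck2_dy n h : Ck2 (S n) h -> Ck2 n (dy h).
Proof. intros [_ [_ [_ H]]]; auto. Qed.

Lemma fun2_ext (F G : R -> R -> R) : (forall x y, F x y = G x y) -> F = G.
Proof. intros H; do 2 (apply functional_extensionality; intro); apply H. Qed.

(** Introduction of one more degree of smoothness from given partial derivatives,
which spares computing [Derive]. *)
Lemma Ck2_S_intro n h hx hy :
  Cts2 h -> (forall x y, is_derive (fun s => h s y) x (hx x y)) ->
  (forall x y, is_derive (fun s => h x s) y (hy x y)) ->
  Ck2 n hx -> Ck2 n hy -> Ck2 (S n) h.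
Proof.
  intros H0 Hx Hy H1 H2.
  replace hx with (dx h) in H1 by (apply fun2_ext; intros; apply is_derive_unique, Hx).
  replace hy with (dy h) in H2 by (apply fun2_ext; intros; apply is_derive_unique, Hy).
  split; [exact H0|]. split; [|auto].
  intros x y; split; eexists; [apply Hx | apply Hy].
Qed.

Lemma is_derive_dx n h x y : Ck2 (S n) h -> is_derive (fun s => h s y) x (dx h x y).
Proof. intros H; apply Derive_correct, (Ck2_dx_ex n), H. Qed.
Lemma is_derive_dy n h x y : Ck2 (S n) h -> is_derive (fun s => h x s) y (dy h x y).
Proof. intros H; apply Derive_correct, (Ck2_dy_ex n), H. Qed.

Lemma Ck2_const n c : Ck2 n (fun _ _ => c).
Proof.
  revert c; induction n as [|n IH]; intros c.
  - split; [apply Cts2_const | exact I].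
  - apply (Ck2_S_intro n _ (fun _ _ => 0) (fun _ _ => 0)); auto; intros.
    + apply Cts2_const.
    + apply (is_derive_const c).
    + apply (is_derive_const c).
Qed.

Lemma Ck2_plus n : forall f g, Ck2 n f -> Ck2 n g -> Ck2 n (fun x y => f x y + g x y).
Proof.
  induction n as [|n IH]; intros f g Hf Hg.
  - split; [apply Cts2_plus; apply (Ck2_Cts2 0); auto | exact I].
  - apply (Ck2_S_intro n _ (fun x y => dx f x y + dx g x y) (fun x y => dy f x y + dy g x y)).
    + apply Cts2_plus; apply (Ck2_Cts2 (S n)); auto.
    + intros x y; apply (is_derive_plus (fun s => f s y) (fun s => g s y)); apply (is_derive_dx n); auto.
    + intros x y; apply (is_derive_plus (fun s => f x s) (fun s => g x s)); apply (is_derive_dy n); auto.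
    + apply IH; apply Ck2_dx; auto.
    + apply IH; apply Ck2_dy; auto.
Qed.

Lemma Ck2_mult n : forall f g, Ck2 n f -> Ck2 n g -> Ck2 n (fun x y => f x y * g x y).
Proof.
  induction n as [|n IH]; intros f g Hf Hg.
  - split; [apply Cts2_mult; apply (Ck2_Cts2 0); auto | exact I].
  - apply (Ck2_S_intro n _ (fun x y => dx f x y * g x y + f x y * dx g x y)
                           (fun x y => dy f x y * g x y + f x y * dy g x y)).
    + apply Cts2_mult; apply (Ck2_Cts2 (S n)); auto.
    + intros x y; apply (is_derive_mult (fun s => f s y) (fun s => g s y));
        try (apply (is_derive_dx n); auto); intros; apply Rmult_comm.
    + intros x y; apply (is_derive_mult (fun s => f x s) (fun s => g x s));
        try (apply (is_derive_dy n); auto); intros; apply Rmult_comm.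
    + apply Ck2_plus; apply IH; auto using Ck2_dx, Ck2_lower.
    + apply Ck2_plus; apply IH; auto using Ck2_dy, Ck2_lower.
Qed.

Lemma Derive_n_Derive h n x : Derive_n (Derive h) n x = Derive_n h (S n) x.
Proof.
  revert x; induction n as [|n IH]; intros x; [reflexivity|].
  simpl; apply Derive_ext; exact IH.
Qed.

Lemma smooth_Derive h : smooth h -> smooth (Derive h).
Proof.
  intros H n x; destruct n as [|n]; [exact I|].
  apply (ex_derive_ext (Derive_n h (S n))).
  - intros; symmetry; apply Derive_n_Derive.
  - exact (H (S (S n)) x).
Qed.
Lemma smooth_ex_derive h x : smooth h -> ex_derive h x.
Proof. intros H; exact (H 1%nat x). Qed.
Lemma smooth_is_derive h x : smooth h -> is_derive h x (Derive h x).
Proof. intros H; apply Derive_correct, smooth_ex_derive, H. Qed.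
Lemma smooth_Cts h : smooth h -> Cts h.
Proof. intros H; apply Cts_ex_derive; intros; apply smooth_ex_derive, H. Qed.

Lemma smooth2_fst h : smooth h -> smooth2 (fun x _ => h x).
Proof.
  intros H n; revert h H; induction n as [|n IH]; intros h H; assert (C := smooth_Cts h H).
  - split; [cts | exact I].
  - apply (Ck2_S_intro n _ (fun x _ => Derive h x) (fun _ _ => 0)).
    + cts.
    + intros; apply smooth_is_derive, H.
    + intros; apply (is_derive_const (h x)).
    + apply IH, smooth_Derive, H.
    + apply Ck2_const.
Qed.
Lemma smooth2_snd h : smooth h -> smooth2 (fun _ y => h y).
Proof.
  intros H n; revert h H; induction n as [|n IH]; intros h H; assert (C := smooth_Cts h H).
  - split; [cts | exact I].
  - apply (Ck2_S_intro n _ (fun _ _ => 0) (fun _ y => Derive h y)).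
    + cts.
    + intros; apply (is_derive_const (h y)).
    + intros; apply smooth_is_derive, H.
    + apply Ck2_const.
    + apply IH, smooth_Derive, H.
Qed.
Lemma smooth2_const c : smooth2 (fun _ _ => c).
Proof. intros n; apply Ck2_const. Qed.
Lemma smooth2_plus f g : smooth2 f -> smooth2 g -> smooth2 (fun x y => f x y + g x y).
Proof. intros Hf Hg n; apply Ck2_plus; auto. Qed.
Lemma smooth2_mult f g : smooth2 f -> smooth2 g -> smooth2 (fun x y => f x y * g x y).
Proof. intros Hf Hg n; apply Ck2_mult; auto. Qed.
Lemma smooth2_scal c f : smooth2 f -> smooth2 (fun x y => c * f x y).
Proof. apply smooth2_mult, smooth2_const. Qed.
Lemma smooth2_minus f g : smooth2 f -> smooth2 g -> smooth2 (fun x y => f x y - g x y).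
Proof.
  intros Hf Hg. replace (fun x y => f x y - g x y) with (fun x y => f x y + -1 * g x y)
    by (apply fun2_ext; intros; ring).
  apply smooth2_plus; auto using smooth2_scal.
Qed.
Lemma smooth2_Cts2 h : smooth2 h -> Cts2 h.
Proof. intros H; apply (Ck2_Cts2 0), H. Qed.
Lemma smooth2_dx h : smooth2 h -> smooth2 (dx h).
Proof. intros H n; apply Ck2_dx, H. Qed.
Lemma smooth2_dy h : smooth2 h -> smooth2 (dy h).
Proof. intros H n; apply Ck2_dy, H. Qed.
Lemma smooth2_is_dx h x y : smooth2 h -> is_derive (fun s => h s y) x (dx h x y).
Proof. intros H; apply (is_derive_dx 0), H. Qed.
Lemma smooth2_is_dy h x y : smooth2 h -> is_derive (fun s => h x s) y (dy h x y).
Proof. intros H; apply (is_derive_dy 0), H. Qed.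

(** * Integrals along the linear flow *)

Definition flow_int (w : R -> R) (om T : R) (h : R -> R -> R) : R -> R -> R :=
  fun x y => RInt (fun t => w t * h (x + om * t) (y + t)) 0 T.

Definition flow_derive (om : R) (h : R -> R -> R) : R -> R -> R :=
  fun x y => om * dx h x y + dy h x y.

Lemma Cts_flow_integrand w om h x y : Cts w -> Cts2 h ->
  Cts (fun t => w t * h (x + om * t) (y + t)).
Proof. intros; cts. Qed.

(** The segment of the orbit and its neighbours stay in a rectangle, on which [h] is
uniformly continuous. *)
Lemma Cts2_flow_int w om T h : 0 <= T -> Cts w -> Cts2 h -> Cts2 (flow_int w om T h).
Proof.
  intros HT Hw Hh.
  apply (Cts2_RInt_unif (fun x y t => w t * h (x + om * t) (y + t))); auto.
  - intros; apply Cts_flow_integrand; auto.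
  - intros x y eps.
    destruct (bounded_on w 0 T Hw) as [M [M0 HM]].
    set (B := Rabs om * T).
    assert (HB : 0 <= B) by (apply Rmult_le_pos; [apply Rabs_pos | auto]).
    assert (He : 0 < eps / (M + 1)) by (apply Rdiv_lt_0_compat; [apply eps | lra]).
    destruct (uniform_continuity_2d h (x - B - 1) (x + B + 1) (y - 1) (y + T + 1)
                (fun u v _ _ => Hh u v) (mkposreal _ He)) as [d Hd]; simpl in Hd.
    assert (Hm : 0 < Rmin d 1) by (apply Rmin_pos; [apply d | lra]).
    exists (mkposreal _ Hm); simpl; intros x' y' Hx Hy t Ht.
    assert (Hx1 := Rlt_le_trans _ _ _ Hx (Rmin_l _ _)).
    assert (Hy1 := Rlt_le_trans _ _ _ Hy (Rmin_l _ _)).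
    assert (Hx2 := Rlt_le_trans _ _ _ Hx (Rmin_r _ _)).
    assert (Hy2 := Rlt_le_trans _ _ _ Hy (Rmin_r _ _)).
    apply Rabs_def2 in Hx2; apply Rabs_def2 in Hy2.
    assert (Ho : - B <= om * t <= B).
    { apply Rabs_le_between. unfold B. rewrite Rabs_mult, (Rabs_right t) by lra.
      apply Rmult_le_compat_l; [apply Rabs_pos | lra]. }
    rewrite <- Rmult_minus_distr_l, Rabs_mult.
    apply Rle_trans with (M * (eps / (M + 1))).
    + apply Rmult_le_compat; try apply Rabs_pos; [apply HM; auto|].
      apply Rlt_le, Hd; try lra.
      * replace (x' + om * t - (x + om * t)) with (x' - x) by ring; auto.
      * replace (y' + t - (y + t)) with (y' - y) by ring; auto.
    + apply Rle_trans with ((M + 1) * (eps / (M + 1))); [nra | right; field; lra].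
Qed.

Lemma is_derive_shift (f : R -> R) c x l : is_derive f (x + c) l -> is_derive (fun z => f (z + c)) x l.
Proof.
  intros H. replace l with (scal 1 l) by apply Rmult_1_l.
  apply (is_derive_comp f (fun z => z + c)); auto. auto_derive; auto.
Qed.

Lemma is_derive_flow_int_x w om T n h x y : 0 <= T -> Cts w -> Ck2 (S n) h ->
  is_derive (fun s => flow_int w om T h s y) x (flow_int w om T (dx h) x y).
Proof.
  intros HT Hw Hh; unfold flow_int.
  assert (HD : forall s t, is_derive (fun s => w t * h (s + om * t) (y + t)) s
                 (w t * dx h (s + om * t) (y + t))).
  { intros s t. apply (is_derive_scal (fun s => h (s + om * t) (y + t))).
    apply (is_derive_shift (fun s => h s (y + t))), (is_derive_dx n), Hh. }
  assert (C1 := Ck2_Cts2 _ _ Hh). assert (C2 := Ck2_Cts2 _ _ (Ck2_dx _ _ Hh)).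
  rewrite (RInt_ext_all _ (fun t => Derive (fun s => w t * h (s + om * t) (y + t)) x))
    by (intros; symmetry; apply is_derive_unique, HD).
  apply (is_derive_RInt_param (fun s t => w t * h (s + om * t) (y + t)) 0 T x).
  - apply filter_forall; intros; eexists; apply HD.
  - intros t _. apply (continuity_2d_pt_ext (fun s t => w t * dx h (s + om * t) (y + t))).
    + intros; symmetry; apply is_derive_unique, HD.
    + revert x t. change (Cts2 (fun s t => w t * dx h (s + om * t) (y + t))). cts.
  - apply filter_forall; intros; apply Cts_ex_RInt. cts.
Qed.

Lemma is_derive_flow_int_y w om T n h x y : 0 <= T -> Cts w -> Ck2 (S n) h ->
  is_derive (fun s => flow_int w om T h x s) y (flow_int w om T (dy h) x y).
Proof.
  intros HT Hw Hh; unfold flow_int.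
  assert (HD : forall s t, is_derive (fun s => w t * h (x + om * t) (s + t)) s
                 (w t * dy h (x + om * t) (s + t))).
  { intros s t. apply (is_derive_scal (fun s => h (x + om * t) (s + t))).
    apply (is_derive_shift (fun s => h (x + om * t) s)), (is_derive_dy n), Hh. }
  assert (C1 := Ck2_Cts2 _ _ Hh). assert (C2 := Ck2_Cts2 _ _ (Ck2_dy _ _ Hh)).
  rewrite (RInt_ext_all _ (fun t => Derive (fun s => w t * h (x + om * t) (s + t)) y))
    by (intros; symmetry; apply is_derive_unique, HD).
  apply (is_derive_RInt_param (fun s t => w t * h (x + om * t) (s + t)) 0 T y).
  - apply filter_forall; intros; eexists; apply HD.
  - intros t _. apply (continuity_2d_pt_ext (fun s t => w t * dy h (x + om * t) (s + t))).
    + intros; symmetry; apply is_derive_unique, HD.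
    + revert y t HD. intros y t _. revert y t. change (Cts2 (fun s t => w t * dy h (x + om * t) (s + t))). cts.
  - apply filter_forall; intros; apply Cts_ex_RInt. cts.
Qed.

Lemma smooth2_flow_int w om T h : 0 <= T -> Cts w -> smooth2 h -> smooth2 (flow_int w om T h).
Proof.
  intros HT Hw H n; revert h H; induction n as [|n IH]; intros h H.
  - split; [apply Cts2_flow_int; auto using smooth2_Cts2 | exact I].
  - apply (Ck2_S_intro n _ (flow_int w om T (dx h)) (flow_int w om T (dy h))).
    + apply Cts2_flow_int; auto using smooth2_Cts2.
    + intros; apply (is_derive_flow_int_x w om T 0); auto.
    + intros; apply (is_derive_flow_int_y w om T 0); auto.
    + apply IH, smooth2_dx, H.
    + apply IH, smooth2_dy, H.
Qed.

Lemma dx_flow_int w om T h x y : 0 <= T -> Cts w -> smooth2 h ->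
  dx (flow_int w om T h) x y = flow_int w om T (dx h) x y.
Proof. intros; apply is_derive_unique, (is_derive_flow_int_x w om T 0); auto. Qed.
Lemma dy_flow_int w om T h x y : 0 <= T -> Cts w -> smooth2 h ->
  dy (flow_int w om T h) x y = flow_int w om T (dy h) x y.
Proof. intros; apply is_derive_unique, (is_derive_flow_int_y w om T 0); auto. Qed.

Lemma periodic2_flow_int w om T h : periodic2 h -> periodic2 (flow_int w om T h).
Proof.
  intros H x y; unfold flow_int; split; apply RInt_ext_all; intros t.
  - replace (x + 1 + om * t) with (x + om * t + 1) by ring.
    rewrite (proj1 (H _ _)); reflexivity.
  - replace (y + 1 + t) with (y + t + 1) by ring.
    rewrite (proj2 (H _ _)); reflexivity.
Qed.

Lemma flow_int_ext w om T f g x y : (forall x y, f x y = g x y) ->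
  flow_int w om T f x y = flow_int w om T g x y.
Proof. intros H; apply RInt_ext_all; intros; rewrite H; reflexivity. Qed.

Lemma flow_int_plus w om T f g x y : Cts w -> Cts2 f -> Cts2 g ->
  flow_int w om T (fun x y => f x y + g x y) x y =
  flow_int w om T f x y + flow_int w om T g x y.
Proof.
  intros; unfold flow_int. rewrite <- RInt_plus_R by (apply Cts_flow_integrand; auto).
  apply RInt_ext_all; intros; ring.
Qed.

Lemma flow_int_scal w om T c f x y : Cts w -> Cts2 f ->
  flow_int w om T (fun x y => c * f x y) x y = c * flow_int w om T f x y.
Proof.
  intros; unfold flow_int. rewrite <- RInt_scal_l by (apply Cts_flow_integrand; auto).
  apply RInt_ext_all; intros; ring.
Qed.

(** The chain rule; [h] is differentiable as a function of two variables because
its partial derivatives are continuous. *)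
Lemma is_derive_along_flow om h x y t : smooth2 h ->
  is_derive (fun t => h (x + om * t) (y + t)) t (flow_derive om h (x + om * t) (y + t)).
Proof.
  intros H. apply is_derive_Reals.
  replace (flow_derive om h (x + om * t) (y + t)) with
    (dx h (x + om * t) (y + t) * om + dy h (x + om * t) (y + t) * 1)
    by (unfold flow_derive; ring).
  apply (derivable_pt_lim_comp_2d h (fun t => x + om * t) (fun t => y + t)).
  - apply filterdiff_differentiable_pt_lim.
    apply (is_derive_filterdiff h _ _ (dx h)).
    + apply filter_forall; intros u; apply smooth2_is_dx, H.
    + apply smooth2_is_dy, H.
    + apply (proj1 (Cts2_filter (dx h))), smooth2_Cts2, smooth2_dx, H.
  - apply is_derive_Reals. auto_derive; auto; ring.
  - apply is_derive_Reals. auto_derive; auto; ring.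
Qed.

Lemma smooth2_flow_derive om h : smooth2 h -> smooth2 (flow_derive om h).
Proof. intros H; apply smooth2_plus; [apply smooth2_scal, smooth2_dx, H | apply smooth2_dy, H]. Qed.

Lemma flow_derive_flow_int w om T h x y : 0 <= T -> Cts w -> smooth2 h ->
  flow_derive om (flow_int w om T h) x y = flow_int w om T (flow_derive om h) x y.
Proof.
  intros HT Hw H; unfold flow_derive at 1.
  rewrite dx_flow_int, dy_flow_int by auto.
  unfold flow_derive. rewrite flow_int_plus, flow_int_scal; auto;
  try apply Cts2_mult; auto using Cts2_const, smooth2_Cts2, smooth2_dx, smooth2_dy.
Qed.

(** * Averaging over closed orbits and the homological equation *)

(** The mean over the orbit of X_0 through the point, which closes after time [q]. *)
Definition avg (p q : Z) : (R -> R -> R) -> R -> R -> R :=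
  flow_int (fun _ => / IZR q) (IZR p / IZR q) (IZR q).

(** A right inverse of the derivative along X_0 on functions of mean zero along the
orbits.  Any weight t/q + c would do for that; c = -1/2 makes the integral of
the weight vanish, and with it the resonant coefficients of the result. *)
Definition antider (p q : Z) : (R -> R -> R) -> R -> R -> R :=
  flow_int (fun t => (t - IZR q / 2) / IZR q) (IZR p / IZR q) (IZR q).

Lemma periodic2_Z h m n x y : periodic2 h -> h (x + IZR m) (y + IZR n) = h x y.
Proof.
  intros H. transitivity (h x (y + IZR n)).
  - apply (periodic_Z (fun x => h x (y + IZR n))). intros s; apply H.
  - apply (periodic_Z (fun y => h x y)). intros s; apply H.
Qed.

Lemma flow_constant om h x y s : smooth2 h -> (forall x y, flow_derive om h x y = 0) ->
  h (x + om * s) (y + s) = h x y.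
Proof.
  intros H H0.
  destruct (MVT_R (fun t => h (x + om * (t * s)) (y + t * s)) (fun _ => 0) 0 1) as [c [_ E]].
  - intros t. replace 0 with (scal s 0) by (apply Rmult_0_r).
    apply (is_derive_comp (fun t => h (x + om * t) (y + t)) (fun t => t * s)).
    + rewrite <- (H0 (x + om * (t * s)) (y + t * s)). apply is_derive_along_flow, H.
    + auto_derive; auto; ring.
  - lra.
  - replace (x + om * (1 * s)) with (x + om * s) in E by ring.
    replace (y + 1 * s) with (y + s) in E by ring.
    replace (x + om * (0 * s)) with x in E by ring.
    replace (y + 0 * s) with y in E by ring. lra.
Qed.

Lemma flow_return p q h x y : (0 < q)%Z -> periodic2 h ->
  h (x + IZR p / IZR q * IZR q) (y + IZR q) = h x y.
Proof.
  intros Hq H. apply IZR_lt in Hq.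
  replace (IZR p / IZR q * IZR q) with (IZR p) by (field; lra). apply periodic2_Z, H.
Qed.

(** Integrate by parts along the orbit.  The weight has slope 1/q, which produces the
mean, and takes the values 1/2 and -1/2 at the two ends of the orbit, where [h]
takes the same value. *)
Lemma antider_spec p q h x y : (0 < q)%Z -> smooth2 h -> periodic2 h ->
  flow_derive (IZR p / IZR q) (antider p q h) x y = h x y - avg p q h x y.
Proof.
  intros Hq Hs Hp. assert (Q := IZR_lt _ _ Hq).
  unfold antider. rewrite flow_derive_flow_int by (auto; try lra; cts).
  assert (C0 := smooth2_Cts2 _ Hs).
  assert (C1 := smooth2_Cts2 _ (smooth2_flow_derive (IZR p / IZR q) _ Hs)).
  unfold avg, flow_int. set (om := IZR p / IZR q) in *.
  set (u := fun t => h (x + om * t) (y + t)).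
  assert (F : RInt (fun t => / IZR q * u t +
     (t - IZR q / 2) / IZR q * flow_derive om h (x + om * t) (y + t)) 0 (IZR q) = h x y).
  { rewrite (RInt_FTC (fun t => (t - IZR q / 2) / IZR q * u t)).
    - unfold u, om. rewrite flow_return by auto. rewrite Rmult_0_r, !Rplus_0_r. real_equation; field; lra.
    - intros t. unfold u.
      apply (is_derive_mult (fun t => (t - IZR q / 2) / IZR q) (fun t => h (x + om * t) (y + t)) t
              (/ IZR q)).
      + auto_derive; auto; field; lra.
      + apply is_derive_along_flow, Hs.
      + intros; apply Rmult_comm.
    - unfold u; cts. }
  rewrite RInt_plus_R in F by (unfold u; cts).
  unfold u in F. real_equation; lra.
Qed.

Lemma avg_flow_derive p q h x y : (0 < q)%Z -> smooth2 h -> periodic2 h ->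
  avg p q (flow_derive (IZR p / IZR q) h) x y = 0.
Proof.
  intros Hq Hs Hp. assert (Q := IZR_lt _ _ Hq).
  assert (C1 := smooth2_Cts2 _ (smooth2_flow_derive (IZR p / IZR q) _ Hs)).
  unfold avg, flow_int. set (om := IZR p / IZR q) in *.
  rewrite RInt_scal_l by cts.
  rewrite (RInt_FTC (fun t => h (x + om * t) (y + t))).
  - unfold om; rewrite flow_return by auto. rewrite Rmult_0_r, !Rplus_0_r. real_equation; ring.
  - intros t; apply is_derive_along_flow, Hs.
  - cts.
Qed.

Lemma smooth2_avg p q h : (0 < q)%Z -> smooth2 h -> smooth2 (avg p q h).
Proof. intros Hq; apply smooth2_flow_int; [apply Rlt_le, (IZR_lt 0), Hq | cts]. Qed.
Lemma smooth2_antider p q h : (0 < q)%Z -> smooth2 h -> smooth2 (antider p q h).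
Proof. intros Hq; apply smooth2_flow_int; [apply Rlt_le, (IZR_lt 0), Hq | cts]. Qed.
Lemma periodic2_avg p q h : periodic2 h -> periodic2 (avg p q h).
Proof. apply periodic2_flow_int. Qed.
Lemma periodic2_antider p q h : periodic2 h -> periodic2 (antider p q h).
Proof. apply periodic2_flow_int. Qed.

Definition flow_invariant (om : R) (b : R -> R -> R) : Prop :=
  forall x y s, b (x + om * s) (y + s) = b x y.

(** Averaging commutes with the derivative along the flow, and annihilates it. *)
Lemma avg_invariant p q h : (0 < q)%Z -> smooth2 h -> periodic2 h ->
  flow_invariant (IZR p / IZR q) (avg p q h).
Proof.
  intros Hq Hs Hp x y s. apply flow_constant; [apply smooth2_avg; auto|].
  intros x' y'. unfold avg. rewrite flow_derive_flow_int; auto.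
  - apply avg_flow_derive; auto.
  - apply Rlt_le, (IZR_lt 0), Hq.
  - cts.
Qed.

Lemma avg_of_invariant p q b x y : (0 < q)%Z -> flow_invariant (IZR p / IZR q) b ->
  avg p q b x y = b x y.
Proof.
  intros Hq Hb. assert (Q := IZR_lt _ _ Hq). unfold avg, flow_int.
  rewrite (RInt_ext_all _ (fun _ => / IZR q * b x y)) by (intros; rewrite Hb; reflexivity).
  rewrite RInt_const_R. real_equation; field; lra.
Qed.

Lemma invariant_section om b x y : flow_invariant om b -> b x y = b (x - om * y) 0.
Proof.
  intros H. rewrite <- (H (x - om * y) 0 y). f_equal; ring.
Qed.

Lemma avg_plus p q f g x y : Cts2 f -> Cts2 g ->
  avg p q (fun x y => f x y + g x y) x y = avg p q f x y + avg p q g x y.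
Proof. intros; apply flow_int_plus; auto; cts. Qed.
Lemma avg_scal p q c f x y : Cts2 f ->
  avg p q (fun x y => c * f x y) x y = c * avg p q f x y.
Proof. intros; apply flow_int_scal; auto; cts. Qed.
Lemma avg_const p q c x y : (0 < q)%Z -> avg p q (fun _ _ => c) x y = c.
Proof. intros Hq; apply (avg_of_invariant p q (fun _ _ => c)); auto. intros ? ? ?; auto. Qed.

(** The orbit winds [p] times around the first circle. *)
Lemma avg_fst p q f x y : (0 < p)%Z -> (0 < q)%Z -> Cts f -> periodic f ->
  avg p q (fun x _ => f x) x y = RInt f 0 1.
Proof.
  intros Hp Hq Hf Pf. assert (P := IZR_lt _ _ Hp). assert (Q := IZR_lt _ _ Hq).
  unfold avg, flow_int. rewrite RInt_scal_l by cts.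
  assert (A := RInt_affine f 0 (IZR q) (IZR p / IZR q) x Hf).
  replace (IZR p / IZR q * IZR q + x) with (x + IZR p) in A by (field; lra).
  replace (IZR p / IZR q * 0 + x) with x in A by ring.
  rewrite (RInt_period_Z f x p) in A by (auto; lia).
  rewrite (RInt_ext_all (fun t => f (IZR p / IZR q * t + x)) (fun t => f (x + IZR p / IZR q * t))) in A
    by (intros; f_equal; ring).
  apply (Rmult_eq_reg_l (IZR p)); [|lra].
  rewrite <- A. real_equation; field; lra.
Qed.

Lemma avg_snd p q g x y : (0 < q)%Z -> Cts g -> periodic g ->
  avg p q (fun _ y => g y) x y = RInt g 0 1.
Proof.
  intros Hq Hg Pg. assert (Q := IZR_lt _ _ Hq).
  unfold avg, flow_int. rewrite RInt_scal_l by cts.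
  rewrite (RInt_ext_all _ (fun t => g (t + y))) by (intros; f_equal; ring).
  rewrite (RInt_shift g) by auto. rewrite Rplus_0_l, Rplus_comm.
  rewrite (RInt_period_Z g) by (auto; lia). real_equation; field; lra.
Qed.

(** * Fourier coefficients on the torus and resonance *)

(** The two-dimensional analogue of [trig]. *)
Definition trig2 (h : R -> R -> R) (k l : Z) (b : R) : R :=
  RInt (fun x => RInt (fun y => h x y * cos (2 * PI * (IZR k * x + IZR l * y) + b)) 0 1) 0 1.

Lemma fcoef2_trig h k l : Cts2 h -> fcoef2 h k l = (trig2 h k l 0, trig2 h k l (PI / 2)).
Proof.
  intros H; unfold fcoef2, trig2.
  rewrite <- RInt_C_pair.
  - apply (RInt_ext (V := C_R_CompleteNormedModule)); intros x _.
    rewrite <- RInt_C_pair by cts.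
    apply (RInt_ext (V := C_R_CompleteNormedModule)); intros y _.
    rewrite real_expi_neg, Rplus_0_r; reflexivity.
  - apply (Cts_RInt_param (fun x y => h x y * cos (2 * PI * (IZR k * x + IZR l * y) + 0))); [lra | cts].
  - apply (Cts_RInt_param (fun x y => h x y * cos (2 * PI * (IZR k * x + IZR l * y) + PI / 2))); [lra | cts].
Qed.

Lemma trig2_ext f g k l b : (forall x y, f x y = g x y) -> trig2 f k l b = trig2 g k l b.
Proof. intros H; apply RInt_ext_all; intros x; apply RInt_ext_all; intros y; rewrite H; auto. Qed.

Lemma torus_shift H a c : Cts2 H -> periodic2 H ->
  RInt (fun x => RInt (fun y => H (x + a) (y + c)) 0 1) 0 1 =
  RInt (fun x => RInt (fun y => H x y) 0 1) 0 1.
Proof.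
  intros HC HP.
  set (K := fun x : R => RInt (fun y => H x y) 0 1).
  assert (CK : Cts K) by (apply Cts_RInt_param; [lra | auto]).
  rewrite (RInt_ext_all _ (fun x => K (x + a))).
  - rewrite (RInt_shift K) by auto. rewrite Rplus_0_l, (Rplus_comm 1).
    apply RInt_period; auto. intros x; apply RInt_ext_all; intros y; apply HP.
  - intros x. rewrite (RInt_shift (fun y => H (x + a) y)) by cts.
    rewrite Rplus_0_l, (Rplus_comm 1).
    apply RInt_period; [cts | intros y; apply HP].
Qed.

Lemma periodic2_char k l b :
  periodic2 (fun x y => cos (2 * PI * (IZR k * x + IZR l * y) + b)).
Proof.
  intros x y; split.
  - rewrite <- (cos_2PI_Z (2 * PI * (IZR k * x + IZR l * y) + b) k); f_equal; ring.
  - rewrite <- (cos_2PI_Z (2 * PI * (IZR k * x + IZR l * y) + b) l); f_equal; ring.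
Qed.

Lemma periodic2_mult f g : periodic2 f -> periodic2 g -> periodic2 (fun x y => f x y * g x y).
Proof.
  intros Hf Hg x y. rewrite (proj1 (Hf x y)), (proj1 (Hg x y)).
  rewrite (proj2 (Hf x y)), (proj2 (Hg x y)); auto.
Qed.

Lemma trig2_shift h k l b a c : Cts2 h -> periodic2 h ->
  trig2 (fun x y => h (x + a) (y + c)) k l b = trig2 h k l (b - 2 * PI * (IZR k * a + IZR l * c)).
Proof.
  intros HC HP; unfold trig2 at 2.
  rewrite <- (torus_shift (fun x y => h x y *
     cos (2 * PI * (IZR k * x + IZR l * y) + (b - 2 * PI * (IZR k * a + IZR l * c)))) a c).
  - apply RInt_ext_all; intros x; apply RInt_ext_all; intros y. do 2 f_equal; ring.
  - cts.
  - apply periodic2_mult; auto. apply periodic2_char.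
Qed.

Lemma trig2_antiphase h k l b : Cts2 h -> trig2 h k l (b - PI) = - trig2 h k l b.
Proof.
  intros HC; unfold trig2.
  replace (- RInt (fun x => RInt (fun y => h x y * cos (2 * PI * (IZR k * x + IZR l * y) + b)) 0 1) 0 1)
    with (-1 * RInt (fun x => RInt (fun y => h x y * cos (2 * PI * (IZR k * x + IZR l * y) + b)) 0 1) 0 1)
    by (real_equation; ring).
  rewrite <- RInt_scal_l.
  - apply RInt_ext_all; intros x. rewrite <- RInt_scal_l by cts.
    apply RInt_ext_all; intros y.
    replace (2 * PI * (IZR k * x + IZR l * y) + (b - PI)) with
      (- (PI - (2 * PI * (IZR k * x + IZR l * y) + b))) by ring.
    rewrite cos_neg, Rtrigo_facts.cos_pi_minus; ring.
  - apply (Cts_RInt_param (fun x y => h x y * cos (2 * PI * (IZR k * x + IZR l * y) + b))); [lra | cts].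
Qed.

Lemma resonant_index_freq p q k l : (0 < q)%Z ->
  resonant_index p q k l <-> IZR k * (IZR p / IZR q) + IZR l = 0.
Proof.
  intros Hq; apply (IZR_lt 0) in Hq; unfold resonant_index.
  transitivity (IZR (p * k + q * l) = 0).
  - split; [intros ->; auto | apply eq_IZR_R0].
  - rewrite plus_IZR, !mult_IZR.
    replace (IZR p * IZR k + IZR q * IZR l) with
      (IZR q * (IZR k * (IZR p / IZR q) + IZR l)) by (field; lra).
    split; intros H; [|rewrite H; ring].
    destruct (Rmult_integral _ _ H); auto; lra.
Qed.

(** Moving along the flow by half a period of the mode leaves the function unchanged
and changes the sign of the coefficient. *)
Lemma invariant_nonresonant p q b k l : (0 < q)%Z -> Cts2 b -> periodic2 b ->
  flow_invariant (IZR p / IZR q) b -> ~ resonant_index p q k l -> fcoef2 b k l = RtoC 0.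
Proof.
  intros Hq HC HP HI Hn. rewrite resonant_index_freq in Hn by auto.
  set (om := IZR p / IZR q) in *. set (d := IZR k * om + IZR l) in *.
  assert (Z : forall be, trig2 b k l be = 0).
  { intros be. assert (S := trig2_shift b k l be (om * / (2 * d)) (/ (2 * d)) HC HP).
    rewrite (trig2_ext _ b) in S by (intros; apply HI).
    replace (be - _) with (be - PI) in S
      by (unfold d; field; exact Hn).
    rewrite trig2_antiphase in S by auto. lra. }
  rewrite fcoef2_trig, !Z by auto. reflexivity.
Qed.

(** Translation by the flow does not change a resonant mode, so each translate of
[h] has the same coefficient and only the weight is integrated. *)
Lemma trig2_flow_int w om T h k l b : 0 <= T -> Cts w -> Cts2 h -> periodic2 h ->
  IZR k * om + IZR l = 0 ->
  trig2 (flow_int w om T h) k l b = RInt w 0 T * trig2 h k l b.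
Proof.
  intros HT Hw HC HP Hr.
  set (H := fun x y => h x y * cos (2 * PI * (IZR k * x + IZR l * y) + b)).
  assert (CH : Cts2 H) by (unfold H; cts).
  assert (PH : periodic2 H) by (apply periodic2_mult; [auto | apply periodic2_char]).
  set (K := fun x : R => RInt (fun y => H x y) 0 1).
  assert (CK : Cts K) by (apply Cts_RInt_param; [lra | auto]).
  assert (PK : periodic K) by (intros x; apply RInt_ext_all; intros y; apply PH).
  change (trig2 h k l b) with (RInt K 0 1).
  unfold trig2, flow_int.
  rewrite (RInt_ext_all _ (fun x => RInt (fun t => w t * K (x + om * t)) 0 T)).
  - rewrite RInt_swap by (auto; cts).
    rewrite (RInt_ext_all _ (fun t => RInt K 0 1 * w t)).
    + rewrite RInt_scal_l by auto. real_equation; ring.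
    + intros t. rewrite RInt_scal_l by cts.
      rewrite (RInt_shift K) by auto. rewrite Rplus_0_l, (Rplus_comm 1), RInt_period by auto.
      real_equation; ring.
  - intros x.
    rewrite (RInt_ext_all _ (fun y => RInt (fun t => w t * H (x + om * t) (y + t)) 0 T)).
    + rewrite (RInt_swap (fun y t => w t * H (x + om * t) (y + t))) by (auto; cts).
      apply RInt_ext_all; intros t. rewrite RInt_scal_l by cts. f_equal.
      rewrite (RInt_shift (fun y => H (x + om * t) y)) by cts.
      rewrite Rplus_0_l, (Rplus_comm 1), RInt_period; [reflexivity | cts | intros y; apply PH].
    + intros y. rewrite Rmult_comm, <- RInt_scal_l by cts.
      apply RInt_ext_all; intros t. unfold H.
      replace (2 * PI * (IZR k * (x + om * t) + IZR l * (y + t)) + b) with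
        (2 * PI * (IZR k * x + IZR l * y + (IZR k * om + IZR l) * t) + b) by ring.
      rewrite Hr, Rmult_0_l, Rplus_0_r; ring.
Qed.

Lemma antider_resonant p q h k l : (0 < q)%Z -> Cts2 h -> periodic2 h ->
  resonant_index p q k l -> fcoef2 (antider p q h) k l = RtoC 0.
Proof.
  intros Hq HC HP Hr. apply (resonant_index_freq p q k l Hq) in Hr.
  assert (Q := IZR_lt _ _ Hq).
  assert (W : Cts (fun t => (t - IZR q / 2) / IZR q)) by cts.
  assert (I0 : RInt (fun t => (t - IZR q / 2) / IZR q) 0 (IZR q) = 0).
  { rewrite (RInt_FTC (fun t => (t ^ 2 - IZR q * t) / (2 * IZR q))); auto.
    - real_equation; field; lra.
    - intros t; auto_derive; auto; field; lra. }
  unfold antider. rewrite fcoef2_trig by (apply Cts2_flow_int; auto; lra).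
  rewrite !trig2_flow_int, I0, !Rmult_0_l by (auto; lra). reflexivity.
Qed.

Lemma avg_resonant p q h k l : (0 < q)%Z -> Cts2 h -> periodic2 h ->
  resonant_index p q k l -> fcoef2 (avg p q h) k l = fcoef2 h k l.
Proof.
  intros Hq HC HP Hr. apply (resonant_index_freq p q k l Hq) in Hr.
  assert (Q := IZR_lt _ _ Hq).
  assert (W : Cts (fun t : R => / IZR q)) by cts.
  unfold avg. rewrite !fcoef2_trig by (auto; apply Cts2_flow_int; auto; lra).
  rewrite !trig2_flow_int by (auto; lra).
  rewrite RInt_const_R. apply C_eq; field; lra.
Qed.

Lemma fcoef2_minus f g k l : Cts2 f -> Cts2 g ->
  fcoef2 (fun x y => f x y - g x y) k l = (fcoef2 f k l - fcoef2 g k l)%C.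
Proof.
  intros Hf Hg. rewrite !fcoef2_trig by (auto; cts).
  assert (E : forall b, trig2 (fun x y => f x y - g x y) k l b = trig2 f k l b - trig2 g k l b).
  { intros b; unfold trig2.
    rewrite <- RInt_minus_R by (apply (Cts_RInt_param (fun x y => _ x y * cos (2 * PI * (IZR k * x + IZR l * y) + b))); [lra | cts]).
    apply RInt_ext_all; intros x. rewrite <- RInt_minus_R by cts.
    apply RInt_ext_all; intros y; ring. }
  rewrite !E; reflexivity.
Qed.

Lemma fcoef2_tensor f g k l : Cts f -> Cts g ->
  fcoef2 (fun x y => f x * g y) k l = (fcoef f k * fcoef g l)%C.
Proof.
  intros Hf Hg. rewrite fcoef2_trig, !fcoef_trig by (auto; cts).
  assert (E : forall b, trig2 (fun x y => f x * g y) k l b =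
     trig g l 0 * trig f k b + trig g l (PI / 2) * trig f k (b - PI / 2)).
  { intros b. unfold trig2.
    rewrite (RInt_ext_all _ (fun x => trig g l 0 * (f x * cos (2 * PI * IZR k * x + b))
       + trig g l (PI / 2) * (f x * cos (2 * PI * IZR k * x + (b - PI / 2))))).
    - rewrite RInt_plus_R, !RInt_scal_l by cts. reflexivity.
    - intros x.
      replace (cos (2 * PI * IZR k * x + (b - PI / 2))) with (sin (2 * PI * IZR k * x + b)).
      2:{ rewrite <- cos_shift, <- cos_neg; f_equal; ring. }
      transitivity (f x * trig g l (2 * PI * IZR k * x + b)).
      + unfold trig; rewrite <- RInt_scal_l by cts.
        apply RInt_ext_all; intros y. rewrite Rmult_assoc. do 3 f_equal; ring.
      + rewrite (trig_phase g l) by auto. ring. }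
  rewrite !E. unfold Cmult; simpl.
  rewrite (trig_phase f k (0 - PI / 2)) by auto.
  replace (PI / 2 - PI / 2) with 0 by ring.
  rewrite Rminus_0_l, cos_neg, sin_neg, cos_PI2, sin_PI2. apply C_eq; ring.
Qed.

(** * Fourier series of functions constant along the flow *)

(** As [b x y] depends only on x - (p/q) y, it is [C (q x - p y)] for the function
[C v = b (v / q) 0].  Bezout coefficients for [p] and [q] combine translation
along the flow with translations by periods into a translation of [C] by 1, so
[C] has period 1, and its Fourier coefficients are the resonant ones of [b]. *)
Theorem invariant_series p q b u : (0 < p)%Z -> (0 < q)%Z -> Z.gcd p q = 1%Z ->
  smooth2 b -> periodic2 b -> flow_invariant (IZR p / IZR q) b ->
  is_zseries (fun m => fcoef2 b (m * q) (- (m * p)) * expi (2 * PI * IZR m * IZR q * u))%C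
    (RtoC (b u 0)).
Proof.
  intros Hp Hq Hg Hs HP HI. assert (P := IZR_lt _ _ Hp). assert (Q := IZR_lt _ _ Hq).
  set (C := fun v : R => b (/ IZR q * v) 0).
  assert (Cb := smooth2_Cts2 b Hs).
  assert (sect : forall h, smooth2 h -> forall v,
    is_derive (fun v => h (/ IZR q * v) 0) v (/ IZR q * dx h (/ IZR q * v) 0)).
  { intros h Hh v. apply (is_derive_comp (fun x => h x 0) (fun v => / IZR q * v)).
    - apply smooth2_is_dx, Hh.
    - auto_derive; auto; ring. }
  assert (D1 : forall v, is_derive C v (/ IZR q * dx b (/ IZR q * v) 0)) by (apply sect, Hs).
  assert (D2 : forall v, is_derive (fun v => / IZR q * dx b (/ IZR q * v) 0) v
     (/ IZR q * (/ IZR q * dx (dx b) (/ IZR q * v) 0))).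
  { intros v; apply (is_derive_scal (fun v => dx b (/ IZR q * v) 0)).
    apply sect, smooth2_dx, Hs. }
  assert (CC := Cts_derive _ _ D1).
  assert (PC : periodic C).
  { intros v; unfold C.
    destruct (Z.gcd_bezout p q 1) as [s [t B]].
    { rewrite Hg; reflexivity. }
    replace (/ IZR q * (v + 1)) with
      (/ IZR q * v + IZR p / IZR q * IZR s + IZR t).
    - rewrite <- (HI (/ IZR q * v) 0 (IZR s)).
      rewrite <- (periodic2_Z b t (- s) _ (0 + IZR s) HP).
      f_equal. rewrite opp_IZR; ring.
    - apply (f_equal IZR) in B. rewrite plus_IZR, !mult_IZR in B.
      apply (Rmult_eq_reg_l (IZR q)); [|lra]. field_simplify; lra. }
  assert (E : forall m be, trig2 b (m * q) (- (m * p)) be = trig C m be).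
  { intros m be.
    set (chi := fun v : R => C v * cos (2 * PI * IZR m * v + be)).
    assert (Cchi : Cts chi) by (unfold chi; cts).
    assert (Pchi : periodic chi).
    { intros v; unfold chi. rewrite PC, <- (cos_2PI_Z (2 * PI * IZR m * v + be) m).
      do 2 f_equal; ring. }
    unfold trig2. rewrite (RInt_ext_all _ (fun _ => RInt chi 0 1)).
    - rewrite RInt_const_R. unfold trig; fold chi. change (RInt chi 0 1) with (trig C m be).
      real_equation; ring.
    - intros x.
      rewrite (RInt_ext_all _ (fun y => chi (- IZR p * y + IZR q * x))).
      + assert (A := RInt_affine chi 0 1 (- IZR p) (IZR q * x) Cchi).
        rewrite <- (opp_RInt_swap chi) in A by auto. change opp with Ropp in A.
        replace (- IZR p * 0 + IZR q * x) with (- IZR p * 1 + IZR q * x + IZR p) in A by ring.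
        rewrite RInt_period_Z in A by (auto; lia).
        apply (Rmult_eq_reg_l (- IZR p)); [|lra]. real_equation; lra.
      + intros y; unfold chi, C. rewrite (invariant_section _ b x y HI). f_equal.
        * f_equal; field; lra.
        * f_equal. rewrite opp_IZR, !mult_IZR; ring. }
  assert (F := fourier_inversion C _ _ (IZR q * u) D1 D2).
  assert (C2 : Cts (fun v => / IZR q * (/ IZR q * dx (dx b) (/ IZR q * v) 0))).
  { assert (X := smooth2_Cts2 _ (smooth2_dx _ (smooth2_dx _ Hs))). cts. }
  specialize (F C2 PC). unfold C at 2 in F.
  replace (/ IZR q * (IZR q * u)) with u in F by (field; lra).
  destruct F as [s1 [s2 [F1 [F2 F3]]]]. exists s1, s2. split; [|split; [|exact F3]].
  - eapply (is_series_ext (V := C_R_NormedModule)); [|exact F1].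
    intros n; cbv beta. rewrite fcoef_trig, fcoef2_trig, !E by auto.
    f_equal; f_equal; ring.
  - eapply (is_series_ext (V := C_R_NormedModule)); [|exact F2].
    intros n; cbv beta. rewrite fcoef_trig, fcoef2_trig, !E by auto.
    f_equal; f_equal; ring.
Qed.

(** * Gaussian integrals *)

(** These functions span a space that is stable under differentiation, which lets one
treat all the derivatives of the Gaussian at once. *)
Definition gauss_moment (a : R) (j : nat) (x : R) : R := x ^ j * exp (- a * x ^ 2).

Lemma exp_INR_mult n x : exp (INR n * x) = exp x ^ n.
Proof.
  induction n as [|n IH].
  - simpl; rewrite Rmult_0_l, exp_0; reflexivity.
  - rewrite S_INR, Rmult_plus_distr_r, exp_plus, IH, Rmult_1_l; simpl; ring.
Qed.

(** The [n]-th power of z/n <= exp (z/n). *)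
Lemma pow_le_exp n z : 0 <= z -> z ^ n <= INR n ^ n * exp z.
Proof.
  intros Hz; destruct n as [|n].
  - simpl. rewrite Rmult_1_l. generalize (exp_ineq1_le z); lra.
  - assert (Hn : 0 < INR (S n)) by (apply lt_0_INR; lia).
    replace (exp z) with (exp (z / INR (S n)) ^ (S n))
      by (rewrite <- exp_INR_mult; f_equal; field; lra).
    rewrite <- Rpow_mult_distr. apply pow_incr; split; auto.
    replace z with (INR (S n) * (z / INR (S n))) at 1 by (field; lra).
    apply Rmult_le_compat_l; [lra|].
    generalize (exp_ineq1_le (z / INR (S n))); lra.
Qed.

(** The decay 1/(1 + y^2) is all that is needed for convergence of the periodized
series, locally uniformly. *)
Lemma gauss_moment_bound a j : 0 < a ->
  exists C, 0 <= C /\ forall y, Rabs (gauss_moment a j y) <= C / (1 + y ^ 2).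
Proof.
  intros Ha.
  set (B := fun n => (INR n / a) ^ n).
  assert (HB : forall n y, (y ^ 2) ^ n * exp (- a * y ^ 2) <= B n).
  { intros n y. unfold B. assert (Hy := pow2_ge_0 y).
    assert (L := pow_le_exp n (a * y ^ 2)).
    rewrite Rpow_mult_distr in L.
    replace (- a * y ^ 2) with (- (a * y ^ 2)) by ring.
    rewrite exp_Ropp. unfold Rdiv; rewrite Rpow_mult_distr, pow_inv.
    assert (0 < a ^ n) by (apply pow_lt; auto).
    assert (He := exp_pos (a * y ^ 2)).
    apply (Rmult_le_reg_l (a ^ n)); auto.
    apply (Rmult_le_reg_r (exp (a * y ^ 2))); auto.
    field_simplify; [|lra|lra]. 
    assert (0 <= a * y ^ 2) by nra. specialize (L H0). lra. }
  assert (HB0 : forall n, 0 <= B n).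
  { intros n; apply pow_le, Rmult_le_pos; [apply pos_INR | apply Rlt_le, Rinv_0_lt_compat, Ha]. }
  exists (B 0%nat + B 1%nat + B j + B (S j)); split.
  - generalize (HB0 0%nat) (HB0 1%nat) (HB0 j) (HB0 (S j)); lra.
  - intros y. assert (Hy := pow2_ge_0 y).
    apply (Rmult_le_reg_r (1 + y ^ 2)); [lra|].
    unfold Rdiv; rewrite Rmult_assoc, Rinv_l, Rmult_1_r by lra.
    unfold gauss_moment. rewrite Rabs_mult, (Rabs_right (exp _)) by (apply Rle_ge, Rlt_le, exp_pos).
    set (e := exp (- a * y ^ 2)). assert (He : 0 < e) by apply exp_pos.
    (* s <= 1 + s^2 turns an arbitrary power into even ones. *)
    assert (A : Rabs (y ^ j) <= 1 + (y ^ 2) ^ j).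
    { rewrite <- pow_mult, Nat.mul_comm, pow_mult.
      rewrite <- (pow2_abs (y ^ j)). generalize (Rabs_pos (y ^ j)); nra. }
    assert (X0 := HB 0%nat y). assert (X1 := HB 1%nat y).
    assert (X2 := HB j y). assert (X3 := HB (S j) y). fold e in X0, X1, X2, X3.
    rewrite pow_O in X0. rewrite pow_1 in X1. rewrite <- (tech_pow_Rmult (y ^ 2)) in X3.
    apply Rle_trans with ((1 + (y ^ 2) ^ j) * e * (1 + y ^ 2)); [|lra].
    apply Rmult_le_compat_r; [lra|]. apply Rmult_le_compat_r; lra.
Qed.

Lemma Cts_gauss_moment a j : Cts (gauss_moment a j).
Proof. unfold gauss_moment; cts. Qed.

Lemma is_derive_gauss_moment a j x :
  is_derive (gauss_moment a j) x (INR j * gauss_moment a (pred j) x + - (2 * a) * gauss_moment a (S j) x).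
Proof.
  unfold gauss_moment. auto_derive; auto.
  destruct j; simpl; ring.
Qed.

Lemma lim_inv_INR C : is_lim_seq (fun n => C * / INR (S n)) 0.
Proof.
  replace (Finite 0) with (Rbar_mult C (Rbar_inv p_infty)) by (simpl; f_equal; ring).
  apply is_lim_seq_scal_l, (is_lim_seq_inv (fun n => INR (S n))); [|discriminate].
  apply -> (is_lim_seq_incr_1 INR). apply is_lim_seq_INR.
Qed.

Lemma gauss_lim a : 0 < a -> is_lim_seq (fun n => exp (- a * INR (S n) ^ 2)) 0.
Proof.
  intros Ha. destruct (gauss_moment_bound a 0 Ha) as [C [C0 HC]].
  apply (is_lim_seq_le_le (fun _ => 0) _ (fun n => C * / INR (S n))).
  - intros n; split; [apply Rlt_le, exp_pos|].
    assert (X := HC (INR (S n))). unfold gauss_moment in X.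
    rewrite Rabs_right in X by (simpl; rewrite Rmult_1_l; apply Rle_ge, Rlt_le, exp_pos).
    rewrite pow_O, Rmult_1_l in X. eapply Rle_trans; [exact X|].
    apply Rmult_le_compat_l; auto.
    assert (1 <= INR (S n)) by (apply (le_INR 1); lia).
    apply Rinv_le_contravar; nra.
  - apply is_lim_seq_const.
  - apply lim_inv_INR.
Qed.

(** The derivative of the left-hand side vanishes, and at 0 it is the integral of
1/(1 + t^2).  This evaluates the Gaussian integral without polar coordinates. *)
Lemma gauss_integral_identity x :
  RInt (fun t => exp (- t ^ 2)) 0 x ^ 2 +
  RInt (fun t => exp (- (x ^ 2 * (1 + t ^ 2))) * / (1 + t ^ 2)) 0 1 = PI / 4.
Proof.
  set (G := fun x => RInt (fun t => exp (- t ^ 2)) 0 x).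
  set (H := fun x => RInt (fun t => exp (- (x ^ 2 * (1 + t ^ 2))) * / (1 + t ^ 2)) 0 1).
  assert (Cinv : Cts (fun t : R => / (1 + t ^ 2))).
  { apply Cts_ex_derive; intros t. auto_derive. generalize (pow2_ge_0 t); simpl; lra. }
  assert (Cg : Cts (fun t : R => exp (- t ^ 2))) by cts.
  assert (DG : forall x, is_derive G x (exp (- x ^ 2))).
  { intros; apply (is_derive_primitive (fun t => exp (- t ^ 2))), Cg. }
  assert (DK : forall x t, is_derive (fun x => exp (- (x ^ 2 * (1 + t ^ 2))) * / (1 + t ^ 2)) x
      (- 2 * x * exp (- x ^ 2) * exp (- (x * t) ^ 2))).
  { intros x' t. assert (1 + t ^ 2 <> 0) by (generalize (pow2_ge_0 t); lra).
    auto_derive; auto.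
    replace (- (x' * (x' * 1) * (1 + t * (t * 1)))) with (- x' ^ 2 + - (x' * t) ^ 2) by ring.
    rewrite exp_plus. field. simpl in H0; lra. }
  assert (DH : forall x, is_derive H x
      (RInt (fun t => - 2 * x * exp (- x ^ 2) * exp (- (x * t) ^ 2)) 0 1)).
  { intros x'. rewrite (RInt_ext_all _ (fun t => Derive (fun x => exp (- (x ^ 2 * (1 + t ^ 2))) * / (1 + t ^ 2)) x'))
      by (intros; symmetry; apply is_derive_unique, DK).
    apply (is_derive_RInt_param (fun x t => exp (- (x ^ 2 * (1 + t ^ 2))) * / (1 + t ^ 2)) 0 1 x').
    - apply filter_forall; intros; eexists; apply DK.
    - intros t _. apply (continuity_2d_pt_ext (fun x t => - 2 * x * exp (- x ^ 2) * exp (- (x * t) ^ 2))).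
      + intros; symmetry; apply is_derive_unique, DK.
      + assert (X : Cts2 (fun x t : R => - 2 * x * exp (- (x * x)) * exp (- ((x * t) * (x * t))))) by cts.
        apply (continuity_2d_pt_ext (fun x t : R => - 2 * x * exp (- (x * x)) * exp (- ((x * t) * (x * t))))).
        * intros u v; do 2 (f_equal; try ring); f_equal; ring.
        * apply X.
    - apply filter_forall; intros; apply Cts_ex_RInt; cts. }
  assert (EH : forall x, RInt (fun t => - 2 * x * exp (- x ^ 2) * exp (- (x * t) ^ 2)) 0 1
      = - 2 * exp (- x ^ 2) * G x).
  { intros x'. rewrite RInt_scal_l by cts.
    assert (A := RInt_affine (fun t => exp (- t ^ 2)) 0 1 x' 0 Cg).
    rewrite Rmult_0_r, Rmult_1_r, !Rplus_0_r in A. unfold G. rewrite <- A.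
    rewrite (RInt_ext_all (fun t => exp (- (x' * t + 0) ^ 2)) (fun t => exp (- (x' * t) ^ 2)))
      by (intros; rewrite Rplus_0_r; reflexivity).
    real_equation; ring. }
  assert (K : forall x, is_derive (fun x => G x ^ 2 + H x) x 0).
  { intros x'. replace 0 with (2 * exp (- x' ^ 2) * G x' + - 2 * exp (- x' ^ 2) * G x') by ring.
    apply (is_derive_plus (fun x => G x ^ 2) H).
    - apply (is_derive_ext (fun x => G x * G x)); [intros; simpl; ring|].
      replace (2 * exp (- x' ^ 2) * G x') with (exp (- x' ^ 2) * G x' + G x' * exp (- x' ^ 2)) by ring.
      apply (is_derive_mult G G); auto; intros; apply Rmult_comm.
    - rewrite <- EH; apply DH. }
  assert (C0 : Cts (fun _ : R => 0)) by cts.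
  assert (F := RInt_FTC _ (fun _ => 0) 0 x K C0).
  rewrite RInt_const_R in F.
  assert (G0 : G 0 = 0) by apply (RInt_point 0 (fun t => exp (- t ^ 2))).
  assert (H0 : H 0 = PI / 4).
  { unfold H. rewrite (RInt_ext_all _ (fun t => / (1 + t ^ 2))).
    - rewrite (RInt_FTC atan); auto.
      + rewrite atan_1, atan_0. real_equation; ring.
      + intros t; apply is_derive_Reals.
        apply derivable_pt_lim_atan.
    - intros t. replace (- (0 ^ 2 * (1 + t ^ 2))) with 0 by ring. rewrite exp_0; ring. }
  change (G x ^ 2 + H x = PI / 4). rewrite G0, H0 in F. simpl in F. simpl. lra.
Qed.

Lemma gauss_integral_lim (L : nat -> R) : (forall n, 0 <= L n) ->
  is_lim_seq (fun n => exp (- L n ^ 2)) 0 ->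
  is_lim_seq (fun n => RInt (fun t => exp (- t ^ 2)) 0 (L n)) (sqrt PI / 2).
Proof.
  intros HL Hlim. assert (HPI := PI_RGT_0).
  assert (Cinv : Cts (fun t : R => / (1 + t ^ 2))).
  { apply Cts_ex_derive; intros t. auto_derive. generalize (pow2_ge_0 t); simpl; lra. }
  set (G := fun x => RInt (fun t => exp (- t ^ 2)) 0 x).
  set (H := fun x => RInt (fun t => exp (- (x ^ 2 * (1 + t ^ 2))) * / (1 + t ^ 2)) 0 1).
  assert (HH : is_lim_seq (fun n => H (L n)) 0).
  { apply is_lim_seq_abs_0.
    apply (is_lim_seq_le_le (fun _ => 0) _ (fun n => exp (- L n ^ 2))); auto.
    - intros n; split; [apply Rabs_pos|].
      replace (exp (- L n ^ 2)) with ((1 - 0) * exp (- L n ^ 2)) by ring.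
      apply RInt_abs_le; [lra | cts |].
      intros t _. assert (Ht := pow2_ge_0 t). assert (Hl := pow2_ge_0 (L n)).
      rewrite Rabs_right.
      + rewrite <- (Rmult_1_r (exp (- L n ^ 2))). apply Rmult_le_compat.
        * apply Rlt_le, exp_pos.
        * apply Rlt_le, Rinv_0_lt_compat; lra.
        * destruct (Req_dec (- (L n ^ 2 * (1 + t ^ 2))) (- L n ^ 2)) as [->|]; [lra|].
          apply Rlt_le, exp_increasing; nra.
        * rewrite <- Rinv_1. apply Rinv_le_contravar; lra.
      + apply Rle_ge, Rmult_le_pos; [apply Rlt_le, exp_pos | apply Rlt_le, Rinv_0_lt_compat; lra].
    - apply is_lim_seq_const. }
  replace (sqrt PI / 2) with (sqrt (PI / 4 - 0)).
  2:{ rewrite Rminus_0_r, sqrt_div by lra. f_equal.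
      replace 4 with (2 * 2) by ring. apply sqrt_square; lra. }
  apply (is_lim_seq_ext (fun n => sqrt (PI / 4 - H (L n)))).
  - intros n. rewrite <- (gauss_integral_identity (L n)).
    replace (_ + _ - H (L n)) with (G (L n) ^ 2) by (unfold G, H; simpl; real_equation; ring).
    apply sqrt_pow2. apply RInt_ge_0; auto.
    + apply Cts_ex_RInt; cts.
    + intros; apply Rlt_le, exp_pos.
  - apply (is_lim_seq_continuous sqrt); [apply continuity_pt_filterlim, continuous_sqrt|].
    apply is_lim_seq_minus'; [apply is_lim_seq_const | exact HH].
Qed.

(** The integrand is odd. *)
Lemma gauss_odd a s L :
  RInt (fun x => exp (- a * x ^ 2) * sin (s * x)) (- L) L = 0.
Proof.
  set (f := fun x : R => exp (- a * x ^ 2) * sin (s * x)).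
  assert (C : Cts f) by (unfold f; cts).
  assert (A := RInt_affine f (- L) L (-1) 0 C).
  replace (-1 * - L + 0) with L in A by ring. replace (-1 * L + 0) with (- L) in A by ring.
  rewrite <- (opp_RInt_swap f) in A by auto. change opp with Ropp in A.
  rewrite (RInt_ext_all _ (fun t => -1 * f t)), RInt_scal_l in A by
    (auto; intros t; unfold f; replace (s * (-1 * t + 0)) with (- (s * t)) by ring;
     rewrite sin_neg; replace ((-1 * t + 0) ^ 2) with (t ^ 2) by ring; ring).
  fold f. lra.
Qed.

(** As a function of the frequency [s], the integral over [-L, L] solves
J' = - s/(2a) J up to a boundary term of size exp (- a L^2).  With the
integrating factor exp (s^2/(4a)), the mean value theorem on [0, s] gives the
bound.  So the Fourier transform is computed without differentiating an improper
integral. *)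
Lemma gauss_cos_bound a s L : 0 < a -> 0 <= s -> 0 <= L ->
  Rabs (exp (s ^ 2 / (4 * a)) * RInt (fun x => exp (- a * x ^ 2) * cos (s * x)) (- L) L
        - RInt (fun x => exp (- a * x ^ 2)) (- L) L)
  <= s * exp (s ^ 2 / (4 * a)) / a * exp (- a * L ^ 2).
Proof.
  intros Ha Hs HL.
  set (J := fun s => RInt (fun x => exp (- a * x ^ 2) * cos (s * x)) (- L) L).
  assert (DK : forall s x, is_derive (fun s => exp (- a * x ^ 2) * cos (s * x)) s
                 (- (x * (exp (- a * x ^ 2) * sin (s * x))))).
  { intros s' x; auto_derive; auto; simpl; ring. }
  assert (DJ : forall s, is_derive J s (exp (- a * L ^ 2) * sin (s * L) / a - s / (2 * a) * J s)).
  { intros s'.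
    assert (F : RInt (fun x => - (x * (exp (- a * x ^ 2) * sin (s' * x)))
         + s' / (2 * a) * (exp (- a * x ^ 2) * cos (s' * x))) (- L) L
         = exp (- a * L ^ 2) * sin (s' * L) / a).
    { rewrite (RInt_FTC (fun x => exp (- a * x ^ 2) * sin (s' * x) / (2 * a))).
      - replace ((- L) ^ 2) with (L ^ 2) by ring.
        replace (s' * - L) with (- (s' * L)) by ring. rewrite sin_neg. real_equation; field; lra.
      - intros x; auto_derive; auto. simpl; field; lra.
      - cts. }
    rewrite RInt_plus_R, RInt_scal_l in F by cts. fold (J s') in F.
    replace (exp (- a * L ^ 2) * sin (s' * L) / a - s' / (2 * a) * J s') with
      (RInt (fun x => - (x * (exp (- a * x ^ 2) * sin (s' * x)))) (- L) L)
      by (clear - F; set (u := J s') in *; real_equation; lra).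
    rewrite (RInt_ext_all _ (fun x => Derive (fun s => exp (- a * x ^ 2) * cos (s * x)) s'))
      by (intros; symmetry; apply is_derive_unique, DK).
    apply (is_derive_RInt_param (fun s x => exp (- a * x ^ 2) * cos (s * x)) (- L) L s').
    - apply filter_forall; intros; eexists; apply DK.
    - intros t _. apply (continuity_2d_pt_ext (fun s x => - (x * (exp (- a * x ^ 2) * sin (s * x))))).
      + intros; symmetry; apply is_derive_unique, DK.
      + apply (continuity_2d_pt_ext (fun s x => - (x * (exp (- a * (x * x)) * sin (s * x))))).
        * intros u v; do 4 f_equal; ring.
        * revert s' t F; intros s' t _; revert s' t.
          change (Cts2 (fun s x => - (x * (exp (- a * (x * x)) * sin (s * x))))). cts.
    - apply filter_forall; intros; apply Cts_ex_RInt; cts. }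
  (* The integrating factor. *)
  set (Z := fun s => exp (s ^ 2 / (4 * a)) * J s).
  assert (DZ : forall s, is_derive Z s (exp (s ^ 2 / (4 * a)) * (exp (- a * L ^ 2) * sin (s * L) / a))).
  { intros s'. unfold Z.
    replace (exp (s' ^ 2 / (4 * a)) * (exp (- a * L ^ 2) * sin (s' * L) / a)) with
      (exp (s' ^ 2 / (4 * a)) * (s' / (2 * a)) * J s' +
       exp (s' ^ 2 / (4 * a)) * (exp (- a * L ^ 2) * sin (s' * L) / a - s' / (2 * a) * J s')) by ring.
    apply (is_derive_mult (fun s => exp (s ^ 2 / (4 * a))) J); auto.
    - auto_derive; auto. unfold Rdiv; simpl; field; lra.
    - intros; apply Rmult_comm. }
  destruct (MVT_R Z _ 0 s DZ Hs) as [c [Hc E]].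
  assert (Z0 : Z 0 = RInt (fun x => exp (- a * x ^ 2)) (- L) L).
  { unfold Z, J. replace (0 ^ 2 / (4 * a)) with 0 by (field; lra). rewrite exp_0.
    rewrite Rmult_1_l. apply RInt_ext_all; intros x. rewrite Rmult_0_l, cos_0; ring. }
  rewrite Z0 in E. unfold Z in E. unfold J in E at 1. rewrite E, Rminus_0_r.
  assert (E1 := exp_pos (c ^ 2 / (4 * a))). assert (E2 := exp_pos (- a * L ^ 2)).
  assert (Hle : exp (c ^ 2 / (4 * a)) <= exp (s ^ 2 / (4 * a))).
  { destruct (Req_dec c s) as [->|]; [lra|]. apply Rlt_le, exp_increasing.
    apply Rmult_lt_compat_r; [apply Rinv_0_lt_compat; lra | nra]. }
  assert (B : Rabs (sin (c * L)) <= 1) by apply Rabs_le, SIN_bound.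
  assert (Ia : 0 < / a) by (apply Rinv_0_lt_compat, Ha).
  unfold Rdiv. rewrite !Rabs_mult, (Rabs_right s) by lra.
  rewrite (Rabs_right (exp (c ^ 2 * / (4 * a)))) by (apply Rle_ge, Rlt_le, exp_pos).
  rewrite (Rabs_right (exp (- a * L ^ 2))) by lra. rewrite (Rabs_right (/ a)) by lra.
  fold (c ^ 2 / (4 * a)). fold (s ^ 2 / (4 * a)).
  replace (exp (c ^ 2 / (4 * a)) * (exp (- a * L ^ 2) * Rabs (sin (c * L)) * / a) * s) with
    ((exp (- a * L ^ 2) * / a * s) * (exp (c ^ 2 / (4 * a)) * Rabs (sin (c * L)))) by ring.
  replace (s * exp (s ^ 2 / (4 * a)) * / a * exp (- a * L ^ 2)) with
    ((exp (- a * L ^ 2) * / a * s) * (exp (s ^ 2 / (4 * a)) * 1)) by ring.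
  apply Rmult_le_compat_l.
  - apply Rmult_le_pos; auto. apply Rmult_le_pos; lra.
  - apply Rmult_le_compat; auto; try lra. apply Rabs_pos.
Qed.

Lemma RInt_even f X : Cts f -> (forall x, f (- x) = f x) -> RInt f (- X) X = 2 * RInt f 0 X.
Proof.
  intros C E.
  assert (A := RInt_affine f 0 X (-1) 0 C).
  replace (-1 * 0 + 0) with 0 in A by ring. replace (-1 * X + 0) with (- X) in A by ring.
  rewrite (RInt_ext_all _ f) in A.
  - rewrite <- (opp_RInt_swap f (- X) 0) in A by auto. change opp with Ropp in A.
    rewrite <- (RInt_Chasles_R f (- X) 0 X) by auto. real_equation; lra.
  - intros t. rewrite <- (E t); f_equal; ring.
Qed.

Lemma gauss_total_lim a : 0 < a ->
  is_lim_seq (fun n => RInt (fun x => exp (- a * x ^ 2)) (- INR (S n)) (INR (S n))) (sqrt (PI / a)).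
Proof.
  intros Ha. assert (HPI := PI_RGT_0). assert (Sa := sqrt_lt_R0 a Ha).
  assert (Sq : sqrt a * sqrt a = a) by (apply sqrt_sqrt; lra).
  assert (C : Cts (fun x : R => exp (- x ^ 2))) by cts.
  apply (is_lim_seq_ext (fun n => 2 / sqrt a * RInt (fun t => exp (- t ^ 2)) 0 (sqrt a * INR (S n)))).
  - intros n. set (L := INR (S n)).
    assert (A := RInt_affine (fun t => exp (- t ^ 2)) 0 L (sqrt a) 0 C).
    rewrite Rmult_0_r, !Rplus_0_r in A. rewrite <- A.
    rewrite RInt_even by (try cts; intros; do 2 f_equal; ring).
    rewrite (RInt_ext_all (fun t => exp (- (sqrt a * t + 0) ^ 2)) (fun x => exp (- a * x ^ 2))).
    + real_equation; field; lra.
    + intros t. f_equal. rewrite <- Sq at 2. ring.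
  - replace (sqrt (PI / a)) with (2 / sqrt a * (sqrt PI / 2)) by (rewrite sqrt_div by lra; field; lra).
    apply (is_lim_seq_scal_l _ _ (sqrt PI / 2)).
    apply (gauss_integral_lim (fun n => sqrt a * INR (S n))).
    + intros n; apply Rmult_le_pos; [lra | apply pos_INR].
    + apply (is_lim_seq_ext (fun n => exp (- a * INR (S n) ^ 2))); [|apply gauss_lim, Ha].
      intros n; f_equal. rewrite <- Sq at 1; ring.
Qed.

Lemma gauss_cos_lim a s : 0 < a ->
  is_lim_seq (fun n => RInt (fun x => exp (- a * x ^ 2) * cos (s * x)) (- INR (S n)) (INR (S n)))
    (sqrt (PI / a) * exp (- (s ^ 2 / (4 * a)))).
Proof.
  intros Ha.
  assert (Pos : forall s, 0 <= s ->
    is_lim_seq (fun n => RInt (fun x => exp (- a * x ^ 2) * cos (s * x)) (- INR (S n)) (INR (S n)))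
      (sqrt (PI / a) * exp (- (s ^ 2 / (4 * a))))).
  { clear s; intros s Hs. set (E := exp (s ^ 2 / (4 * a))).
    assert (HE : 0 < E) by apply exp_pos.
    set (J := fun n => RInt (fun x => exp (- a * x ^ 2) * cos (s * x)) (- INR (S n)) (INR (S n))).
    set (I := fun n => RInt (fun x => exp (- a * x ^ 2)) (- INR (S n)) (INR (S n))).
    assert (D : is_lim_seq (fun n => E * J n - I n) 0).
    { apply is_lim_seq_abs_0.
      apply (is_lim_seq_le_le (fun _ => 0) _ (fun n => s * E / a * exp (- a * INR (S n) ^ 2))).
      - intros n; split; [apply Rabs_pos|]. apply gauss_cos_bound; auto. apply pos_INR.
      - apply is_lim_seq_const.
      - replace (Finite 0) with (Rbar_mult (s * E / a) 0) by (simpl; f_equal; ring).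
        apply is_lim_seq_scal_l, gauss_lim, Ha. }
    assert (D2 := is_lim_seq_plus' _ _ _ _ D (gauss_total_lim a Ha)).
    apply (is_lim_seq_scal_l _ (/ E)) in D2. rewrite exp_Ropp. fold E.
    replace (sqrt (PI / a) * / E) with (/ E * (0 + sqrt (PI / a))) by ring.
    apply (is_lim_seq_ext (fun n => / E * (E * J n - I n + I n))); [|exact D2].
    intros n; unfold J; field; lra. }
  destruct (Rle_dec 0 s) as [H|H]; [apply Pos, H|].
  replace (s ^ 2) with ((- s) ^ 2) by ring.
  apply (is_lim_seq_ext (fun n => RInt (fun x => exp (- a * x ^ 2) * cos (- s * x)) (- INR (S n)) (INR (S n)))).
  - intros n; apply RInt_ext_all; intros x. rewrite <- (cos_neg (s * x)); do 2 f_equal; ring.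
  - apply Pos; lra.
Qed.

Lemma gauss_phase_lim a s b : 0 < a ->
  is_lim_seq (fun n => RInt (fun x => exp (- a * x ^ 2) * cos (s * x + b)) (- INR (S n)) (INR (S n)))
    (sqrt (PI / a) * exp (- (s ^ 2 / (4 * a))) * cos b).
Proof.
  intros Ha. rewrite Rmult_comm.
  apply (is_lim_seq_ext (fun n => cos b * RInt (fun x => exp (- a * x ^ 2) * cos (s * x)) (- INR (S n)) (INR (S n)))).
  - intros n.
    rewrite (RInt_ext_all (fun x => exp (- a * x ^ 2) * cos (s * x + b))
      (fun x => cos b * (exp (- a * x ^ 2) * cos (s * x)) - sin b * (exp (- a * x ^ 2) * sin (s * x))))
      by (intros x; rewrite cos_plus; ring).
    rewrite RInt_minus_R, !RInt_scal_l, gauss_odd by cts. real_equation; ring.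
  - apply (is_lim_seq_scal_l _ (cos b) (sqrt (PI / a) * exp (- (s ^ 2 / (4 * a))))), gauss_cos_lim, Ha.
Qed.

(** * Dominated series of functions *)

Lemma dominated_ex_series (t M : nat -> R) : (forall n, Rabs (t n) <= M n) -> ex_series M -> ex_series t.
Proof. intros H; apply (ex_series_le (K := R_AbsRing) (V := R_CompleteNormedModule) t M), H. Qed.

(** The index [N] does not depend on the series [t]: this is the uniformity in the
Weierstrass test. *)
Lemma dominated_tail (M : nat -> R) : ex_series M ->
  forall eps : posreal, exists N, forall n, (N <= n)%nat -> forall t : nat -> R,
    (forall n, Rabs (t n) <= M n) -> Rabs (sum_n t n - Series t) < eps.
Proof.
  intros HM eps.
  assert (L := Series_correct _ HM). 
  destruct (proj1 (filterlim_locally _ _) L eps) as [N HN].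
  exists N; intros n Hn t Ht.
  specialize (HN n Hn). change (Rabs (sum_n M n - Series M) < eps) in HN.
  assert (E : forall a, ex_series a ->
     sum_n a n - Series a = - Series (fun k => a (S n + k)%nat)).
  { intros a Ha. rewrite (Series_incr_n a (S n)) by (auto; lia).
    rewrite sum_n_Reals. simpl pred. ring. }
  assert (Et := dominated_ex_series _ _ Ht HM).
  rewrite E in HN |- * by auto. rewrite Rabs_Ropp in HN |- *.
  eapply Rle_lt_trans; [|exact HN]. eapply Rle_trans; [|apply Rle_abs].
  assert (T : ex_series (fun k => Rabs (t (S n + k)%nat))).
  { apply (dominated_ex_series _ (fun k => M (S n + k)%nat)).
    - intros; rewrite Rabs_Rabsolu; apply Ht.
    - apply -> (ex_series_incr_n M (S n)); auto. }
  eapply Rle_trans; [apply Series_Rabs, T|].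
  apply Series_le; [intros; split; [apply Rabs_pos | apply Ht]|].
  apply -> (ex_series_incr_n M (S n)); auto.
Qed.

Lemma sum_n_derive (t t' : nat -> R -> R) n x : (forall n x, is_derive (t n) x (t' n x)) ->
  is_derive (fun x => sum_n (fun k => t k x) n) x (sum_n (fun k => t' k x) n).
Proof.
  intros H; induction n as [|n IH].
  - rewrite sum_O. apply (is_derive_ext (t 0%nat)); [intros; rewrite sum_O; auto | apply H].
  - rewrite sum_Sn.
    apply (is_derive_ext (fun x => plus (sum_n (fun k => t k x) n) (t (S n) x)));
      [intros; rewrite sum_Sn; auto | ].
    apply (is_derive_plus (fun x => sum_n (fun k => t k x) n) (t (S n))); auto.
Qed.

Lemma Cts_sum_n (t : nat -> R -> R) n : (forall n, Cts (t n)) -> Cts (fun x => sum_n (fun k => t k x) n).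
Proof.
  intros H; induction n as [|n IH]; intros x.
  - apply (continuous_ext (t 0%nat)); [intros; rewrite sum_O; auto | apply H].
  - apply (continuous_ext (fun x => sum_n (fun k => t k x) n + t (S n) x));
      [intros; rewrite sum_Sn; auto | ].
    apply (continuous_plus (fun x => sum_n (fun k => t k x) n) (t (S n))); [apply IH | apply H].
Qed.

(** Term by term differentiation on an interval where the terms and their derivatives
are dominated. *)
Lemma is_derive_Series (t t' : nat -> R -> R) (M : nat -> R) A x :
  (forall n x, is_derive (t n) x (t' n x)) -> (forall n, Cts (t' n)) ->
  (forall n x, -A < x < A -> Rabs (t n x) <= M n /\ Rabs (t' n x) <= M n) ->
  ex_series M -> -A < x < A ->
  is_derive (fun x => Series (fun n => t n x)) x (Series (fun n => t' n x)).
Proof.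
  intros HD HC HM HS Hx.
  assert (ED : forall n x, Derive (fun x => sum_n (fun k => t k x) n) x = sum_n (fun k => t' k x) n)
    by (intros; apply is_derive_unique, sum_n_derive, HD).
  assert (U : forall (s : nat -> R -> R), (forall n x, - A < x < A -> Rabs (s n x) <= M n) ->
     CVU_dom (fun n x => sum_n (fun k => s k x) n) (fun x => - A < x < A)).
  { intros s Hs eps. destruct (dominated_tail M HS eps) as [N HN].
    exists N; intros n Hn y Hy. apply (HN n Hn (fun k => s k y)). auto. }
  assert (X : is_derive (fun y => real (Lim_seq (fun n => sum_n (fun k => t k y) n))) x
     (real (Lim_seq (fun n => Derive (fun x => sum_n (fun k => t k x) n) x)))).
  { apply (CVU_Derive (fun n x => sum_n (fun k => t k x) n) (fun x => - A < x < A)); auto.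
    - apply open_and; [apply open_gt | apply open_lt].
    - intros a b y; lra.
    - apply U; intros; apply HM; auto.
    - intros n y _; eexists; apply sum_n_derive, HD.
    - intros n y _. apply continuity_pt_filterlim.
      apply (continuous_ext (fun x => sum_n (fun k => t' k x) n)).
      + intros; symmetry; apply ED.
      + apply (Cts_sum_n t'), HC.
    - intros eps. destruct (U t' (fun n x H => proj2 (HM n x H)) eps) as [N HN].
      exists N; intros n Hn y Hy. rewrite ED.
      rewrite (Lim_seq_ext _ (fun n => sum_n (fun k => t' k y) n)) by (intros; apply ED).
      apply HN; auto. }
  rewrite (Lim_seq_ext _ (fun n => sum_n (fun k => t' k x) n)) in X by (intros; apply ED).
  exact X.
Qed.

Lemma RInt_Series_lim (t : nat -> R -> R) (M : nat -> R) a b (c : R -> R) :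
  a <= b -> Cts c -> (forall n, Cts (t n)) -> Cts (fun x => Series (fun n => t n x)) ->
  (forall n x, a <= x <= b -> Rabs (t n x) <= M n) -> ex_series M ->
  is_lim_seq (fun n => RInt (fun x => sum_n (fun k => t k x) n * c x) a b)
    (RInt (fun x => Series (fun n => t n x) * c x) a b).
Proof.
  intros Hab Cc Ct CS HM HS.
  destruct (bounded_on c a b Cc) as [B [B0 HB]].
  apply is_lim_seq_Reals; intros eps Heps.
  assert (Hp : 0 < eps / ((b - a + 1) * (B + 1))).
  { apply Rdiv_lt_0_compat; auto. apply Rmult_lt_0_compat; lra. }
  destruct (dominated_tail M HS (mkposreal _ Hp)) as [N HN]; simpl in HN.
  exists N; intros n Hn. unfold Rdist.
  assert (n_differentiable := Cts_sum_n t n Ct).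
  rewrite <- RInt_minus_R by cts.
  eapply Rle_lt_trans.
  - apply RInt_abs_le with (M := eps / (b - a + 1)); [auto | cts |].
    intros x Hx. rewrite <- Rmult_minus_distr_r, Rabs_mult.
    apply Rle_trans with (eps / ((b - a + 1) * (B + 1)) * (B + 1)).
    + apply Rmult_le_compat; try apply Rabs_pos.
      * apply Rlt_le, (HN n Hn (fun k => t k x)). auto.
      * specialize (HB x Hx); lra.
    + right; field; lra.
  - apply Rlt_le_trans with ((b - a + 1) * (eps / (b - a + 1))).
    + apply Rmult_lt_compat_r; [apply Rdiv_lt_0_compat; lra | lra].
    + right; field; lra.
Qed.

(** * The periodized Gaussian *)

(** The translates by [n] and by [- n - 1] are taken together, so that a one-sided
series runs over all the integers. *)
Definition gauss_pair (a : R) (j n : nat) (x : R) : R :=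
  gauss_moment a j (x - INR n) + gauss_moment a j (x + INR n + 1).
Definition gauss_periodized (a : R) (j : nat) (x : R) : R := Series (fun n => gauss_pair a j n x).

Lemma Cts_gauss_pair a j n : Cts (gauss_pair a j n).
Proof. assert (C := Cts_gauss_moment a j). unfold gauss_pair; cts. Qed.

(** 1 + n^2 <= 2 (1 + x^2) (1 + (x - n)^2), so a translate by [n] decays like 1/n^2
for bounded [x]. *)
Lemma gauss_pair_bound a j A : 0 < a -> 0 <= A -> exists C, 0 <= C /\
  forall n x, - A <= x <= A -> Rabs (gauss_pair a j n x) <= C * / INR (S n) ^ 2.
Proof.
  intros Ha HA. destruct (gauss_moment_bound a j Ha) as [C [C0 HC]].
  exists (C * (4 * (1 + A ^ 2)) + C * (4 * (1 + A ^ 2))).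
  assert (A2 : 0 <= A ^ 2) by apply pow2_ge_0.
  split; [assert (0 <= C * (4 * (1 + A ^ 2))) by (apply Rmult_le_pos; lra); lra|]. intros n x Hx.
  assert (Hn := pos_INR n).
  assert (Hx2 : x ^ 2 <= A ^ 2) by (assert (0 <= (A - x) * (A + x)) by (apply Rmult_le_pos; lra); lra).
  assert (HP0 : 0 < INR (S n)) by (apply lt_0_INR; lia).
  assert (HP : 0 < INR (S n) ^ 2) by (apply pow_lt, HP0).
  assert (S2 : INR (S n) ^ 2 <= 2 * (1 + INR n ^ 2)) by (rewrite S_INR; generalize (pow2_ge_0 (INR n - 1)); lra).
  assert (Y : forall y, 1 + INR n ^ 2 <= 2 * (1 + A ^ 2) * (1 + y ^ 2) ->
     Rabs (gauss_moment a j y) <= C * (4 * (1 + A ^ 2)) * / INR (S n) ^ 2).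
  { intros y Hy. eapply Rle_trans; [apply HC|].
    assert (Hy2 := pow2_ge_0 y). unfold Rdiv. rewrite Rmult_assoc.
    apply Rmult_le_compat_l; auto.
    apply (Rmult_le_reg_r (1 + y ^ 2)); [lra|]. rewrite Rinv_l by lra.
    apply (Rmult_le_reg_r (INR (S n) ^ 2)); auto.
    replace (4 * (1 + A ^ 2) * / INR (S n) ^ 2 * (1 + y ^ 2) * INR (S n) ^ 2) with
      (4 * (1 + A ^ 2) * (1 + y ^ 2)) by (field; lra). lra. }
  unfold gauss_pair. eapply Rle_trans; [apply Rabs_triang|].
  rewrite Rmult_plus_distr_r. apply Rplus_le_compat; apply Y.
  - assert (D := pow2_ge_0 (x - INR n)). assert (D2 := pow2_ge_0 (x + (x - INR n))).
    assert (D3 := Rmult_le_pos _ _ A2 D). lra.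
  - assert (D := pow2_ge_0 (x + INR n + 1)). assert (D2 := pow2_ge_0 (x + (x + INR n + 1))).
    assert (D3 := Rmult_le_pos _ _ A2 D). assert (INR n ^ 2 <= (INR n + 1) ^ 2) by nra. lra.
Qed.

Lemma is_derive_gauss_pair a j n x :
  is_derive (gauss_pair a j n) x (INR j * gauss_pair a (pred j) n x + - (2 * a) * gauss_pair a (S j) n x).
Proof.
  unfold gauss_pair.
  replace (INR j * (gauss_moment a (pred j) (x - INR n) + gauss_moment a (pred j) (x + INR n + 1)) +
    - (2 * a) * (gauss_moment a (S j) (x - INR n) + gauss_moment a (S j) (x + INR n + 1))) with
   ((INR j * gauss_moment a (pred j) (x + - INR n) + - (2 * a) * gauss_moment a (S j) (x + - INR n)) +
    (INR j * gauss_moment a (pred j) (x + (INR n + 1)) + - (2 * a) * gauss_moment a (S j) (x + (INR n + 1)))).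
  - apply (is_derive_plus (fun x => gauss_moment a j (x - INR n)) (fun x => gauss_moment a j (x + INR n + 1))).
    + apply (is_derive_shift (gauss_moment a j) (- INR n)), is_derive_gauss_moment.
    + apply (is_derive_ext (fun x => gauss_moment a j (x + (INR n + 1)))).
      * intros; f_equal; ring.
      * apply (is_derive_shift (gauss_moment a j) (INR n + 1)), is_derive_gauss_moment.
  - replace (x + (INR n + 1)) with (x + INR n + 1) by ring. unfold Rminus; ring.
Qed.

Lemma gauss_pair_ex_series a j x : 0 < a -> ex_series (fun n => gauss_pair a j n x).
Proof.
  intros Ha. destruct (gauss_pair_bound a j (Rabs x) Ha (Rabs_pos x)) as [C [_ HC]].
  apply (dominated_ex_series _ (fun n => C * / INR (S n) ^ 2)).
  - intros n; apply HC. apply Rabs_le_between; lra.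
  - apply (ex_series_scal (K := R_AbsRing) (V := R_NormedModule) C), ex_series_inv_sq.
Qed.

Lemma is_derive_gauss_periodized a j x : 0 < a ->
  is_derive (gauss_periodized a j) x (INR j * gauss_periodized a (pred j) x + - (2 * a) * gauss_periodized a (S j) x).
Proof.
  intros Ha. set (A := Rabs x + 1).
  assert (HA : 0 <= A) by (unfold A; generalize (Rabs_pos x); lra).
  destruct (gauss_pair_bound a j A Ha HA) as [C0 [P0 H0]].
  destruct (gauss_pair_bound a (pred j) A Ha HA) as [C1 [P1 H1]].
  destruct (gauss_pair_bound a (S j) A Ha HA) as [C2 [P2 H2]].
  assert (J := pos_INR j).
  assert (E := gauss_pair_ex_series a).
  unfold gauss_periodized. rewrite <- !Series_scal_l.
  rewrite <- Series_plus by
    (apply (ex_series_scal (K := R_AbsRing) (V := R_NormedModule)); apply E, Ha).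
  apply (is_derive_Series (gauss_pair a j)
    (fun n x => INR j * gauss_pair a (pred j) n x + - (2 * a) * gauss_pair a (S j) n x)
    (fun n => (C0 + INR j * C1 + 2 * a * C2) * / INR (S n) ^ 2) A).
  - intros; apply is_derive_gauss_pair.
  - intros n. assert (X1 := Cts_gauss_pair a (pred j) n). assert (X2 := Cts_gauss_pair a (S j) n). cts.
  - intros n y Hy.
    assert (I : 0 < / INR (S n) ^ 2) by (apply Rinv_0_lt_compat, pow_lt, lt_0_INR; lia).
    assert (Hy' : - A <= y <= A) by lra.
    specialize (H0 n y Hy'). specialize (H1 n y Hy'). specialize (H2 n y Hy').
    set (i := / INR (S n) ^ 2) in *.
    assert (0 <= INR j * C1 * i) by (apply Rmult_le_pos; [nra | lra]).
    assert (0 <= 2 * a * C2 * i) by (apply Rmult_le_pos; [nra | lra]).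
    assert (0 <= C0 * i) by nra.
    split; [lra|].
    eapply Rle_trans; [apply Rabs_triang|]. rewrite !Rabs_mult, Rabs_Ropp, (Rabs_right (INR j)) by lra.
    rewrite Rabs_mult, (Rabs_right 2), (Rabs_right a) by lra.
    assert (INR j * Rabs (gauss_pair a (pred j) n y) <= INR j * (C1 * i)) by (apply Rmult_le_compat_l; lra).
    assert (2 * a * Rabs (gauss_pair a (S j) n y) <= 2 * a * (C2 * i)) by (apply Rmult_le_compat_l; lra).
    lra.
  - apply (ex_series_scal (K := R_AbsRing) (V := R_NormedModule)), ex_series_inv_sq.
  - unfold A. generalize (Rle_abs x) (Rle_abs (- x)); rewrite Rabs_Ropp. lra.
Qed.

Lemma Cts_gauss_periodized a j : 0 < a -> Cts (gauss_periodized a j).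
Proof. intros Ha. apply (Cts_derive _ _ (fun x => is_derive_gauss_periodized a j x Ha)). Qed.

(** A translation by 1 changes a partial sum by two terms, which tend to 0. *)
Lemma gauss_periodized_periodic a : 0 < a -> periodic (gauss_periodized a 0).
Proof.
  intros Ha x. unfold gauss_periodized.
  set (T := fun x n => sum_n (fun n => gauss_pair a 0 n x) n).
  assert (L : forall x, is_lim_seq (T x) (Series (fun n => gauss_pair a 0 n x)))
    by (intros; apply (Series_correct _ (gauss_pair_ex_series a 0 _ Ha))).
  assert (D : forall n, T (x + 1) n = T x n + (gauss_moment a 0 (x + INR n + 1 + 1) - gauss_moment a 0 (x - INR n))).
  { unfold T; induction n as [|n IH].
    - rewrite !sum_O; unfold gauss_pair; simpl.
      replace (x + 1 - 0) with (x + 0 + 1) by ring.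
      replace (x + 1 + 0 + 1) with (x + 0 + 1 + 1) by ring. ring.
    - rewrite !sum_Sn, IH. unfold gauss_pair, plus; simpl plus; rewrite S_INR.
      change (sum_n (fun n0 => gauss_pair a 0 n0 x) n + (gauss_moment a 0 (x + INR n + 1 + 1) - gauss_moment a 0 (x - INR n)) +
        (gauss_moment a 0 (x + 1 - (INR n + 1)) + gauss_moment a 0 (x + 1 + (INR n + 1) + 1)) =
        sum_n (fun n0 => gauss_pair a 0 n0 x) n + (gauss_moment a 0 (x - (INR n + 1)) + gauss_moment a 0 (x + (INR n + 1) + 1)) +
        (gauss_moment a 0 (x + (INR n + 1) + 1 + 1) - gauss_moment a 0 (x - (INR n + 1)))).
      replace (x + 1 - (INR n + 1)) with (x - INR n) by ring.
      replace (x + 1 + (INR n + 1) + 1) with (x + (INR n + 1) + 1 + 1) by ring.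
      replace (x + (INR n + 1) + 1) with (x + INR n + 1 + 1) by ring. ring. }
  destruct (gauss_moment_bound a 0 Ha) as [C [C0 HC]].
  assert (Z : forall z, is_lim_seq (fun n => gauss_moment a 0 (z + INR n)) 0 /\ is_lim_seq (fun n => gauss_moment a 0 (z - INR n)) 0).
  { intros z.
    assert (LB : is_lim_seq (fun n => (2 * C * (1 + z ^ 2)) * / (INR n ^ 2 + 1)) 0).
    { replace (Finite 0) with (Rbar_mult (2 * C * (1 + z ^ 2)) (Rbar_inv p_infty)) by (simpl; f_equal; ring).
      apply is_lim_seq_scal_l, is_lim_seq_inv; [|discriminate].
      apply (is_lim_seq_le_p_loc INR); [|apply is_lim_seq_INR].
      exists 0%nat; intros n _. nra. }
    assert (B : forall n y, 1 + INR n ^ 2 <= 2 * (1 + z ^ 2) * (1 + y ^ 2) ->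
       Rabs (gauss_moment a 0 y) <= 2 * C * (1 + z ^ 2) * / (INR n ^ 2 + 1)).
    { intros n y Hy. eapply Rle_trans; [apply HC|].
      assert (Hy2 := pow2_ge_0 y). assert (Hn2 := pow2_ge_0 (INR n)). assert (Hz2 := pow2_ge_0 z).
      apply (Rmult_le_reg_r (1 + y ^ 2)); [lra|]. unfold Rdiv; rewrite Rmult_assoc, Rinv_l by lra.
      apply (Rmult_le_reg_r (INR n ^ 2 + 1)); [lra|].
      replace (2 * C * (1 + z ^ 2) * / (INR n ^ 2 + 1) * (1 + y ^ 2) * (INR n ^ 2 + 1)) with
        (C * (2 * (1 + z ^ 2) * (1 + y ^ 2))) by (field; lra).
      rewrite Rmult_1_r. apply Rmult_le_compat_l; lra. }
    split; apply is_lim_seq_abs_0;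
      apply (is_lim_seq_le_le (fun _ => 0) _ (fun n => (2 * C * (1 + z ^ 2)) * / (INR n ^ 2 + 1)));
      auto using is_lim_seq_const; intros n; (split; [apply Rabs_pos|]); apply B.
    - assert (Da := pow2_ge_0 (z + INR n)). assert (D2 := pow2_ge_0 (z + (z + INR n))).
      assert (D3 := Rmult_le_pos _ _ (pow2_ge_0 z) Da). assert (D4 := pow2_ge_0 z). lra.
    - assert (Da := pow2_ge_0 (z - INR n)). assert (D2 := pow2_ge_0 (z + (z - INR n))).
      assert (D3 := Rmult_le_pos _ _ (pow2_ge_0 z) Da). assert (D4 := pow2_ge_0 z). lra. }
  assert (L2 : is_lim_seq (T (x + 1)) (Series (fun n => gauss_pair a 0 n x))).
  { apply (is_lim_seq_ext (fun n => T x n + (gauss_moment a 0 (x + INR n + 1 + 1) - gauss_moment a 0 (x - INR n))));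
      [intros; symmetry; apply D|].
    replace (Finite (Series (fun n => gauss_pair a 0 n x))) with
      (Finite (Series (fun n => gauss_pair a 0 n x) + (0 - 0))) by (f_equal; ring).
    apply is_lim_seq_plus'; [apply L|]. apply is_lim_seq_minus'; [|apply Z].
    apply (is_lim_seq_ext (fun n => gauss_moment a 0 (x + 1 + 1 + INR n))); [|apply Z].
    intros; f_equal; ring. }
  assert (X1 := is_lim_seq_unique _ _ (L (x + 1))).
  rewrite (is_lim_seq_unique _ _ L2) in X1. injection X1; auto.
Qed.

(** Recursion from the first derivative upwards, opposite to that of [ex_derive_n]:
stability properties follow by induction on [n] for all functions at once. *)
Fixpoint n_differentiable (n : nat) (h : R -> R) : Prop :=
  match n with
  | O => True
  | S m => (forall x, ex_derive h x) /\ n_differentiable m (Derive h)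
  end.

Lemma n_differentiable_smooth h : (forall n, n_differentiable n h) -> smooth h.
Proof.
  intros H n; specialize (H n); revert h H.
  induction n as [|n IH]; intros h H x; [exact I|].
  destruct H as [H1 H2]. destruct n as [|n]; [apply H1|].
  apply (ex_derive_ext (Derive_n (Derive h) n)).
  - intros; apply Derive_n_Derive.
  - exact (IH _ H2 x).
Qed.

Lemma n_differentiable_intro n (h h' : R -> R) : (forall x, is_derive h x (h' x)) -> n_differentiable n h' -> n_differentiable (S n) h.
Proof.
  intros H Hn; split.
  - intros; eexists; apply H.
  - replace (Derive h) with h'; auto.
    apply functional_extensionality; intros x; symmetry; apply is_derive_unique, H.
Qed.

Lemma n_differentiable_lin n : forall c d f g, n_differentiable n f -> n_differentiable n g -> n_differentiable n (fun x => c * f x + d * g x).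
Proof.
  induction n as [|n IH]; intros c d f g Hf Hg; [exact I|].
  destruct Hf as [F1 F2], Hg as [G1 G2].
  apply (n_differentiable_intro n _ (fun x => c * Derive f x + d * Derive g x)); auto.
  intros x; apply (is_derive_plus (fun x => c * f x) (fun x => d * g x));
    [apply (is_derive_scal f) | apply (is_derive_scal g)]; apply Derive_correct; auto.
Qed.

Lemma n_differentiable_shift n c : forall f, n_differentiable n f -> n_differentiable n (fun x => f (x + c)).
Proof.
  induction n as [|n IH]; intros f Hf; [exact I|].
  destruct Hf as [F1 F2].
  apply (n_differentiable_intro n _ (fun x => Derive f (x + c))); auto.
  intros x; apply is_derive_shift, Derive_correct; auto.
Qed.

(** The derivative of each periodized moment is a combination of two others, so the
induction goes through for all of them together. *)
Lemma n_differentiable_gauss_periodized a n : 0 < a -> forall j, n_differentiable n (gauss_periodized a j).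
Proof.
  intros Ha; induction n as [|n IH]; intros j; [exact I|].
  apply (n_differentiable_intro n _ (fun x => INR j * gauss_periodized a (pred j) x + - (2 * a) * gauss_periodized a (S j) x)).
  - intros; apply is_derive_gauss_periodized, Ha.
  - apply n_differentiable_lin; apply IH.
Qed.

(** Unfolding: the translates of [-1, 0] by the integers from -n to n + 1 tile the
interval from -(n+1) to n+1, and the mode has period 1.  With the unit interval
[-1, 0] this tiling is symmetric. *)
Lemma sum_gauss_pair_unfold a k b n : 0 < a ->
  RInt (fun x => sum_n (fun n => gauss_pair a 0 n x) n * cos (2 * PI * IZR k * x + b)) (-1) 0 =
  RInt (fun x => exp (- a * x ^ 2) * cos (2 * PI * IZR k * x + b)) (- INR (S n)) (INR (S n)).
Proof.
  intros Ha. set (c := fun x : R => cos (2 * PI * IZR k * x + b)).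
  assert (Cc : Cts c) by (unfold c; cts).
  assert (Cg := Cts_gauss_moment a 0).
  assert (Pc : forall x m, c (x + IZR m) = c x).
  { intros x m; unfold c. rewrite <- (cos_2PI_Z (2 * PI * IZR k * x + b) (k * m)), mult_IZR.
    f_equal; ring. }
  set (G := fun x : R => gauss_moment a 0 x * c x).
  assert (CG : Cts G) by (unfold G; cts).
  rewrite (RInt_ext_all (fun x => exp (- a * x ^ 2) * cos (2 * PI * IZR k * x + b)) G) by
    (intros; unfold G, gauss_moment, c; rewrite pow_O, Rmult_1_l; reflexivity).
  rewrite (RInt_ext_all _ (fun x => sum_n (fun n => gauss_pair a 0 n x) n * c x)) by reflexivity.
  assert (St : forall m, RInt (fun x => gauss_pair a 0 m x * c x) (-1) 0 =
     RInt G (- INR m - 1) (- INR m) + RInt G (INR m) (INR m + 1)).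
  { intros m.
    rewrite (RInt_ext_all _ (fun x => G (x + - INR m) + G (x + (INR m + 1)))).
    - rewrite RInt_plus_R by cts. rewrite !(RInt_shift G) by auto.
      f_equal; f_equal; ring.
    - intros x; unfold G, gauss_pair.
      replace (- INR m) with (IZR (- Z.of_nat m)) by (rewrite opp_IZR, <- INR_IZR_INZ; ring).
      replace (INR m + 1) with (IZR (Z.of_nat m + 1)) by (rewrite plus_IZR, <- INR_IZR_INZ; ring).
      rewrite !Pc, plus_IZR, opp_IZR, <- INR_IZR_INZ.
      replace (x + (INR m + 1)) with (x + INR m + 1) by ring.
      unfold Rminus; ring. }
  induction n as [|n IH].
  - rewrite (RInt_ext_all _ (fun x => gauss_pair a 0 0 x * c x)) by (intros; rewrite sum_O; reflexivity).
    rewrite St. simpl INR.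
    rewrite Ropp_0, Rplus_0_l, (Rminus_0_l 1). apply RInt_Chasles_R, CG.
  - rewrite (RInt_ext_all _ (fun x => sum_n (fun n => gauss_pair a 0 n x) n * c x + gauss_pair a 0 (S n) x * c x))
      by (intros; rewrite sum_Sn; apply Rmult_plus_distr_r).
    assert (C1 := Cts_sum_n (gauss_pair a 0) n (Cts_gauss_pair a 0)).
    assert (C2 := Cts_gauss_pair a 0 (S n)).
    rewrite RInt_plus_R, IH, St by cts.
    rewrite (S_INR (S n)).
    replace (- (INR (S n) + 1)) with (- INR (S n) - 1) by ring.
    rewrite <- (RInt_Chasles_R G (- INR (S n) - 1) (- INR (S n)) (INR (S n) + 1)) by auto.
    rewrite <- (RInt_Chasles_R G (- INR (S n)) (INR (S n)) (INR (S n) + 1)) by auto.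
    real_equation; ring.
Qed.

Lemma trig_gauss_periodized a k b : 0 < a ->
  trig (gauss_periodized a 0) k b = sqrt (PI / a) * exp (- ((2 * PI * IZR k) ^ 2 / (4 * a))) * cos b.
Proof.
  intros Ha. assert (CP := Cts_gauss_periodized a 0 Ha).
  set (c := fun x : R => cos (2 * PI * IZR k * x + b)).
  assert (Cc : Cts c) by (unfold c; cts).
  destruct (gauss_pair_bound a 0 1 Ha) as [C [C0 HC]]; [lra|].
  assert (L : is_lim_seq (fun n => RInt (fun x => sum_n (fun k => gauss_pair a 0 k x) n * c x) (-1) 0)
     (RInt (fun x => gauss_periodized a 0 x * c x) (-1) 0)).
  { apply (RInt_Series_lim (gauss_pair a 0) (fun n => C * / INR (S n) ^ 2)); auto; try lra.
    - apply Cts_gauss_pair.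
    - intros; apply HC; lra.
    - apply (ex_series_scal (K := R_AbsRing) (V := R_NormedModule) C), ex_series_inv_sq. }
  assert (E : trig (gauss_periodized a 0) k b = RInt (fun x => gauss_periodized a 0 x * c x) (-1) 0).
  { unfold trig; fold c. replace (RInt (fun x => gauss_periodized a 0 x * c x) (-1) 0) with
      (RInt (fun x => gauss_periodized a 0 x * c x) (-1) (-1 + 1)) by (f_equal; ring).
    symmetry. apply (RInt_period (fun x => gauss_periodized a 0 x * c x)).
    - cts.
    - intros x. rewrite gauss_periodized_periodic by auto. f_equal. unfold c.
      rewrite <- (cos_2PI_Z (2 * PI * IZR k * x + b) k); f_equal; ring. }
  assert (L2 := gauss_phase_lim a (2 * PI * IZR k) b Ha).
  apply (is_lim_seq_ext _ (fun n => RInt (fun x => sum_n (fun k => gauss_pair a 0 k x) n * c x) (-1) 0)) in L2.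
  - apply is_lim_seq_unique in L. apply is_lim_seq_unique in L2. rewrite L in L2.
    injection L2; intros X. rewrite E. exact X.
  - intros n; symmetry; apply sum_gauss_pair_unfold, Ha.
Qed.

(** * The smoothed block function and its Fourier coefficients *)

Lemma frac_part_unit m s : IZR m <= s < IZR m + 1 -> frac_part s = s - IZR m.
Proof.
  intros H. unfold frac_part, Int_part.
  rewrite <- (tech_up s (m + 1)); try (rewrite plus_IZR; lra).
  do 2 f_equal; lia.
Qed.

Lemma block_bounds la s : 0 <= block la s <= 1.
Proof. unfold block; destruct Rlt_dec; lra. Qed.

Lemma phi_gauss_moment al x : phi al x = sqrt (al / PI) * gauss_moment al 0 x.
Proof. unfold phi, gauss_moment. rewrite pow_O, Rmult_1_l; reflexivity. Qed.

Lemma phi_pos al x : 0 <= phi al x.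
Proof. apply Rmult_le_pos; [apply sqrt_pos | apply Rlt_le, exp_pos]. Qed.

Lemma Cts_phi al : Cts (phi al).
Proof. unfold phi; cts. Qed.

Lemma RInt_block_unit al la x m : 0 <= la <= 1 ->
  is_RInt (fun s => phi al (x - s) * block la s) (IZR m) (IZR m + 1)
    (RInt (fun s => phi al (x - IZR m - s)) 0 la).
Proof.
  intros Hl. assert (C := Cts_phi al).
  assert (Cx : Cts (fun s : R => phi al (x - s))) by cts.
  replace (RInt (fun s => phi al (x - IZR m - s)) 0 la) with
    (plus (RInt (fun s => phi al (x - s)) (IZR m) (IZR m + la)) 0).
  2:{ change (RInt (fun s => phi al (x - s)) (IZR m) (IZR m + la) + 0 =
         RInt (fun s => phi al (x - IZR m - s)) 0 la).
      rewrite (RInt_ext_all (fun s => phi al (x - IZR m - s)) (fun s => phi al (x - (s + IZR m))))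
        by (intros; f_equal; ring).
      rewrite (RInt_shift (fun s => phi al (x - s))) by auto.
      rewrite Rplus_0_r; f_equal; ring. }
  apply (is_RInt_Chasles (V := R_NormedModule) _ _ (IZR m + la)).
  - apply (is_RInt_ext (fun s => phi al (x - s))).
    + intros s Hs. rewrite Rmin_left, Rmax_right in Hs by lra.
      unfold block. rewrite (frac_part_unit m) by lra. destruct Rlt_dec; lra.
    + apply (RInt_correct (fun s => phi al (x - s))); auto.
  - apply (is_RInt_ext (fun _ => 0)).
    + intros s Hs. rewrite Rmin_left, Rmax_right in Hs by lra.
      unfold block. rewrite (frac_part_unit m) by lra. destruct Rlt_dec; lra.
    + generalize (is_RInt_const (V := R_NormedModule) (IZR m + la) (IZR m + 1) 0).
      change (scal (IZR m + 1 - (IZR m + la)) 0) with ((IZR m + 1 - (IZR m + la)) * 0).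
      rewrite Rmult_0_r; auto.
Qed.

(** The part of the convolution over [m, m+1] is an integral over [0, la] of a
translate of the Gaussian, and the parts are summed in the pairs of
[gauss_pair]. *)
Lemma RInt_block_partial al la x n : 0 <= la <= 1 ->
  is_RInt (fun s => phi al (x - s) * block la s) (- INR (S n)) (INR (S n))
    (RInt (fun s => sum_n (fun k => gauss_pair al 0 k (x - s)) n * sqrt (al / PI)) 0 la).
Proof.
  intros Hl. set (f := fun s => phi al (x - s) * block la s).
  assert (C := Cts_phi al).
  assert (CT := Cts_gauss_pair al 0).
  assert (Ctx : forall k, Cts (fun s => gauss_pair al 0 k (x - s))) by (intros k; assert (X := CT k); cts).
  assert (St : forall k,
     RInt (fun s => gauss_pair al 0 k (x - s) * sqrt (al / PI)) 0 la =
     RInt (fun s => phi al (x - IZR (- Z.of_nat (S k)) - s)) 0 la +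
     RInt (fun s => phi al (x - IZR (Z.of_nat k) - s)) 0 la).
  { intros k. rewrite <- RInt_plus_R by cts. apply RInt_ext_all; intros s.
    rewrite !phi_gauss_moment. unfold gauss_pair. rewrite opp_IZR, <- !INR_IZR_INZ, S_INR.
    replace (x - INR k - s) with (x - s - INR k) by ring.
    replace (x - - (INR k + 1) - s) with (x - s + INR k + 1) by ring. ring. }
  assert (B1 : forall k, is_RInt f (- INR (S k)) (- INR k)
     (RInt (fun s => phi al (x - IZR (- Z.of_nat (S k)) - s)) 0 la)).
  { intros k. generalize (RInt_block_unit al la x (- Z.of_nat (S k)) Hl).
    rewrite opp_IZR, <- INR_IZR_INZ.
    replace (- INR (S k) + 1) with (- INR k) by (rewrite S_INR; ring). auto. }
  assert (B2 : forall k, is_RInt f (INR k) (INR (S k))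
     (RInt (fun s => phi al (x - IZR (Z.of_nat k) - s)) 0 la)).
  { intros k. generalize (RInt_block_unit al la x (Z.of_nat k) Hl).
    rewrite <- INR_IZR_INZ, <- S_INR; auto. }
  induction n as [|n IH].
  - rewrite (RInt_ext_all _ (fun s => gauss_pair al 0 0 (x - s) * sqrt (al / PI)))
      by (intros; rewrite sum_O; reflexivity).
    rewrite St. apply (is_RInt_Chasles (V := R_NormedModule) f _ 0).
    + replace 0 with (- INR 0) at 1 by (simpl; ring). apply (B1 0%nat).
    + apply (B2 0%nat).
  - rewrite (RInt_ext_all _ (fun s => sum_n (fun k => gauss_pair al 0 k (x - s)) n * sqrt (al / PI)
        + gauss_pair al 0 (S n) (x - s) * sqrt (al / PI)))
      by (intros; rewrite sum_Sn; apply Rmult_plus_distr_r).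
    assert (CS := Cts_sum_n (fun k s => gauss_pair al 0 k (x - s)) n Ctx).
    assert (CX := Ctx (S n)).
    rewrite RInt_plus_R, St by (apply Cts_mult; [assumption | apply Cts_const]).
    set (J := RInt (fun s => sum_n (fun k => gauss_pair al 0 k (x - s)) n * sqrt (al / PI)) 0 la) in *.
    set (u := RInt (fun s => phi al (x - IZR (- Z.of_nat (S (S n))) - s)) 0 la).
    set (v := RInt (fun s => phi al (x - IZR (Z.of_nat (S n)) - s)) 0 la).
    replace (J + (u + v)) with (plus u (plus J v)) by (unfold plus; simpl; real_equation; ring).
    apply (is_RInt_Chasles (V := R_NormedModule) f _ (- INR (S n))); [apply B1|].
    apply (is_RInt_Chasles (V := R_NormedModule) f _ (INR (S n))); [apply IH | apply B2].
Qed.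

(** The sum of the translates of [phi al] by the integers. *)
Definition theta (al x : R) : R := sqrt (al / PI) * gauss_periodized al 0 x.

(** The integrand of the convolution is nonnegative, so its integrals over intervals
increase with the interval: it suffices to know the limit along the intervals
from -(n+1) to n+1, where it is a partial sum of the series of theta. *)
Lemma forcing_theta al la x : 0 < al -> 0 <= la <= 1 ->
  forcing al la x = RInt (fun s => theta al (x - s)) 0 la.
Proof.
  intros Ha Hl; unfold theta. assert (CP := Cts_gauss_periodized al 0 Ha).
  set (f := fun s => phi al (x - s) * block la s).
  set (l := RInt (fun s => sqrt (al / PI) * gauss_periodized al 0 (x - s)) 0 la).
  set (J := fun n => RInt (fun s => sum_n (fun k => gauss_pair al 0 k (x - s)) n * sqrt (al / PI)) 0 la).
  assert (HJ : forall n, is_RInt f (- INR (S n)) (INR (S n)) (J n))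
    by (intros; apply RInt_block_partial, Hl).
  assert (f0 : forall s, 0 <= f s).
  { intros s; apply Rmult_le_pos; [apply phi_pos | apply block_bounds]. }
  assert (Hf : forall a b, ex_RInt f a b).
  { intros a b. destruct (INR_unbounded (Rabs a + Rabs b)) as [n Hn].
    apply (ex_RInt_inside f a b 0 (INR (S n))).
    - rewrite Rminus_0_l, Rplus_0_l. exists (J n); apply HJ.
    - rewrite Rminus_0_r, S_INR. generalize (Rabs_pos b); lra.
    - rewrite Rminus_0_r, S_INR. generalize (Rabs_pos a); lra. }
  assert (Mono : forall a b c d, a <= b -> b <= c -> c <= d -> RInt f b c <= RInt f a d).
  { intros a b c d Hab Hbc Hcd.
    rewrite <- (RInt_Chasles f a b d), <- (RInt_Chasles f b c d) by auto.
    assert (0 <= RInt f a b) by (apply RInt_ge_0; auto).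
    assert (0 <= RInt f c d) by (apply RInt_ge_0; auto).
    change (RInt f b c <= RInt f a b + (RInt f b c + RInt f c d)). lra. }
  assert (HJ' : forall n, RInt f (- INR (S n)) (INR (S n)) = J n)
    by (intros; apply is_RInt_unique, HJ).
  assert (L : is_lim_seq J l).
  { destruct (gauss_pair_bound al 0 (Rabs x + 1) Ha) as [C [C0 HC]];
      [generalize (Rabs_pos x); lra|].
    assert (X := RInt_Series_lim (fun k s => gauss_pair al 0 k (x - s)) (fun n => C * / INR (S n) ^ 2)
      0 la (fun _ => sqrt (al / PI))).
    replace l with (RInt (fun s => gauss_periodized al 0 (x - s) * sqrt (al / PI)) 0 la)
      by (apply RInt_ext_all; intros; ring).
    apply X.
    - lra.
    - cts.
    - intros n. assert (Y := Cts_gauss_pair al 0 n). cts.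
    - change (Cts (fun s => gauss_periodized al 0 (x - s))). cts.
    - intros n s Hs; apply HC. generalize (Rle_abs x) (Rle_abs (- x)); rewrite Rabs_Ropp; lra.
    - apply (ex_series_scal (K := R_AbsRing) (V := R_NormedModule) C), ex_series_inv_sq. }
  assert (Le : forall n, J n <= l).
  { intros n. apply (is_lim_seq_incr_compare J l L). intros k. rewrite <- !HJ'.
    rewrite (S_INR (S k)). apply Mono; generalize (pos_INR (S k)); lra. }
  unfold forcing. apply (is_RInt_gen_unique (V := R_CompleteNormedModule)).
  intros P [eps HP].
  apply is_lim_seq_Reals in L. destruct (L eps (cond_pos eps)) as [N HN].
  specialize (HN N (Nat.le_refl N)). unfold Rdist in HN. specialize (Le N) as LeN.
  rewrite Rabs_left1 in HN by lra.
  exists (fun a => a < - INR (S N)) (fun b => INR (S N) < b).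
  - exists (- INR (S N)); auto.
  - exists (INR (S N)); auto.
  - intros a b Ha' Hb. exists (RInt f a b); split; [apply (RInt_correct f); auto|].
    apply HP. destruct (INR_unbounded (Rabs a + Rabs b)) as [n Hn].
    assert (Hn' : INR n <= INR (S n)) by (rewrite S_INR; lra).
    assert (Ra := Rle_abs (- a)). rewrite Rabs_Ropp in Ra. assert (Rb := Rle_abs b).
    assert (Pa := Rabs_pos a). assert (Pb := Rabs_pos b). assert (PN := pos_INR (S N)).
    assert (M1 : J N <= RInt f a b) by (rewrite <- HJ'; apply Mono; lra).
    assert (M2 : RInt f a b <= J n) by (rewrite <- HJ'; apply Mono; lra).
    assert (M3 := Le n).
    change (Rabs (RInt f a b - l) < eps).
    apply Rabs_def1; generalize (cond_pos eps); lra.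
Qed.

Lemma Cts_theta al : 0 < al -> Cts (theta al).
Proof. intros Ha; assert (C := Cts_gauss_periodized al 0 Ha); unfold theta; cts. Qed.

Lemma forcing_derive al la x : 0 < al -> 0 <= la <= 1 ->
  is_derive (forcing al la) x (theta al x - theta al (x - la)).
Proof.
  intros Ha Hl. assert (C := Cts_theta al Ha).
  apply (is_derive_ext (fun x => RInt (theta al) 0 x - RInt (theta al) 0 (x - la))).
  - cut (forall t : R, RInt (theta al) 0 t - RInt (theta al) 0 (t - la) = forcing al la t);
      [intros X t; apply X|].
    intros t. rewrite forcing_theta by auto.
    assert (A := RInt_affine (theta al) 0 la (-1) t C).
    replace (-1 * 0 + t) with t in A by ring. replace (-1 * la + t) with (t - la) in A by ring.
    rewrite (RInt_ext_all (fun s => theta al (t - s)) (fun s => theta al (-1 * s + t)))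
      by (intros; f_equal; ring).
    assert (B := RInt_Chasles_R (theta al) 0 t (t - la) C). real_equation. lra.
  - apply (is_derive_minus (fun x => RInt (theta al) 0 x) (fun x => RInt (theta al) 0 (x - la))).
    + apply is_derive_primitive, C.
    + apply (is_derive_shift (fun x => RInt (theta al) 0 x) (- la)), is_derive_primitive, C.
Qed.

Lemma smooth_forcing al la : 0 < al -> 0 <= la <= 1 -> smooth (forcing al la).
Proof.
  intros Ha Hl; apply n_differentiable_smooth; intros [|n]; [exact I|].
  apply (n_differentiable_intro n _ (fun x => theta al x - theta al (x - la))).
  - intros; apply forcing_derive; auto.
  - set (c := sqrt (al / PI)).
    replace (fun x => theta al x - theta al (x - la)) with
      (fun x => c * gauss_periodized al 0 x + (- c) * gauss_periodized al 0 (x + - la)).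
    + apply (n_differentiable_lin n c (- c) (gauss_periodized al 0) (fun x => gauss_periodized al 0 (x + - la))).
      * apply n_differentiable_gauss_periodized, Ha.
      * apply n_differentiable_shift, n_differentiable_gauss_periodized, Ha.
    + apply functional_extensionality; intros x; unfold theta; fold c. unfold Rminus; ring.
Qed.

Lemma periodic_forcing al la : 0 < al -> 0 <= la <= 1 -> periodic (forcing al la).
Proof.
  intros Ha Hl x. rewrite !forcing_theta by auto. apply RInt_ext_all; intros s. unfold theta.
  replace (x + 1 - s) with (x - s + 1) by ring. rewrite gauss_periodized_periodic; auto.
Qed.

Lemma trig_translate h k b a : Cts h -> periodic h ->
  trig (fun x => h (x + a)) k b = trig h k (b - 2 * PI * IZR k * a).
Proof.
  intros C P; unfold trig at 2.
  set (H := fun x : R => h x * cos (2 * PI * IZR k * x + (b - 2 * PI * IZR k * a))).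
  assert (CH : Cts H) by (unfold H; cts).
  rewrite <- (RInt_period H a) by
    (auto; intros x; unfold H; rewrite P; f_equal;
     rewrite <- (cos_2PI_Z (2 * PI * IZR k * x + _) k); f_equal; ring).
  unfold trig. rewrite (RInt_ext_all _ (fun x => H (x + a))).
  - rewrite (RInt_shift H) by auto. f_equal; ring.
  - intros x; unfold H; do 2 f_equal; ring.
Qed.

Lemma trig_theta al k b : 0 < al ->
  trig (theta al) k b = exp (- (PI ^ 2 * IZR k ^ 2) / al) * cos b.
Proof.
  intros Ha. assert (C := Cts_gauss_periodized al 0 Ha). assert (HPI := PI_RGT_0).
  unfold trig, theta.
  rewrite (RInt_ext_all _ (fun x => sqrt (al / PI) * (gauss_periodized al 0 x * cos (2 * PI * IZR k * x + b))))
    by (intros; ring).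
  rewrite RInt_scal_l by cts. fold (trig (gauss_periodized al 0) k b). rewrite trig_gauss_periodized by auto.
  rewrite <- !Rmult_assoc, <- sqrt_mult; try (apply Rlt_le, Rdiv_lt_0_compat; lra).
  replace (al / PI * (PI / al)) with 1 by (field; lra). rewrite sqrt_1, Rmult_1_l.
  do 2 f_equal. field; lra.
Qed.

Lemma trig_forcing al la k b : 0 < al -> 0 <= la <= 1 ->
  trig (forcing al la) k b =
  exp (- (PI ^ 2 * IZR k ^ 2) / al) * RInt (fun s => cos (b + 2 * PI * IZR k * s)) 0 la.
Proof.
  intros Ha Hl. assert (C := Cts_theta al Ha).
  unfold trig.
  rewrite (RInt_ext_all (fun x => forcing al la x * cos (2 * PI * IZR k * x + b))
    (fun x => RInt (fun s => theta al (x - s) * cos (2 * PI * IZR k * x + b)) 0 la)).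
  - rewrite (RInt_swap (fun x s => theta al (x - s) * cos (2 * PI * IZR k * x + b))); [| lra | cts].
    rewrite <- RInt_scal_l by cts. apply RInt_ext_all; intros s.
    rewrite (RInt_ext_all _ (fun x => theta al (x + - s) * cos (2 * PI * IZR k * x + b))) by reflexivity.
    fold (trig (fun x => theta al (x + - s)) k b).
    rewrite trig_translate, trig_theta; auto.
    + do 2 f_equal; ring.
    + intros x; unfold theta; rewrite gauss_periodized_periodic; auto.
  - intros x. rewrite forcing_theta, Rmult_comm, <- RInt_scal_l by (auto; cts).
    apply RInt_ext_all; intros; ring.
Qed.

(** A translation multiplies a coefficient by a phase, so the coefficient of the
forcing is that of theta times the integral of the phase over [0, la]. *)
Theorem fcoef_forcing al la k : 0 < al -> 0 <= la <= 1 ->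
  fcoef (forcing al la) k = forcing_coef al la k.
Proof.
  intros Ha Hl. assert (HPI := PI_RGT_0).
  rewrite fcoef_trig by (apply smooth_Cts, smooth_forcing; auto).
  rewrite !trig_forcing by auto. unfold forcing_coef.
  destruct (Z.eq_dec k 0) as [->|Hk].
  - replace (- (PI ^ 2 * 0 ^ 2) / al) with 0 by (field; lra). rewrite exp_0, !Rmult_1_l.
    rewrite (RInt_ext_all _ (fun _ => 1)) by
      (intros s; replace (0 + 2 * PI * 0 * s) with 0 by ring; apply cos_0).
    rewrite (RInt_ext_all (fun s => cos (PI / 2 + 2 * PI * 0 * s)) (fun _ => 0)) by
      (intros s; replace (PI / 2 + 2 * PI * 0 * s) with (PI / 2) by ring; apply cos_PI2).
    rewrite !RInt_const_R. apply C_eq; ring.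
  - assert (Hk' : IZR k <> 0) by (apply not_0_IZR; auto).
    set (w := 2 * PI * IZR k).
    assert (Hw : w <> 0) by (unfold w; apply Rmult_integral_contrapositive; split; lra).
    set (E := exp (- (PI ^ 2 * IZR k ^ 2) / al)).
    assert (I : forall b, RInt (fun s => cos (b + w * s)) 0 la = (sin (b + w * la) - sin b) / w).
    { intros b. rewrite (RInt_FTC (fun s => sin (b + w * s) / w)).
      - rewrite Rmult_0_r, Rplus_0_r. real_equation; field; auto.
      - intros s; auto_derive; auto. field; auto.
      - cts. }
    rewrite !I, Rplus_0_l, sin_0, sin_PI2, sin_plus, sin_PI2, cos_PI2.
    unfold expi. rewrite cos_neg, sin_neg.
    unfold Ci, RtoC, Cdiv, Cinv, Cmult, Cminus, Cplus, Copp; simpl.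
    apply C_eq; field; auto.
Qed.

(** * Functions without resonant coefficients *)

Lemma RtoC_mean h : Cts h -> fcoef h 0 = RtoC (RInt h 0 1).
Proof.
  intros C; rewrite fcoef_trig, trig0_quarter by auto. unfold RtoC. apply C_eq; auto.
  unfold trig; apply RInt_ext_all; intros x.
  replace (2 * PI * 0 * x + 0) with 0 by ring. rewrite cos_0; ring.
Qed.

Lemma is_zseries_zero c s : (forall k, c k = RtoC 0) -> is_zseries c s -> s = RtoC 0.
Proof.
  intros H [s1 [s2 [H1 [H2 ->]]]].
  assert (Z : forall (d : nat -> C) t, (forall n, d n = RtoC 0) ->
     is_series (V := C_R_NormedModule) d t -> t = RtoC 0).
  { intros d t Hd Ht.
    apply (filterlim_locally_unique (V := C_R_NormedModule) (F := eventually)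
             (sum_n (G := C_R_NormedModule) d)); [exact Ht|].
    apply (filterlim_ext (fun _ => RtoC 0)); [|apply filterlim_const].
    intros n; induction n as [|n IH].
    - rewrite sum_O, Hd; reflexivity.
    - rewrite sum_Sn, <- IH, Hd. symmetry; apply Cplus_0_l. }
  rewrite (Z _ _ (fun n => H (Z.of_nat n)) H1), (Z _ _ (fun n => H (- Z.of_nat (S n))%Z) H2).
  unfold RtoC, Cplus; simpl. apply C_eq; ring.
Qed.

(** The uniqueness theorem for Fourier series, in the form used for generators. *)
Lemma invariant_coef_zero p q b : (0 < p)%Z -> (0 < q)%Z -> Z.gcd p q = 1%Z ->
  smooth2 b -> periodic2 b -> flow_invariant (IZR p / IZR q) b ->
  (forall k l, resonant_index p q k l -> fcoef2 b k l = RtoC 0) ->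
  forall x y, b x y = 0.
Proof.
  intros Hp Hq Hg Hs HP HI H0 x y. rewrite (invariant_section _ b x y HI).
  assert (S := invariant_series p q b (x - IZR p / IZR q * y) Hp Hq Hg Hs HP HI).
  apply is_zseries_zero in S.
  - injection S; auto.
  - intros m. rewrite H0.
    + unfold RtoC, Cmult; simpl. apply C_eq; ring.
    + unfold resonant_index; ring.
Qed.

(** * The Lie series up to degree two *)

Lemma dx_const (c x y : R) : dx (fun _ _ => c) x y = 0.
Proof. exact (Derive_const c _). Qed.
Lemma dy_const (c x y : R) : dy (fun _ _ => c) x y = 0.
Proof. exact (Derive_const c _). Qed.

Lemma vfield_ext (Y Z : vfield) :
  (forall x y, fst (Y x y) = fst (Z x y)) -> (forall x y, snd (Y x y) = snd (Z x y)) -> Y = Z.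
Proof.
  intros H1 H2. do 2 (apply functional_extensionality; intro).
  rewrite (surjective_pairing (Y _ _)), H1, H2. symmetry; apply surjective_pairing.
Qed.

(** The field X_0 has constant components, so only the derivative of [a] along it
survives. *)
Lemma bracket_along_x_const a om :
  bracket (along_x a) (fun _ _ => (om, 1)) = along_x (fun x y => - flow_derive om a x y).
Proof.
  apply vfield_ext; intros x y; unfold bracket, dir_derive, along_x; simpl.
  - rewrite dx_const, dy_const. unfold flow_derive; ring_simplify.
    change (fun a0 b : R => a a0 b) with a. ring.
  - rewrite !dx_const, !dy_const; ring.
Qed.

Lemma bracket_along_x a b :
  bracket (along_x a) (along_x b) = along_x (fun x y => a x y * dx b x y - b x y * dx a x y).
Proof.
  apply vfield_ext; intros x y; unfold bracket, dir_derive, along_x; simpl.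
  - change (fun a0 b0 : R => a a0 b0) with a. change (fun a0 b0 : R => b a0 b0) with b. ring.
  - rewrite !dx_const, !dy_const; ring.
Qed.

Lemma lie_transform_0 d Y X : (0 < d)%nat -> lie_transform d Y X 0 = X 0%nat.
Proof.
  intros Hd; apply vfield_ext; intros x y; unfold lie_transform; simpl;
    rewrite Nat.Div0.div_0_l; simpl; field.
Qed.

Lemma lie_transform_1_1 Y X : lie_transform 1 Y X 1 =
  (fun x y => (fst (X 1%nat x y) + fst (bracket Y (X 0%nat) x y),
               snd (X 1%nat x y) + snd (bracket Y (X 0%nat) x y))).
Proof. apply vfield_ext; intros x y; unfold lie_transform; simpl; field. Qed.

Lemma lie_transform_1_2 Y X : lie_transform 1 Y X 2 =
  (fun x y => (fst (X 2%nat x y) + fst (bracket Y (X 1%nat) x y) + / 2 * fst (bracket Y (bracket Y (X 0%nat)) x y),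
               snd (X 2%nat x y) + snd (bracket Y (X 1%nat) x y) + / 2 * snd (bracket Y (bracket Y (X 0%nat)) x y))).
Proof. apply vfield_ext; intros x y; unfold lie_transform; simpl; field. Qed.

Lemma lie_transform_2_1 Y X : lie_transform 2 Y X 1 = X 1%nat.
Proof. apply vfield_ext; intros x y; unfold lie_transform; simpl; field. Qed.

Lemma lie_transform_2_2 Y X : lie_transform 2 Y X 2 =
  (fun x y => (fst (X 2%nat x y) + fst (bracket Y (X 0%nat) x y),
               snd (X 2%nat x y) + snd (bracket Y (X 0%nat) x y))).
Proof. apply vfield_ext; intros x y; unfold lie_transform; simpl; field. Qed.

(** The coefficient of d/dx in the degree two part of the transformed field. *)
Definition second_order_part (om s : R) (a1 a2 h : R -> R -> R) : R -> R -> R :=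
  fun x y => s + (a1 x y * dx h x y - h x y * dx a1 x y)
   + / 2 * (a1 x y * dx (fun x y => - flow_derive om a1 x y) x y
            - (- flow_derive om a1 x y) * dx a1 x y) - flow_derive om a2 x y.

(** Only finitely many terms of the two Lie series have degree at most two. *)
Lemma normal_form om s h a1 a2 (G : nat -> vfield) :
  G 0%nat = (fun _ _ => (om, 1)) -> G 1%nat = along_x h -> G 2%nat = along_x (fun _ _ => s) ->
  let N := lie_transform 2 (along_x a2) (lie_transform 1 (along_x a1) G) in
  N 0%nat = (fun _ _ => (om, 1)) /\
  N 1%nat = along_x (fun x y => h x y - flow_derive om a1 x y) /\
  N 2%nat = along_x (second_order_part om s a1 a2 h).
Proof.
  intros G0 G1 G2 N. unfold N.
  rewrite lie_transform_0, lie_transform_2_1, lie_transform_2_2 by lia.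
  rewrite lie_transform_0, lie_transform_1_1, lie_transform_1_2 by lia.
  rewrite G0, G1, G2, !bracket_along_x_const, !bracket_along_x.
  split; [reflexivity|]. split; apply vfield_ext; intros x y; unfold along_x; simpl; try ring.
  unfold second_order_part; ring.
Qed.

(** The three parts are recovered from the values of the field at the parameters
rescaled by 0, 1 and -1. *)
Lemma degree_parts_oscillator p q f g G P x y : degree_parts (oscillator p q f g) G ->
  G 0%nat P x y = (IZR p / IZR q, 1) /\
  G 1%nat P x y = (eta P * f x + eps P * g y, 0) /\
  G 2%nat P x y = (sigma P, 0).
Proof.
  intros [Hh Hs].
  assert (E : forall t,
    IZR p / IZR q + t ^ 2 * sigma P + t * eta P * f x + t * eps P * g y =
      fst (G 0%nat P x y) + t * fst (G 1%nat P x y) + t ^ 2 * fst (G 2%nat P x y) /\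
    1 = snd (G 0%nat P x y) + t * snd (G 1%nat P x y) + t ^ 2 * snd (G 2%nat P x y)).
  { intros t. assert (S := Hs (rescale t P) x y). unfold oscillator in S; simpl sigma in S; simpl eta in S; simpl eps in S.
    rewrite !(proj1 (Hh _ x y)), !(proj2 (Hh _ x y)) in S.
    split; [generalize (f_equal fst S) | generalize (f_equal snd S)]; simpl; lra. }
  destruct (E 0) as [A0 B0], (E 1) as [A1 B1], (E (-1)) as [A2 B2].
  rewrite (surjective_pairing (G 0%nat P x y)), (surjective_pairing (G 1%nat P x y)),
    (surjective_pairing (G 2%nat P x y)).
  repeat split; f_equal; lra.
Qed.

(** * The second-order terms and their averages *)

Definition linear_drive (f g : R -> R) (P : param) : R -> R -> R :=
  fun x y => eta P * f x + eps P * g y.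

Definition oscillator_part (p q : Z) (f g : R -> R) (d : nat) (P : param) : vfield :=
  match d with
  | 0%nat => fun _ _ => (IZR p / IZR q, 1)
  | 1%nat => along_x (linear_drive f g P)
  | 2%nat => along_x (fun _ _ => sigma P)
  | _ => along_x (fun _ _ => 0)
  end.

(** With K = antider w, this is the coefficient of eta^2 (for w = f(x)) and of
eta eps (for w = g(y)) in the second-order terms.  Both have this form because
these terms are eta times a function depending linearly on X_1. *)
Definition quadratic_source (p q : Z) (f : R -> R) (w : R -> R -> R) : R -> R -> R :=
  fun x y =>
    / 2 * (antider p q w x y * Derive f x
           - IZR q / IZR p * (w x y + avg p q w x y) * (f x - RInt f 0 1)).

Definition quadratic_drive (p q : Z) (f g : R -> R) (P : param) : R -> R -> R :=
  fun x y => eta P ^ 2 * quadratic_source p q f (fun x _ => f x) x y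
           + eta P * eps P * quadratic_source p q f (fun _ y => g y) x y.

Lemma dx_lin c d a b x y : smooth2 a -> smooth2 b ->
  dx (fun x y => c * a x y + d * b x y) x y = c * dx a x y + d * dx b x y.
Proof.
  intros Ha Hb; apply is_derive_unique.
  apply (is_derive_plus (fun s => c * a s y) (fun s => d * b s y));
    [apply (is_derive_scal (fun s => a s y)) | apply (is_derive_scal (fun s => b s y))];
    apply smooth2_is_dx; auto.
Qed.
Lemma dx_fst f x y : dx (fun x _ => f x) x y = Derive f x.
Proof. reflexivity. Qed.
Lemma dx_snd g x y : dx (fun _ y => g y) x y = 0.
Proof. exact (Derive_const (g y) x). Qed.
Lemma dy_fst f x y : dy (fun x _ => f x) x y = 0.
Proof. exact (Derive_const (f x) y). Qed.
Lemma dx_scal_l c a x y : dx (fun x y => c * a x y) x y = c * dx a x y.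
Proof. exact (Derive_scal (fun s => a s y) c x). Qed.
Lemma dy_scal_l c a x y : dy (fun x y => c * a x y) x y = c * dy a x y.
Proof. exact (Derive_scal (fun s => a x s) c y). Qed.
Lemma flow_derive_scal om c a x y :
  flow_derive om (fun x y => c * a x y) x y = c * flow_derive om a x y.
Proof. unfold flow_derive; rewrite dx_scal_l, dy_scal_l; ring. Qed.

Lemma antider_zero p q x y : antider p q (fun _ _ => 0) x y = 0.
Proof.
  unfold antider, flow_int. rewrite (RInt_ext_all _ (fun _ => 0)) by (intros; ring).
  rewrite RInt_const_R; real_equation; ring.
Qed.

Lemma periodic2_fst f : periodic f -> periodic2 (fun x _ => f x).
Proof. intros H x y; auto. Qed.
Lemma periodic2_snd f : periodic f -> periodic2 (fun _ y => f y).
Proof. intros H x y; auto. Qed.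
Lemma periodic2_lin c d a b : periodic2 a -> periodic2 b ->
  periodic2 (fun x y => c * a x y + d * b x y).
Proof.
  intros Ha Hb x y. rewrite (proj1 (Ha x y)), (proj1 (Hb x y)), (proj2 (Ha x y)), (proj2 (Hb x y)); auto.
Qed.
Lemma smooth2_lin c d a b : smooth2 a -> smooth2 b -> smooth2 (fun x y => c * a x y + d * b x y).
Proof. intros; apply smooth2_plus; apply smooth2_scal; auto. Qed.

Lemma antider_lin p q c d a b x y : Cts2 a -> Cts2 b ->
  antider p q (fun x y => c * a x y + d * b x y) x y = c * antider p q a x y + d * antider p q b x y.
Proof.
  intros Ca Cb; unfold antider.
  assert (W : Cts (fun t => (t - IZR q / 2) / IZR q)) by cts.
  rewrite (flow_int_plus _ _ _ (fun x y => c * a x y) (fun x y => d * b x y)) by (auto; cts).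
  rewrite !flow_int_scal by auto. reflexivity.
Qed.
Lemma avg_lin p q c d a b x y : Cts2 a -> Cts2 b ->
  avg p q (fun x y => c * a x y + d * b x y) x y = c * avg p q a x y + d * avg p q b x y.
Proof.
  intros Ca Cb.
  rewrite (avg_plus p q (fun x y => c * a x y) (fun x y => d * b x y)) by cts.
  rewrite !avg_scal by auto. reflexivity.
Qed.

(** For functions of [x] alone, the derivative along the flow is p/q times the
ordinary derivative, so T f' is q/p times f minus its mean. *)
Lemma antider_derive_fst p q f x y : (0 < p)%Z -> (0 < q)%Z -> smooth f -> periodic f ->
  antider p q (fun x _ => Derive f x) x y = IZR q / IZR p * (f x - RInt f 0 1).
Proof.
  intros Hp Hq Hs HP. assert (P := IZR_lt _ _ Hp). assert (Q := IZR_lt _ _ Hq).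
  assert (S2 := smooth2_fst f Hs).
  assert (A := antider_spec p q (fun x _ => f x) x y Hq S2 (periodic2_fst f HP)).
  rewrite avg_fst in A by (auto using smooth_Cts).
  unfold flow_derive, antider in A. rewrite dx_flow_int, dy_flow_int in A by (auto; try lra; cts).
  fold (antider p q (dx (fun x _ => f x)) x y) (antider p q (dy (fun x _ => f x)) x y) in A.
  replace (dy (fun x _ => f x)) with (fun _ _ : R => 0) in A
    by (apply fun2_ext; intros; symmetry; exact (Derive_const _ _)).
  rewrite antider_zero in A. change (dx (fun x _ => f x)) with (fun x (_ : R) => Derive f x) in A.
  rewrite <- A. field; lra.
Qed.

Lemma dx_antider_drive p q f g P x y : (0 < p)%Z -> (0 < q)%Z ->
  smooth f -> periodic f -> smooth g ->
  dx (antider p q (linear_drive f g P)) x y = eta P * (IZR q / IZR p * (f x - RInt f 0 1)).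
Proof.
  intros Hp Hq Hs HP Hg. assert (Q := IZR_lt _ _ Hq).
  assert (S1 := smooth2_fst f Hs). assert (S2 := smooth2_snd g Hg).
  unfold antider at 1. rewrite dx_flow_int; [| lra | cts | apply smooth2_lin; auto].
  fold (antider p q (dx (linear_drive f g P)) x y).
  rewrite <- (antider_derive_fst p q f x y) by auto.
  assert (S1' := smooth2_fst _ (smooth_Derive f Hs)).
  replace (dx (linear_drive f g P)) with (fun x y : R => eta P * Derive f x + 0 * 0).
  - rewrite (antider_lin p q (eta P) 0 (fun x _ => Derive f x) (fun _ _ => 0)).
    + ring.
    + apply smooth2_Cts2, S1'.
    + cts.
  - apply fun2_ext; intros x' y'. unfold linear_drive.
    rewrite (dx_lin (eta P) (eps P) (fun x _ => f x) (fun _ y => g y)) by auto.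
    rewrite dx_fst, dx_snd. ring.
Qed.

(** For a1 = T X_1, the inner bracket with X_0 is m - X_1, so half of the bracket
[a1, X_1] cancels in the Lie series. *)
Lemma second_order_part_antider p q f g P a2 x y : (0 < p)%Z -> (0 < q)%Z ->
  smooth f -> periodic f -> smooth g -> periodic g ->
  second_order_part (IZR p / IZR q) (sigma P) (antider p q (linear_drive f g P)) a2
    (linear_drive f g P) x y
  = sigma P + quadratic_drive p q f g P x y - flow_derive (IZR p / IZR q) a2 x y.
Proof.
  intros Hp Hq Hf Pf Hg Pg. assert (Pp := IZR_lt _ _ Hp). assert (Q := IZR_lt _ _ Hq).
  assert (S1 := smooth2_fst f Hf). assert (S2 := smooth2_snd g Hg).
  assert (P1 := periodic2_fst f Pf). assert (P2 := periodic2_snd g Pg).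
  assert (SH : smooth2 (linear_drive f g P)) by (apply smooth2_lin; auto).
  assert (PH : periodic2 (linear_drive f g P)) by (apply periodic2_lin; auto).
  set (m := eta P * RInt f 0 1 + eps P * RInt g 0 1).
  assert (AV : forall x y, avg p q (linear_drive f g P) x y = m).
  { intros x' y'. unfold linear_drive.
    rewrite (avg_lin p q (eta P) (eps P) (fun x _ => f x) (fun _ y => g y)) by (apply smooth2_Cts2; auto).
    rewrite avg_fst, avg_snd by (auto using smooth_Cts). reflexivity. }
  assert (DA : forall x y, flow_derive (IZR p / IZR q) (antider p q (linear_drive f g P)) x y
      = linear_drive f g P x y - m).
  { intros x' y'. rewrite antider_spec, AV by auto. reflexivity. }
  assert (DH : dx (linear_drive f g P) x y = eta P * Derive f x).
  { unfold linear_drive. rewrite (dx_lin (eta P) (eps P) (fun x _ => f x) (fun _ y => g y)) by auto.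
    rewrite dx_fst, dx_snd. ring. }
  unfold second_order_part.
  replace (dx (fun x y => - flow_derive (IZR p / IZR q) (antider p q (linear_drive f g P)) x y) x y)
    with (- (eta P * Derive f x)).
  - rewrite DA, DH, dx_antider_drive by auto.
    unfold quadratic_drive, quadratic_source.
    rewrite avg_fst, avg_snd by (auto using smooth_Cts).
    unfold linear_drive. rewrite (antider_lin p q (eta P) (eps P) (fun x _ => f x) (fun _ y => g y))
      by (apply smooth2_Cts2; auto).
    unfold m. field; lra.
  - rewrite <- DH. symmetry; apply is_derive_unique.
    apply (is_derive_ext (fun s => m - linear_drive f g P s y)).
    + intros s; rewrite DA. real_equation; ring.
    + replace (- dx (linear_drive f g P) x y) with (0 - dx (linear_drive f g P) x y) by ring.
      apply (is_derive_minus (fun _ => m) (fun s => linear_drive f g P s y)).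
      * apply (is_derive_const m).
      * apply smooth2_is_dx, SH.
Qed.

Lemma flow_derive_mult om a b x y : smooth2 a -> smooth2 b ->
  flow_derive om (fun x y => a x y * b x y) x y =
  flow_derive om a x y * b x y + a x y * flow_derive om b x y.
Proof.
  intros Ha Hb; unfold flow_derive.
  replace (dx (fun x y => a x y * b x y) x y) with (dx a x y * b x y + a x y * dx b x y).
  replace (dy (fun x y => a x y * b x y) x y) with (dy a x y * b x y + a x y * dy b x y).
  - ring.
  - symmetry; apply is_derive_unique.
    apply (is_derive_mult (fun s => a x s) (fun s => b x s));
      try (apply smooth2_is_dy; auto); intros; apply Rmult_comm.
  - symmetry; apply is_derive_unique.
    apply (is_derive_mult (fun s => a s y) (fun s => b s y));
      try (apply smooth2_is_dx; auto); intros; apply Rmult_comm.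
Qed.

Lemma flow_derive_fst om f x y : flow_derive om (fun x _ => f x) x y = om * Derive f x.
Proof. unfold flow_derive. rewrite dx_fst, dy_fst. ring. Qed.

Lemma smooth2_quadratic_source p q f w : (0 < q)%Z -> smooth f -> smooth2 w ->
  smooth2 (quadratic_source p q f w).
Proof.
  intros Hq Hf Hw. apply smooth2_scal, smooth2_minus.
  - apply smooth2_mult; [apply smooth2_antider; auto | apply (smooth2_fst (Derive f)), smooth_Derive, Hf].
  - apply (smooth2_mult (fun x y => IZR q / IZR p * (w x y + avg p q w x y))).
    + apply smooth2_scal, smooth2_plus; auto. apply smooth2_avg; auto.
    + apply smooth2_minus; [apply smooth2_fst, Hf | apply smooth2_const].
Qed.

Lemma periodic2_quadratic_source p q f w : smooth f -> periodic f -> periodic2 w ->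
  periodic2 (quadratic_source p q f w).
Proof.
  intros Hf Pf Pw x y. unfold quadratic_source.
  rewrite (proj1 (Pw x y)), (proj2 (Pw x y)), Pf.
  rewrite (periodic_derive f (Derive f) (fun x => smooth_is_derive f x Hf) Pf).
  rewrite (proj1 (periodic2_antider p q w Pw x y)), (proj2 (periodic2_antider p q w Pw x y)).
  rewrite (proj1 (periodic2_avg p q w Pw x y)), (proj2 (periodic2_avg p q w Pw x y)). auto.
Qed.

(** Writing K for T w, the product rule gives K f' = q/p (D (K f) - (w - w0) f).  The
term D (K f) has mean zero, and what remains is explicit in w and f. *)
Lemma avg_quadratic_source p q f w w0 x y : (0 < p)%Z -> (0 < q)%Z ->
  smooth f -> periodic f -> smooth2 w -> periodic2 w -> (forall x y, avg p q w x y = w0) ->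
  avg p q (quadratic_source p q f w) x y =
  - (IZR q / IZR p) * (avg p q (fun x y => w x y * f x) x y - RInt f 0 1 * w0).
Proof.
  intros Hp Hq Hf Pf Hw Pw Hm. assert (Pp := IZR_lt _ _ Hp). assert (Q := IZR_lt _ _ Hq).
  set (r := IZR q / IZR p). set (f0 := RInt f 0 1). set (om := IZR p / IZR q).
  assert (S1 := smooth2_fst f Hf). assert (P1 := periodic2_fst f Pf).
  set (Kf := fun x y => antider p q w x y * f x).
  assert (SK : smooth2 Kf) by (apply smooth2_mult; auto; apply smooth2_antider; auto).
  assert (PK : periodic2 Kf) by (apply periodic2_mult; auto; apply periodic2_antider; auto).
  assert (SM : smooth2 (fun x y => w x y * f x)) by (apply smooth2_mult; auto).
  assert (E : forall x y, quadratic_source p q f w x y =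
     (r / 2 * flow_derive om Kf x y + (- r) * (w x y * f x)) + (r / 2 * f0 * w x y + r / 2 * f0 * w0)).
  { intros x' y'. unfold Kf.
    rewrite (flow_derive_mult om (antider p q w) (fun x _ => f x)) by (auto; apply smooth2_antider; auto).
    rewrite flow_derive_fst. unfold om; rewrite antider_spec by auto.
    unfold quadratic_source. rewrite !Hm. fold f0. unfold r. field; lra. }
  rewrite (flow_int_ext _ _ _ _ _ x y E : avg p q _ x y = avg p q _ x y).
  assert (CK := smooth2_Cts2 _ (smooth2_flow_derive om _ SK)).
  assert (CM := smooth2_Cts2 _ SM). assert (CW := smooth2_Cts2 _ Hw).
  rewrite (avg_plus p q (fun x y => r / 2 * flow_derive om Kf x y + (- r) * (w x y * f x))
                        (fun x y => r / 2 * f0 * w x y + r / 2 * f0 * w0)).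
  - rewrite (avg_lin p q (r / 2) (- r) (flow_derive om Kf) (fun x y => w x y * f x)) by auto.
    unfold om; rewrite avg_flow_derive by auto.
    rewrite (avg_plus p q (fun x y => r / 2 * f0 * w x y) (fun _ _ => r / 2 * f0 * w0))
      by (try apply Cts2_const; apply Cts2_mult; auto; apply Cts2_const).
    rewrite avg_scal, avg_const, Hm by auto. field.
  - apply Cts2_plus; apply Cts2_mult; auto; apply Cts2_const.
  - apply Cts2_plus; [apply Cts2_mult; auto; apply Cts2_const | apply Cts2_const].
Qed.

(** * The vectorfield approximation *)

(** The term sigma, the mean of X_1, and the orbit mean of the second-order terms,
which is constant along the flow and hence read off at [y = 0]. *)
Definition averaged_field (p q : Z) (f g : R -> R) (P : param) (u : R) : R :=
  sigma P + (eta P * RInt f 0 1 + eps P * RInt g 0 1) + avg p q (quadratic_drive p q f g P) u 0.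

Lemma avg_drive p q f g P x y : (0 < p)%Z -> (0 < q)%Z ->
  smooth f -> periodic f -> smooth g -> periodic g ->
  avg p q (linear_drive f g P) x y = eta P * RInt f 0 1 + eps P * RInt g 0 1.
Proof.
  intros Hp Hq Hf Pf Hg Pg. unfold linear_drive.
  rewrite (avg_lin p q (eta P) (eps P) (fun x _ => f x) (fun _ y => g y))
    by (apply smooth2_Cts2; auto using smooth2_fst, smooth2_snd).
  rewrite avg_fst, avg_snd by (auto using smooth_Cts). reflexivity.
Qed.

Lemma smooth2_drive f g P : smooth f -> smooth g -> smooth2 (linear_drive f g P).
Proof. intros; apply smooth2_lin; auto using smooth2_fst, smooth2_snd. Qed.
Lemma periodic2_drive f g P : periodic f -> periodic g -> periodic2 (linear_drive f g P).
Proof. intros; apply periodic2_lin; auto using periodic2_fst, periodic2_snd. Qed.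
Lemma smooth2_second p q f g P : (0 < q)%Z -> smooth f -> smooth g -> smooth2 (quadratic_drive p q f g P).
Proof.
  intros Hq Hf Hg; apply smooth2_lin; apply smooth2_quadratic_source; auto using smooth2_fst, smooth2_snd.
Qed.
Lemma periodic2_second p q f g P : smooth f -> periodic f -> periodic g ->
  periodic2 (quadratic_drive p q f g P).
Proof.
  intros Hf Pf Pg; apply periodic2_lin; apply periodic2_quadratic_source;
    auto using periodic2_fst, periodic2_snd.
Qed.

Lemma invariant_resonant_field p q b : (0 < q)%Z -> smooth2 b -> periodic2 b ->
  flow_invariant (IZR p / IZR q) b -> resonant_field p q (along_x b).
Proof.
  intros Hq Hs HP HI; split; [reflexivity|]. intros k l Hn.
  apply (invariant_nonresonant p q b k l); auto using smooth2_Cts2.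
Qed.

Lemma generator_antider p q d (h : param -> R -> R -> R) : (0 < q)%Z ->
  (forall P, smooth2 (h P)) -> (forall P, periodic2 (h P)) ->
  (forall x y, homogeneous d (fun P => h P x y)) ->
  generator p q d (fun P => antider p q (h P)).
Proof.
  intros Hq Hs HP Hh; split.
  - intros x y t P.
    assert (W : Cts (fun t => (t - IZR q / 2) / IZR q)) by cts.
    unfold antider. rewrite <- flow_int_scal by (auto; apply smooth2_Cts2; auto).
    apply flow_int_ext; intros x' y'. apply Hh.
  - intros P; split; [apply smooth2_antider; auto|]. split; [apply periodic2_antider; auto|].
    intros k l; apply antider_resonant; auto. apply smooth2_Cts2; auto.
Qed.

(** With these generators, each degree of the transformed field is replaced by its
orbit mean. *)
Lemma averaged_field_approximation p q f g : (0 < p)%Z -> (0 < q)%Z ->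
  smooth f -> periodic f -> smooth g -> periodic g ->
  vf_approximation p q (oscillator p q f g) (averaged_field p q f g).
Proof.
  intros Hp Hq Hf Pf Hg Pg. assert (Q := IZR_lt _ _ Hq).
  exists (oscillator_part p q f g).
  exists (fun P => antider p q (linear_drive f g P)), (fun P => antider p q (quadratic_drive p q f g P)).
  split; [|split; [|split]].
  - split.
    + intros [|[|[|d]]] x y; split; intros t P;
        unfold oscillator_part, along_x, linear_drive; simpl; ring.
    + intros P x y; unfold oscillator, oscillator_part, along_x, linear_drive; simpl. f_equal; ring.
  - apply generator_antider; auto using smooth2_drive, periodic2_drive.
    intros x y t P; unfold linear_drive; simpl; ring.
  - apply generator_antider; auto using smooth2_second, periodic2_second.
    intros x y t P; unfold quadratic_drive; simpl; ring.
  - intros P N.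
    destruct (normal_form (IZR p / IZR q) (sigma P) (linear_drive f g P)
      (antider p q (linear_drive f g P)) (antider p q (quadratic_drive p q f g P))
      (fun d => oscillator_part p q f g d P) eq_refl eq_refl eq_refl) as [N0 [N1 N2]].
    set (m := eta P * RInt f 0 1 + eps P * RInt g 0 1).
    assert (SD := smooth2_drive f g P Hf Hg). assert (PD := periodic2_drive f g P Pf Pg).
    assert (SS := smooth2_second p q f g P Hq Hf Hg). assert (PS := periodic2_second p q f g P Hf Pf Pg).
    assert (E1 : N 1%nat = along_x (fun _ _ => m)).
    { unfold N; etransitivity; [exact N1|]. f_equal. apply fun2_ext; intros x y.
      rewrite antider_spec, avg_drive by auto. unfold m; ring. }
    assert (E2 : N 2%nat = along_x (fun x y => sigma P + avg p q (quadratic_drive p q f g P) x y)).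
    { unfold N; etransitivity; [exact N2|]. f_equal. apply fun2_ext; intros x y.
      rewrite second_order_part_antider, antider_spec by auto. ring. }
    assert (E0 : N 0%nat = (fun _ _ => (IZR p / IZR q, 1))) by exact N0.
    assert (IA := avg_invariant p q _ Hq SS PS).
    intros Wx Wy. split; [|split].
    + rewrite E1. apply invariant_resonant_field; auto using smooth2_const.
      * intros x y; auto.
      * intros x y s; auto.
    + rewrite E2. apply invariant_resonant_field; auto.
      * apply smooth2_plus; [apply smooth2_const | apply smooth2_avg; auto].
      * intros x y. rewrite (proj1 (periodic2_avg p q _ PS x y)), (proj2 (periodic2_avg p q _ PS x y)); auto.
      * intros x y s; rewrite IA; auto.
    + intros x y; unfold Wx, Wy. rewrite E0, E1, E2. unfold along_x; simpl. split; [|ring].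
      unfold averaged_field. fold m. rewrite (invariant_section _ _ x y IA). ring.
Qed.

(** The degree one part is first shown to be constant along the flow, then equal to
its mean; this determines the first generator, and the degree two part follows
by averaging. *)
Lemma vf_approximation_unique p q f g V : (0 < p)%Z -> (0 < q)%Z -> Z.gcd p q = 1%Z ->
  smooth f -> periodic f -> smooth g -> periodic g ->
  vf_approximation p q (oscillator p q f g) V ->
  forall P u, V P u = averaged_field p q f g P u.
Proof.
  intros Hp Hq Hgcd Hf Pf Hg Pg [G [a1 [a2 [HG [[Ha1 Hb1] [[Ha2 Hb2] HN]]]]]] P u.
  assert (Q := IZR_lt _ _ Hq). set (om := IZR p / IZR q) in *.
  assert (SD := fun P => smooth2_drive f g P Hf Hg). assert (PD := fun P => periodic2_drive f g P Pf Pg).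
  set (n1 := fun P x y => linear_drive f g P x y - flow_derive om (a1 P) x y).
  set (n2 := fun P => second_order_part om (sigma P) (a1 P) (a2 P) (linear_drive f g P)).
  assert (HV : forall P x y, V P (x - om * y) = n1 P x y + n2 P x y).
  { intros P' x y.
    assert (D := fun x y => degree_parts_oscillator p q f g G P' x y HG).
    destruct (normal_form om (sigma P') (linear_drive f g P') (a1 P') (a2 P') (fun d => G d P'))
      as [N0 [N1 N2]].
    - apply vfield_ext; intros x' y'; destruct (D x' y') as [-> _]; reflexivity.
    - apply vfield_ext; intros x' y'; destruct (D x' y') as [_ [-> _]]; reflexivity.
    - apply vfield_ext; intros x' y'; destruct (D x' y') as [_ [_ ->]]; reflexivity.
    - destruct (HN P') as [_ [_ HW]]. destruct (HW x y) as [HW1 _].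
      rewrite N0, N1, N2 in HW1. unfold along_x in HW1; simpl in HW1. fold om in HW1.
      rewrite <- HW1. unfold n1, n2. ring. }
  (* The reflection eta, eps -> -eta, -eps separates degree one from degree two *)
  set (P' := rescale (-1) P).
  assert (A1 : a1 P' = fun x y => -1 * a1 P x y).
  { apply fun2_ext; intros x y. etransitivity; [exact (Ha1 x y (-1) P) | cbv beta; simpl; ring]. }
  assert (A2 : a2 P' = a2 P).
  { apply fun2_ext; intros x y. etransitivity; [exact (Ha2 x y (-1) P) | cbv beta; simpl; ring]. }
  assert (AH : linear_drive f g P' = fun x y => -1 * linear_drive f g P x y).
  { apply fun2_ext; intros x y. unfold linear_drive, P'; simpl; ring. }
  assert (N1 : forall x y, n1 P' x y = - n1 P x y).
  { intros x y; unfold n1. rewrite AH, A1, flow_derive_scal. ring. }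
  assert (N2 : forall x y, n2 P' x y = n2 P x y).
  { intros x y; unfold n2, second_order_part. rewrite AH, A1, A2, !dx_scal_l, flow_derive_scal.
    replace (fun x y => - flow_derive om (fun x y => -1 * a1 P x y) x y) with
      (fun x y => -1 * (- flow_derive om (a1 P) x y))
      by (apply fun2_ext; intros; rewrite flow_derive_scal; ring).
    rewrite dx_scal_l. unfold P'; simpl; ring. }
  assert (F1 : forall x y, n1 P x y = (V P (x - om * y) - V P' (x - om * y)) / 2).
  { intros x y; rewrite !HV, N1, N2; field. }
  assert (I1 : flow_invariant om (n1 P)).
  { intros x y s. rewrite !F1. replace (x + om * s - om * (y + s)) with (x - om * y) by ring. reflexivity. }
  assert (F2 : forall x y, n2 P x y = (V P (x - om * y) + V P' (x - om * y)) / 2).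
  { intros x y; rewrite !HV, N1, N2; field. }
  assert (I2 : flow_invariant om (n2 P)).
  { intros x y s. rewrite !F2. replace (x + om * s - om * (y + s)) with (x - om * y) by ring. reflexivity. }
  destruct (Hb1 P) as [Sa1 [Pa1 Ra1]]. destruct (Hb2 P) as [Sa2 [Pa2 _]].
  set (m := eta P * RInt f 0 1 + eps P * RInt g 0 1).
  assert (M1 : forall x y, n1 P x y = m).
  { intros x y. rewrite <- (avg_of_invariant p q (n1 P) x y Hq I1).
    assert (E : forall x y, n1 P x y = linear_drive f g P x y + -1 * flow_derive om (a1 P) x y)
      by (intros; unfold n1; ring).
    unfold avg. rewrite (flow_int_ext _ _ _ _ _ x y E).
    fold (avg p q (fun x y => linear_drive f g P x y + -1 * flow_derive om (a1 P) x y) x y).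
    assert (CD := smooth2_Cts2 _ (SD P)). assert (CF := smooth2_Cts2 _ (smooth2_flow_derive om _ Sa1)).
    rewrite (avg_plus p q (linear_drive f g P) (fun x y => -1 * flow_derive om (a1 P) x y))
      by (auto; apply Cts2_mult; auto; apply Cts2_const).
    rewrite avg_scal by auto. unfold om; rewrite avg_flow_derive, avg_drive by auto. unfold m; ring. }
  assert (EA : a1 P = antider p q (linear_drive f g P)).
  { set (b := fun x y => a1 P x y - antider p q (linear_drive f g P) x y).
    assert (SA := smooth2_antider p q _ Hq (SD P)).
    assert (PA := periodic2_antider p q _ (PD P)).
    assert (Sb : smooth2 b) by (apply smooth2_minus; auto).
    assert (Db : forall x y, flow_derive om b x y = 0).
    { intros x y.
      replace b with (fun x y => 1 * a1 P x y + -1 * antider p q (linear_drive f g P) x y)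
        by (apply fun2_ext; intros; unfold b; ring).
      assert (X : flow_derive om (fun x y => 1 * a1 P x y + -1 * antider p q (linear_drive f g P) x y) x y =
         flow_derive om (a1 P) x y - flow_derive om (antider p q (linear_drive f g P)) x y).
      { unfold flow_derive. rewrite dx_lin by auto.
        replace (dy (fun x y => 1 * a1 P x y + -1 * antider p q (linear_drive f g P) x y) x y) with
          (1 * dy (a1 P) x y + -1 * dy (antider p q (linear_drive f g P)) x y); [ring|].
        symmetry; apply is_derive_unique.
        apply (is_derive_plus (fun s => 1 * a1 P x s) (fun s => -1 * antider p q (linear_drive f g P) x s));
          [apply (is_derive_scal (fun s => a1 P x s)) | apply (is_derive_scal (fun s => antider p q (linear_drive f g P) x s))];
          apply smooth2_is_dy; auto. }
      rewrite X. assert (Y := antider_spec p q _ x y Hq (SD P) (PD P)).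
      rewrite avg_drive in Y by auto. fold m om in Y. rewrite Y.
      generalize (M1 x y); unfold n1; lra. }
    assert (Z : forall x y, b x y = 0).
    { apply (invariant_coef_zero p q b Hp Hq Hgcd Sb).
      - intros x y; unfold b. rewrite (proj1 (Pa1 x y)), (proj2 (Pa1 x y)), (proj1 (PA x y)), (proj2 (PA x y)); auto.
      - intros x y s. apply (flow_constant om b x y s Sb Db).
      - intros k l Hr; unfold b. rewrite fcoef2_minus by (apply smooth2_Cts2; auto).
        rewrite Ra1, antider_resonant by (auto; apply smooth2_Cts2; auto).
        apply Cplus_opp_r. }
    apply fun2_ext; intros x y; generalize (Z x y); unfold b; lra. }
  assert (M2 : n2 P u 0 = sigma P + avg p q (quadratic_drive p q f g P) u 0).
  { rewrite <- (avg_of_invariant p q (n2 P) u 0 Hq I2).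
    assert (E : forall x y, n2 P x y = (sigma P + quadratic_drive p q f g P x y) + -1 * flow_derive om (a2 P) x y).
    { intros x y; unfold n2. rewrite EA. unfold om; rewrite second_order_part_antider by auto. ring. }
    unfold avg at 1. rewrite (flow_int_ext _ _ _ _ _ u 0 E).
    fold (avg p q (fun x y => (sigma P + quadratic_drive p q f g P x y) + -1 * flow_derive om (a2 P) x y) u 0).
    assert (CS := smooth2_Cts2 _ (smooth2_second p q f g P Hq Hf Hg)).
    assert (CF := smooth2_Cts2 _ (smooth2_flow_derive om _ Sa2)).
    assert (CC := Cts2_const (sigma P)).
    rewrite (avg_plus p q (fun x y => sigma P + quadratic_drive p q f g P x y) (fun x y => -1 * flow_derive om (a2 P) x y))
      by (try apply Cts2_plus; auto; apply Cts2_mult; auto; apply Cts2_const).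
    rewrite (avg_plus p q (fun _ _ => sigma P) (quadratic_drive p q f g P)) by auto.
    rewrite avg_scal, avg_const by auto. unfold om; rewrite avg_flow_derive by auto. ring. }
  unfold averaged_field. fold m.
  replace u with (u - om * 0) at 1 by ring. rewrite HV, M1, M2. ring.
Qed.

(** Averaging preserves the resonant coefficients of the product f(x) g(y). *)
Lemma averaged_product_series p q f g u : (0 < p)%Z -> (0 < q)%Z -> Z.gcd p q = 1%Z ->
  smooth f -> periodic f -> smooth g -> periodic g ->
  is_zseries (fun m => fcoef f (m * q) * fcoef g (- (m * p)) * expi (2 * PI * IZR m * IZR q * u))%C
    (RtoC (avg p q (fun x y => f x * g y) u 0)).
Proof.
  intros Hp Hq Hgcd Hf Pf Hg Pg.
  set (h := fun x y => f x * g y).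
  assert (Sh : smooth2 h) by (apply smooth2_mult; auto using smooth2_fst, smooth2_snd).
  assert (Ph : periodic2 h) by (apply periodic2_mult; auto using periodic2_fst, periodic2_snd).
  destruct (invariant_series p q (avg p q h) u Hp Hq Hgcd (smooth2_avg p q h Hq Sh)
    (periodic2_avg p q h Ph) (avg_invariant p q h Hq Sh Ph)) as [s1 [s2 [H1 [H2 H3]]]].
  assert (E : forall m, fcoef2 (avg p q h) (m * q) (- (m * p)) = (fcoef f (m * q) * fcoef g (- (m * p)))%C).
  { intros m. rewrite avg_resonant; auto using smooth2_Cts2.
    - apply fcoef2_tensor; apply smooth_Cts; auto.
    - unfold resonant_index; ring. }
  exists s1, s2. split; [|split; [|exact H3]].
  - eapply (is_series_ext (V := C_R_NormedModule)); [|exact H1]. intros n; cbv beta. rewrite E; reflexivity.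
  - eapply (is_series_ext (V := C_R_NormedModule)); [|exact H2]. intros n; cbv beta. rewrite E; reflexivity.
Qed.

(** On the orbit of slope 1 through the origin, the mean of f(x) f(y) is the integral
of f^2. *)
Lemma square_series f : smooth f -> periodic f ->
  is_zseries (fun k => fcoef f k * fcoef f (- k))%C (RtoC (RInt (fun x => f x * f x) 0 1)).
Proof.
  intros Hf Pf. assert (Cf := smooth_Cts f Hf).
  destruct (averaged_product_series 1 1 f f 0 ltac:(lia) ltac:(lia) eq_refl Hf Pf Hf Pf)
    as [s1 [s2 [H1 [H2 H3]]]].
  assert (E : avg 1 1 (fun x y => f x * f y) 0 0 = RInt (fun x => f x * f x) 0 1).
  { unfold avg, flow_int. apply RInt_ext_all; intros t. rewrite Rinv_1, Rmult_1_l.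
    f_equal; f_equal; field. }
  rewrite E in H3.
  assert (X : forall k : Z, (fcoef f (k * 1) * fcoef f (- (k * 1)) * expi (2 * PI * IZR k * IZR 1 * 0))%C =
     (fcoef f k * fcoef f (- k))%C).
  { intros k. rewrite Z.mul_1_r, Rmult_0_r. unfold expi. rewrite cos_0, sin_0.
    change ((1, 0) : C) with (RtoC 1). apply Cmult_1_r. }
  exists s1, s2. split; [|split; [|exact H3]].
  - eapply (is_series_ext (V := C_R_NormedModule)); [|exact H1]. intros n; exact (X (Z.of_nat n)).
  - eapply (is_series_ext (V := C_R_NormedModule)); [|exact H2]. intros n; exact (X (- Z.of_nat (S n))%Z).
Qed.

(** Only the two orbit means of f(x)^2 and f(x) g(y) remain after
[avg_quadratic_source]; the rest is arithmetic. *)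
Lemma averaged_field_value p q f g P u : (0 < p)%Z -> (0 < q)%Z ->
  smooth f -> periodic f -> smooth g -> periodic g ->
  averaged_field p q f g P u =
  sigma P - IZR q / IZR p * (eta P ^ 2 * RInt (fun x => f x * f x) 0 1
     + eps P * eta P * avg p q (fun x y => f x * g y) u 0)
  + (eta P * RInt f 0 1 + eps P * RInt g 0 1) * (1 + IZR q / IZR p * eta P * RInt f 0 1).
Proof.
  intros Hp Hq Hf Pf Hg Pg. assert (C := smooth_Cts f Hf).
  unfold averaged_field.
  assert (S1 := smooth2_fst f Hf). assert (S2 := smooth2_snd g Hg).
  assert (P1 := periodic2_fst f Pf). assert (P2 := periodic2_snd g Pg).
  unfold quadratic_drive.
  rewrite (avg_lin p q (eta P ^ 2) (eta P * eps P) (quadratic_source p q f (fun x _ => f x))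
     (quadratic_source p q f (fun _ y => g y))) by (apply smooth2_Cts2, smooth2_quadratic_source; auto).
  rewrite (avg_quadratic_source p q f (fun x _ => f x) (RInt f 0 1)) by
    (auto; intros; apply avg_fst; auto).
  rewrite (avg_quadratic_source p q f (fun _ y => g y) (RInt g 0 1)) by
    (auto; intros; apply avg_snd; auto using smooth_Cts).
  rewrite (avg_fst p q (fun x => f x * f x)); auto.
  - replace (avg p q (fun x y => g y * f x) u 0) with (avg p q (fun x y => f x * g y) u 0)
      by (apply flow_int_ext; intros; apply Rmult_comm).
    ring.
  - cts.
  - intros x; rewrite Pf; reflexivity.
Qed.

Theorem theorem3p1 :
  forall (p q : Z) (alpha lambda : R) (f : R -> R),
    (0 < p)%Z -> (0 < q)%Z -> Z.gcd p q = 1%Z ->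
    0 < alpha -> 0 <= lambda <= 1 ->
    smooth f -> periodic f ->
    (forall k : Z,
       fcoef (forcing alpha lambda) k = forcing_coef alpha lambda k) /\
    exists V : param -> R -> R,
      vf_approximation p q (oscillator p q f (forcing alpha lambda)) V /\
      (forall V' : param -> R -> R,
         vf_approximation p q (oscillator p q f (forcing alpha lambda)) V' ->
         forall P u, V' P u = V P u) /\
      exists (S1 : C) (S2 : R -> C),
        is_zseries (fun k => fcoef f k * fcoef f (- k))%C S1 /\
        (forall u : R,
           is_zseries
             (fun m => fcoef f (m * q) * forcing_coef alpha lambda (- (m * p))
                       * expi (2 * PI * IZR m * IZR q * u))%C (S2 u)) /\
        forall (P : param) (u : R),
          let mean :=
            (RtoC (eta P) * fcoef f 0
             + RtoC (eps P) * forcing_coef alpha lambda 0)%C in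
          let r := RtoC (IZR q / IZR p) in
          RtoC (V P u) =
            (RtoC (sigma P)
             - r * (RtoC (eta P) ^ 2 * S1 + RtoC (eps P) * RtoC (eta P) * S2 u)
             + mean * (1 + r * RtoC (eta P) * fcoef f 0))%C.
Proof.
  intros p q al la f Hp Hq Hgcd Ha Hl Hf Pf.
  assert (HC := fun k => fcoef_forcing al la k Ha Hl).
  assert (Hg := smooth_forcing al la Ha Hl). assert (Pg := periodic_forcing al la Ha Hl).
  set (g := forcing al la) in *.
  split; [exact HC|].
  exists (averaged_field p q f g). split; [apply averaged_field_approximation; auto|].
  split; [intros V' HV'; apply vf_approximation_unique; auto|].
  exists (RtoC (RInt (fun x => f x * f x) 0 1)), (fun u => RtoC (avg p q (fun x y => f x * g y) u 0)).
  split; [apply square_series; auto|]. split.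
  - intros u.
    destruct (averaged_product_series p q f g u Hp Hq Hgcd Hf Pf Hg Pg) as [s1 [s2 [H1 [H2 H3]]]].
    exists s1, s2. split; [|split; [|exact H3]].
    + eapply (is_series_ext (V := C_R_NormedModule)); [|exact H1].
      intros n; cbv beta. rewrite HC; reflexivity.
    + eapply (is_series_ext (V := C_R_NormedModule)); [|exact H2].
      intros n; cbv beta. rewrite HC; reflexivity.
  - intros P u mean r. unfold mean, r. rewrite <- HC, !RtoC_mean by (apply smooth_Cts; auto).
    rewrite averaged_field_value by auto.
    rewrite RtoC_plus, RtoC_minus, !RtoC_mult, !RtoC_plus, !RtoC_mult, RtoC_pow. reflexivity.
Qed.
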